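(* Let $(K,\partial_t)$ be an algebraically closed differential field of characteristic zero, and consider $K(x)$ as a $\partial\partial_t$-field with $\partial=d/dx$ and $\partial_t(x)=0$. Let $L\in K[\partial_t]$ be nonzero. Then $\mathbb G_m^{L\circ\triangle}$ is a PPV-group over $K(x)$ if and only if $L\circ\partial_t$ has a fundamental set of solutions inside $K$; and $\mathbb G_a^L$ is a PPV-group over $K(x)$ if and only if $L$ has a fundamental set of solutions inside $K$.
   Context: A PPV-ring for $\partial(y)=Ay$ ($A\in F^{n\times n}$) over a $\partial\partial_t$-field $F$ (two commuting derivations) is a $\partial\partial_t$-ring extension $R/F$ with: (i) some $Y\in\mathrm{GL}_n(R)$, $\partial(Y)=AY$, such that $R$ is generated over $F$ by the entries of $Y$, $\det(Y)^{-1}$ and all their $\partial_t$-derivatives; (ii) $C_R=C_F$, $C_R=\{r:\partial r=0\}$; (iii) $R$ is $\partial$-simple. Its PPV-group $\mathrm{Gal}_Y(R/F)\le\mathrm{GL}_n$ has $S$-points $\{Y^{-1}\sigma(Y):\sigma\in\mathrm{Aut}^{\partial\partial_t}(R\otimes_KS/F\otimes_KS)\}$ for $\partial_t$-$K$-algebras $S$. A linear $\partial_t$-algebraic group is a PPV-group over $F$ if it is (in some faithful representation) $\mathrm{Gal}_Y(R/F)$ for some PPV-ring $R$ over $F$. $\mathbb G_a^L(S)=\{\mu\in S: L(\mu)=0\}$ and $\mathbb G_m^{L\circ\triangle}(S)=\{\lambda\in S^\times: L(\partial_t(\lambda)/\lambda)=0\}$. A fundamental set of solutions of an operator of order $d$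 inside $K$ means $d$ solutions in $K$ linearly independent over $K^{\partial_t}$. *)

(* Defs.v *)
From HB Require Import structures.
From mathcomp Require Import all_boot all_order all_algebra all_field.
Set Implicit Arguments. Unset Strict Implicit. Unset Printing Implicit Defensive.
Import GRing.Theory.
Local Open Scope ring_scope.

Definition is_derivation (R : ringType) (D : R -> R) : Prop :=
  (forall a b, D (a + b) = D a + D b) /\ (forall a b, D (a * b) = D a * b + a * D b).

(* Application of an operator L = sum_i L_i dt^i in K[dt] (coefficients on the
   left) to an element u of a dt-K-algebra S (structure map kS, derivation dS). *)
Definition apply_op (K : fieldType) (S : ringType) (kS : K -> S) (dS : S -> S)
  (L : {poly K}) (u : S) : S :=
  \sum_(i < size L) kS L`_i * iter i dS u.

Definition dt_alg (K : fieldType) (dK : K -> K) (S : comRingType)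
  (kS : {rmorphism K -> S}) (dS : S -> S) : Prop :=
  is_derivation dS /\ forall k, dS (kS k) = kS (dK k).

Definition dt_alg_hom (K : fieldType) (S S' : comRingType)
  (kS : {rmorphism K -> S}) (kS' : {rmorphism K -> S'}) (dS : S -> S) (dS' : S' -> S')
  (h : {rmorphism S -> S'}) : Prop :=
  (forall k, h (kS k) = kS' k) /\ (forall s, h (dS s) = dS' (h s)).

Definition Ga_pt (K : fieldType) (L : {poly K}) (S : comRingType)
  (kS : {rmorphism K -> S}) (dS : S -> S) (u : S) : Prop :=
  apply_op kS dS L u = 0.

Definition Gm_pt (K : fieldType) (L : {poly K}) (S : comRingType)
  (kS : {rmorphism K -> S}) (dS : S -> S) (u : S) : Prop :=
  exists v, u * v = 1 /\ apply_op kS dS L (dS u * v) = 0.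

Definition is_tensor (K : fieldType) (R S T : comRingType)
  (kR : K -> R) (kS : K -> S) (jR : {rmorphism R -> T}) (jS : {rmorphism S -> T}) : Prop :=
  (forall k, jR (kR k) = jS (kS k)) /\
  forall (U : comRingType) (a : {rmorphism R -> U}) (b : {rmorphism S -> U}),
    (forall k, a (kR k) = b (kS k)) ->
    exists h : {rmorphism T -> U},
      (forall r, h (jR r) = a r) /\ (forall s, h (jS s) = b s) /\
      forall h' : {rmorphism T -> U},
        (forall r, h' (jR r) = a r) -> (forall s, h' (jS s) = b s) -> forall t, h' t = h t.

(* S-points of the PPV-group Gal_Y(R/F):
   { Y^-1 sigma(Y) | sigma in Aut^{dd_t}(R (x)_K S / F (x)_K S) },
   with the derivations d (x) 0 and d_t (x) d_S on R (x)_K S. *)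
Definition Gal_pt (K F : fieldType) (inK : {rmorphism K -> F}) (dK : K -> K)
  (R : comRingType) (iF : {rmorphism F -> R}) (dR dtR : R -> R) (n : nat) (Y : 'M[R]_n)
  (S : comRingType) (kS : {rmorphism K -> S}) (dS : S -> S) (g : 'M[S]_n) : Prop :=
  (exists g', g *m g' = 1%:M) /\
  exists (T : comRingType) (jR : {rmorphism R -> T}) (jS : {rmorphism S -> T})
         (dT dtT : T -> T) (sigma : {rmorphism T -> T}),
    is_tensor (fun k => iF (inK k)) kS jR jS /\
    is_derivation dT /\ is_derivation dtT /\
    (forall r, dT (jR r) = jR (dR r)) /\ (forall s, dT (jS s) = 0) /\
    (forall r, dtT (jR r) = jR (dtR r)) /\ (forall s, dtT (jS s) = jS (dS s)) /\
    bijective sigma /\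
    (forall t, sigma (dT t) = dT (sigma t)) /\ (forall t, sigma (dtT t) = dtT (sigma t)) /\
    (forall f, sigma (jR (iF f)) = jR (iF f)) /\ (forall s, sigma (jS s) = jS s) /\
    map_mx jR Y *m map_mx jS g = map_mx (fun r => sigma (jR r)) Y.

Definition PPV_ring (F : fieldType) (dF dtF : F -> F) (R : comRingType)
  (iF : {rmorphism F -> R}) (dR dtR : R -> R) (n : nat) (A : 'M[F]_n) (Y : 'M[R]_n) : Prop :=
  is_derivation dR /\ is_derivation dtR /\ (forall r, dR (dtR r) = dtR (dR r)) /\
  (forall f, dR (iF f) = iF (dF f)) /\ (forall f, dtR (iF f) = iF (dtF f)) /\
  map_mx dR Y = map_mx iF A *m Y /\
  (exists dinv : R, \det Y * dinv = 1 /\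
     forall P : R -> Prop,
       P 1 -> (forall a b, P a -> P b -> P (a - b)) -> (forall a b, P a -> P b -> P (a * b)) ->
       (forall f, P (iF f)) ->
       (forall k i j, P (iter k dtR (Y i j))) -> (forall k, P (iter k dtR dinv)) ->
       forall r, P r) /\
  (forall r, dR r = 0 -> exists f, r = iF f) /\
  (1 != 0 :> R) /\
  (forall I : R -> Prop,
     I 0 -> (forall a b, I a -> I b -> I (a + b)) -> (forall a b, I b -> I (a * b)) ->
     (forall a, I a -> I (dR a)) ->
     (forall r, I r -> r = 0) \/ (forall r, I r)).

(* The linear dt-algebraic group G (given by its functor of points Gpt on
   dt-K-algebras, with group law Gmul) is a PPV-group over F: it is isomorphic
   (natural isomorphism of group functors on dt-K-algebras) to Gal_Y(R/F) for
   some PPV-ring R over F. *)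
Definition is_PPV_group (K F : fieldType) (inK : {rmorphism K -> F}) (dK : K -> K)
  (dF dtF : F -> F)
  (Gpt : forall S : comRingType, {rmorphism K -> S} -> (S -> S) -> S -> Prop)
  (Gmul : forall S : comRingType, S -> S -> S) : Prop :=
  exists (n : nat) (A : 'M[F]_n) (R : comRingType) (iF : {rmorphism F -> R})
         (dR dtR : R -> R) (Y : 'M[R]_n),
    PPV_ring dF dtF iF dR dtR A Y /\
    exists phi : forall S : comRingType, {rmorphism K -> S} -> (S -> S) -> S -> 'M[S]_n,
      (forall S kS dS, dt_alg dK kS dS ->
         (forall u, Gpt S kS dS u -> Gal_pt inK dK iF dR dtR Y kS dS (phi S kS dS u)) /\
         (forall u v, Gpt S kS dS u -> Gpt S kS dS v -> phi S kS dS u = phi S kS dS v -> u = v) /\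
         (forall g, Gal_pt inK dK iF dR dtR Y kS dS g ->
                    exists u, Gpt S kS dS u /\ phi S kS dS u = g) /\
         (forall u v, Gpt S kS dS u -> Gpt S kS dS v ->
                    phi S kS dS (Gmul S u v) = phi S kS dS u *m phi S kS dS v)) /\
      (forall (S S' : comRingType) kS kS' dS dS' (h : {rmorphism S -> S'}),
         dt_alg dK kS dS -> dt_alg dK kS' dS' -> dt_alg_hom kS kS' dS dS' h ->
         forall u, Gpt S kS dS u -> phi S' kS' dS' (h u) = map_mx h (phi S kS dS u)).

Definition fundamental_set (K : fieldType) (dK : K -> K) (P : {poly K}) : Prop :=
  exists f : 'I_(size P).-1 -> K,
    (forall i, apply_op id dK P (f i) = 0) /\
    forall c : 'I_(size P).-1 -> K,
      (forall i, dK (c i) = 0) -> \sum_i c i * f i = 0 -> forall i, c i = 0.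

Definition is_Kx_dfield (K F : fieldType) (inK : {rmorphism K -> F}) (dK : K -> K)
  (x : F) (dF dtF : F -> F) : Prop :=
  (forall p : {poly K}, (map_poly inK p).[x] = 0 -> p = 0) /\
  (forall f, exists p q : {poly K},
       (map_poly inK q).[x] != 0 /\ f * (map_poly inK q).[x] = (map_poly inK p).[x]) /\
  is_derivation dF /\ is_derivation dtF /\ (forall f, dF (dtF f) = dtF (dF f)) /\
  (forall k, dF (inK k) = 0) /\ dF x = 1 /\
  (forall k, dtF (inK k) = inK (dK k)) /\ dtF x = 0.

(* Main.v *)
Require Import Defs.
From HB Require Import structures.
From mathcomp Require Import all_boot all_order all_algebra all_field.
From mathcomp Require Import boolp ring zify.
From mathcomp Require classical_sets.
Import GRing.Theory.
Local Open Scope ring_scope.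
Set Implicit Arguments. Unset Strict Implicit. Unset Printing Implicit Defensive.

(** Necessity. If R/F is a PPV-ring with group G, then R (x)_F R = R (x)_K C with C its
ring of d-constants, so Y (x) 1 and 1 (x) Y differ by a universal C-point of G. For G inside
Ga or Gm this point is a cocycle u of R (x)_F R, and contracting the cocycle identity with an
F-linear functional of R (Hilbert 90) gives w in R with u = w (x) 1 - 1 (x) w, resp.
w (x) 1 = u (1 (x) w). Hence d(w) = b, resp. d(w) = b w, with b in K(x), and an operator M
kills the universal point iff M(b), resp. M(dt b), is a d-derivative in K(x), i.e. iff it
kills the residues of b, resp. their dt-derivatives. Since no operator of order less than that
of L kills all points, these residues span a full solution space over the constants of K.

Sufficiency. From solutions f_i of L one takes R = F[log (x - i)], on which the group acts by
log (x - i) |-> log (x - i) + a_i with dt a_i = 0, and mu = sum_i a_i f_i identifies it with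
Ga^L. If the f_i = dt h_i solve L, adjoining w = exp(x) prod_i (x - i)^(h_i) and its inverse
gives Gm^(L o dlog). *)

(** * Derivations and their constants *)

(** The group is known only through its functor of points, so there is no coordinate ring to start
    from. The ring [C] takes its place: the matrix that compares [Y (x) 1] with [1 (x) Y] is a point
    over [C] from which every other point is obtained by a ring map. Operators [M] in [K[dt]] then
    link the two sides of the equivalence. Whether [M] kills the universal point is a question of
    exactness in [K(x)]; if [M] kills all points, its order is bounded below by that of [L]. Points
    over [K] are too few for this bound, since [L] may have no nonzero solution in [K], so it is
    tested on a generic infinitesimal solution, with values in a square-zero extension of [K]. In
    the multiplicative case the solutions of [L] that appear are [dt]-derivatives of residues, that
    is, of elements of [K]. This is why the criterion concerns [L] composed with [dt]: the solutions
    must have antiderivatives in [K], and these antiderivatives are the exponents [h_i] of the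
    converse. *)

Lemma rmorph_of (R S : comNzRingType) (f : R -> S) :
  (forall a b, f (a + b) = f a + f b) -> f 1 = 1 ->
  (forall a b, f (a * b) = f a * f b) ->
  exists h : {rmorphism R -> S}, forall r, h r = f r.
Proof.
move=> fD f1 fM.
have f0 : f 0 = 0 by apply: (addIr (f 0)); rewrite -fD !add0r.
have fN a : f (- a) = - f a by apply: (addIr (f a)); rewrite -fD !addNr.
have fB : zmod_morphism f by move=> a b; rewrite fD fN.
have fm : monoid_morphism f by split.
pose i1 := GRing.isZmodMorphism.Build R S f fB.
pose i2 := GRing.isMonoidMorphism.Build R S f fm.
pose h : {rmorphism R -> S} := HB.pack f i1 i2.
by exists h.
Qed.

Section DerivationTheory.
Variables (R : nzRingType) (D : R -> R) (hD : is_derivation D).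

Lemma derD a b : D (a + b) = D a + D b. Proof. by case: hD. Qed.
Lemma derM a b : D (a * b) = D a * b + a * D b. Proof. by case: hD. Qed.
Lemma der0 : D 0 = 0.
Proof. by apply: (addIr (D 0)); rewrite -derD !add0r. Qed.
Lemma derN a : D (- a) = - D a.
Proof. by apply: (addIr (D a)); rewrite -derD !addNr der0. Qed.
Lemma derB a b : D (a - b) = D a - D b. Proof. by rewrite derD derN. Qed.
Lemma der1 : D 1 = 0.
Proof. by apply: (addIr (D 1)); rewrite add0r -{3}[1]mul1r derM mulr1 mul1r. Qed.
Lemma der_sum I (r : seq I) (P : pred I) (f : I -> R) :
  D (\sum_(i <- r | P i) f i) = \sum_(i <- r | P i) D (f i).
Proof. by apply: (big_morph D derD der0). Qed.
Lemma der_nat n : D n%:R = 0.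
Proof. by elim: n => [|n IH]; rewrite ?der0 // -natr1 derD IH der1 addr0. Qed.
Lemma der_iterD n a b : iter n D (a + b) = iter n D a + iter n D b.
Proof. by elim: n => //= n ->; rewrite derD. Qed.
Lemma der_iterB n a b : iter n D (a - b) = iter n D a - iter n D b.
Proof. by elim: n => //= n ->; rewrite derB. Qed.

Lemma der_mulmx m n p (M : 'M[R]_(m, n)) (N : 'M[R]_(n, p)) :
  map_mx D (M *m N) = map_mx D M *m N + M *m map_mx D N.
Proof.
apply/matrixP=> i j; rewrite !mxE der_sum -big_split /=.
by apply: eq_bigr => k _; rewrite derM !mxE.
Qed.
End DerivationTheory.

Section Constants.
Variables (T : comNzRingType) (D : T -> T) (hD : is_derivation D).

(** The proof that [D] is a derivation is an argument, so that the subring structure can be attached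
    to the predicate itself. *)
Definition cst_pred (h : is_derivation D) : {pred T} := fun t => D t == 0.

Lemma cst_pred_subring : subring_closed (cst_pred hD).
Proof.
split=> [|a b|a b]; rewrite /in_mem /= /cst_pred.
- by rewrite (der1 hD).
- by move=> /eqP a0 /eqP b0; rewrite (derB hD) a0 b0 subr0.
- by move=> /eqP a0 /eqP b0; rewrite (derM hD) a0 b0 mul0r mulr0 addr0.
Qed.
HB.instance Definition _ := GRing.isSubringClosed.Build T (cst_pred hD) cst_pred_subring.

Record csts := Csts {cst_val : T; cst_valP : cst_val \in cst_pred hD}.
HB.instance Definition _ := [isSub for cst_val].
HB.instance Definition _ := [Choice of csts by <:].
HB.instance Definition _ := [SubChoice_isSubComNzRing of csts by <:].

Lemma cst_val0 (c : csts) : D (cst_val c) = 0.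
Proof. by apply/eqP; case: c. Qed.

Lemma csts_of t : D t = 0 -> exists c : csts, cst_val c = t.
Proof. by move=> t0; have tP : t \in cst_pred hD; [apply/eqP | exists (Csts tP)]. Qed.

Lemma cst_inj : injective cst_val. Proof. exact: val_inj. Qed.
End Constants.

(** * Tensor products of algebras over a field *)

Section Functionals.
Variables (k : fieldType) (R : comNzRingType) (kR : {rmorphism k -> R}).

Definition klinear (f : R -> k) : Prop :=
  (forall a b, f (a + b) = f a + f b) /\ (forall c r, f (kR c * r) = c * f r).

Definition ksubspace (W : R -> Prop) : Prop :=
  W 0 /\ (forall a b, W a -> W b -> W (a + b)) /\ (forall c a, W a -> W (kR c * a)).

Lemma ksubspaceB W a b : ksubspace W -> W a -> W b -> W (a - b).
Proof.
case=> _ [WD WZ] Wa Wb; apply: WD => //.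
by rewrite -mulN1r -(rmorph1 kR) -rmorphN; apply: WZ.
Qed.


(** A subspace that is maximal among those containing [W] and missing [v] is a complement of the
    line of [v]; the functional is the coordinate along [v]. Zorn's lemma is used because [R] may
    have infinite dimension. *)
Lemma klinear_sep (W : R -> Prop) v : ksubspace W -> ~ W v ->
  exists f, klinear f /\ (forall w, W w -> f w = 0) /\ f v = 1.
Proof.
move=> sW nWv.
pose P (A : R -> Prop) := (forall z, ~ A z) \/
  [/\ ksubspace A, forall z, W z -> A z & ~ A v].
have [|A [PA Amax]] := @classical_sets.Zorn_bigcup R P.
  move=> C CP Ct.
  have [[A0 [CA0 [z0 Az0]]]|nC] := pselect (exists A0, C A0 /\ exists z, A0 z); last first.
    by left=> z [A CA Az]; apply: nC; exists A; split=> //; exists z.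
  have good A z : C A -> A z -> [/\ ksubspace A, forall z, W z -> A z & ~ A v].
    by move=> CA Az; case: (CP A CA) => // /(_ z).
  right; split.
  - split; first by exists A0 => //; case: (good _ _ CA0 Az0) => -[].
    split.
      move=> a b [A CA Aa] [B CB Bb].
      have [AB|BA] := Ct _ _ CA CB.
        exists B => //; have [[_ [BD _]] _ _] := good _ _ CB Bb.
        by apply: BD => //; apply: AB.
      exists A => //; have [[_ [AD _]] _ _] := good _ _ CA Aa.
      by apply: AD => //; apply: BA.
    move=> c a [A CA Aa]; exists A => //.
    by have [[_ [_ AZ]] _ _] := good _ _ CA Aa; apply: AZ.
  - by move=> z Wz; exists A0 => //; have [_ + _] := good _ _ CA0 Az0; apply.
  - by move=> [A CA Av]; have [_ _] := good _ _ CA Av.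
have {PA} [sA WA nAv] : [/\ ksubspace A, forall z, W z -> A z & ~ A v].
  case: PA => // A0; exfalso; apply: (Amax W); last by right.
  split; first by move=> z /A0.
  by move=> /(_ 0 sW.1) /A0.
have [A00 [AD AZ]] := sA.
have split z : exists c, A (z - kR c * v).
  have [Az|nAz] := pselect (A z); first by exists 0; rewrite rmorph0 mul0r subr0.
  (* [B] is [A + k z], strictly larger than [A]; by maximality it contains [v], and solving that
     relation for [z] gives the scalar. *)
  pose B y := exists c, A (y - kR c * z).
  have [|nBv] := pselect (B v).
    move=> [c Ac].
    have [c0|c0] := eqVneq c 0; first by case: nAv; move: Ac; rewrite c0 rmorph0 mul0r subr0.
    exists c^-1; have := AZ (- c^-1) _ Ac.
    rewrite mulrBr mulrA -rmorphM mulNr mulVf //.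
    by rewrite !rmorphN rmorph1 mulN1r opprK mulNr addrC.
  exfalso; apply: (Amax B).
    split; first by move=> y Ay; exists 0; rewrite rmorph0 mul0r subr0.
    by move=> /(_ z) BA; apply: nAz; apply: BA; exists 1; rewrite rmorph1 mul1r subrr.
  right; split=> //.
  - split; first by exists 0; rewrite rmorph0 mul0r subr0.
    split.
      move=> a b [c Ac] [d Ad]; exists (c + d).
      by rewrite rmorphD mulrDl opprD addrACA; apply: AD.
    move=> e a [c Ac]; exists (e * c).
    by rewrite rmorphM -mulrA -mulrBr; apply: AZ.
  - by move=> y /WA Ay; exists 0; rewrite rmorph0 mul0r subr0.
have uniq c d z : A (z - kR c * v) -> A (z - kR d * v) -> c = d.
  move=> Ac Ad; apply/eqP; rewrite -subr_eq0; apply/eqP; apply: contrapT => /eqP cd.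
  apply: nAv; have := AZ (c - d)^-1 _ (ksubspaceB sA Ad Ac).
  rewrite opprB [_ + (_ - z)]addrC addrA subrK -mulrBl -rmorphB mulrA -rmorphM.
  by rewrite mulVf // rmorph1 mul1r.
pose f z := sval (cid (split z)).
have fP z : A (z - kR (f z) * v) := svalP (cid (split z)).
exists f; split; first split.
- move=> a b; apply: (uniq _ _ (a + b)) => //.
  by rewrite rmorphD mulrDl opprD addrACA; apply: AD.
- move=> c r; apply: (uniq _ _ (kR c * r)) => //.
  by rewrite rmorphM -mulrA -mulrBr; apply: AZ.
split.
  move=> w /WA Aw; apply: (uniq _ _ w) => //.
  by rewrite rmorph0 mul0r subr0.
by apply: (uniq _ _ v) => //; rewrite rmorph1 mul1r subrr.
Qed.

(** A [k]-linear retraction of [R] onto [k]: it makes tensor products nonzero, their second factor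
    embedded, and it drives the descent from [R] to [F]. *)
Lemma klinear_one : exists f, klinear f /\ f 1 = 1.
Proof.
have [| |f [fl [_ f1]]] := @klinear_sep (fun z => z = 0) 1.
- by split=> //; split=> [a b -> ->|c a ->]; rewrite ?addr0 ?mulr0.
- exact/eqP/oner_neq0.
by exists f.
Qed.
End Functionals.

Section Tensor.
Variables (k : fieldType) (R S : comNzRingType).
Variables (kR : {rmorphism k -> R}) (kS : {rmorphism k -> S}).

Definition balanced (M : zmodType) (b : R -> S -> M) : Prop :=
  [/\ forall r r' s, b (r + r') s = b r s + b r' s,
      forall r s s', b r (s + s') = b r s + b r s' &
      forall c r s, b (kR c * r) s = b r (kS c * s)].

Definition tsum (M : zmodType) (b : R -> S -> M) (l : seq (R * S)) : M :=
  \sum_(p <- l) b p.1 p.2.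

(** Two formal sums are identified when no balanced map separates them. The universal property then
    holds by construction, and an identity between tensors is checked on balanced maps. *)
Definition tensor_rel (l l' : seq (R * S)) : bool :=
  `[< forall (M : zmodType) (b : R -> S -> M), balanced b -> tsum b l = tsum b l' >].

Lemma tensor_rel_refl : reflexive tensor_rel.
Proof. by move=> l; apply/asboolP. Qed.
Lemma tensor_rel_sym : symmetric tensor_rel.
Proof. by move=> l l'; apply/asboolP/asboolP=> h M b bb; rewrite h. Qed.
Lemma tensor_rel_trans : transitive tensor_rel.
Proof.
by move=> l l' l'' /asboolP h /asboolP h'; apply/asboolP=> M b bb; rewrite h ?h'.
Qed.
Canonical tensor_equiv :=
  EquivRel tensor_rel tensor_rel_refl tensor_rel_sym tensor_rel_trans.

Definition tensor := {eq_quot tensor_rel}%qT.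
HB.instance Definition _ := Choice.on tensor.

Definition tlift (M : zmodType) (b : R -> S -> M) (t : tensor) : M :=
  tsum b (repr t).

Lemma tlift_pi (M : zmodType) (b : R -> S -> M) l : balanced b ->
  tlift b (\pi_tensor l)%qT = tsum b l.
Proof.
move=> bb; rewrite /tlift.
have /eqmodP/asboolP/(_ M b bb) // : (repr (\pi_tensor l)%qT) = l %[mod tensor]%qT.
by rewrite reprK.
Qed.

Lemma tensorP (t t' : tensor) :
  (forall (M : zmodType) (b : R -> S -> M), balanced b -> tlift b t = tlift b t') ->
  t = t'.
Proof.
move=> h; rewrite -[t]reprK -[t']reprK; apply/eqmodP/asboolP=> M b bb.
exact: h.
Qed.

Definition tzero : tensor := (\pi_tensor [::])%qT.
Definition tadd (t t' : tensor) : tensor := (\pi_tensor (repr t ++ repr t'))%qT.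
Definition topp (t : tensor) : tensor :=
  (\pi_tensor [seq (- p.1, p.2) | p <- repr t])%qT.
Definition pure (r : R) (s : S) : tensor := (\pi_tensor [:: (r, s)])%qT.

Lemma tlift0 (M : zmodType) (b : R -> S -> M) : balanced b -> tlift b tzero = 0.
Proof. by move=> bb; rewrite tlift_pi // /tsum big_nil. Qed.
Lemma tliftD (M : zmodType) (b : R -> S -> M) t t' : balanced b ->
  tlift b (tadd t t') = tlift b t + tlift b t'.
Proof. by move=> bb; rewrite tlift_pi // /tsum big_cat. Qed.
Lemma balanced0l (M : zmodType) (b : R -> S -> M) s : balanced b -> b 0 s = 0.
Proof. by case=> bD _ _; apply: (addIr (b 0 s)); rewrite -bD !add0r. Qed.
Lemma balanced0r (M : zmodType) (b : R -> S -> M) r : balanced b -> b r 0 = 0.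
Proof. by case=> _ bD _; apply: (addIr (b r 0)); rewrite -bD !add0r. Qed.
Lemma tliftN (M : zmodType) (b : R -> S -> M) t : balanced b -> tlift b (topp t) = - tlift b t.
Proof.
move=> bb; rewrite tlift_pi // /tlift /tsum big_map -sumrN.
apply: eq_bigr => -[r s] _ /=.
by apply: (addIr (b r s)); case: (bb) => bD _ _; rewrite -bD !addNr balanced0l.
Qed.

Fact taddA : associative tadd.
Proof. by move=> a b c; apply: tensorP => M f bf; rewrite !tliftD // addrA. Qed.
Fact taddC : commutative tadd.
Proof. by move=> a b; apply: tensorP => M f bf; rewrite !tliftD // addrC. Qed.
Fact tadd0 : left_id tzero tadd.
Proof. by move=> a; apply: tensorP => M f bf; rewrite tliftD // tlift0 // add0r. Qed.
Fact taddN : left_inverse tzero topp tadd.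
Proof. by move=> a; apply: tensorP => M f bf; rewrite tliftD // tliftN // addNr tlift0. Qed.
HB.instance Definition _ := GRing.isZmodule.Build tensor taddA taddC tadd0 taddN.

Lemma tlift_add (M : zmodType) (b : R -> S -> M) (t t' : tensor) : balanced b ->
  tlift b (t + t') = tlift b t + tlift b t'.
Proof. exact: tliftD. Qed.
Lemma tlift_pure (M : zmodType) (b : R -> S -> M) r s : balanced b -> tlift b (pure r s) = b r s.
Proof. by move=> bb; rewrite tlift_pi // /tsum big_seq1. Qed.

Lemma pure_balanced : balanced pure.
Proof.
split=> *; apply: tensorP => M f bf; rewrite ?tlift_add // !tlift_pure //; by case: bf.
Qed.
Lemma pureDl r r' s : pure (r + r') s = pure r s + pure r' s.
Proof. by case: pure_balanced. Qed.
Lemma pureDr r s s' : pure r (s + s') = pure r s + pure r s'.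
Proof. by case: pure_balanced. Qed.
Lemma pureZ c r s : pure (kR c * r) s = pure r (kS c * s).
Proof. by case: pure_balanced. Qed.
Lemma pure0l s : pure 0 s = 0. Proof. exact: balanced0l pure_balanced. Qed.
Lemma pure0r r : pure r 0 = 0. Proof. exact: balanced0r pure_balanced. Qed.
Lemma pureNl r s : pure (- r) s = - pure r s.
Proof. by apply: (addIr (pure r s)); rewrite -pureDl !addNr pure0l. Qed.

Lemma tensor_sum (t : tensor) : t = \sum_(p <- repr t) pure p.1 p.2.
Proof.
apply: tensorP => M b bb.
rewrite (big_morph (tlift b) (fun t t' => tlift_add t t' bb) (tlift0 bb)).
by apply: eq_bigr => p _; rewrite tlift_pure.
Qed.

Lemma tensor_ind (P : tensor -> Prop) :
  (forall r s, P (pure r s)) -> (forall t t', P t -> P t' -> P (t + t')) ->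
  forall t, P t.
Proof.
move=> Pp PD t; rewrite [t]tensor_sum; elim: (repr t) => [|p l IH].
  by rewrite big_nil -(pure0l 0).
by rewrite big_cons; apply: PD.
Qed.

Lemma tlift_balanced2 (M : zmodType) (b : R -> S -> R -> S -> M) t :
  (forall r s, balanced (b r s)) -> (forall r s, balanced (fun r' s' => b r' s' r s)) ->
  balanced (fun r s => tlift (b r s) t).
Proof.
move=> b1 b2; split=> [r r' s|r s s'|c r s]; elim/tensor_ind: t;
  try (by move=> t t' h h'; rewrite !tlift_add // h h' // addrACA);
  move=> u v; rewrite !tlift_pure //; by case: (b2 u v).
Qed.

Definition tmul (t t' : tensor) : tensor :=
  tlift (fun r s => tlift (fun r' s' => pure (r * r') (s * s')) t') t.

Lemma tmul_bal1 r s : balanced (fun r' s' => pure (r * r') (s * s')).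
Proof.
by split=> *; rewrite ?mulrDr ?pureDl ?pureDr // mulrCA pureZ mulrCA.
Qed.
Lemma tmul_bal2 r s : balanced (fun r' s' => pure (r' * r) (s' * s)).
Proof.
by split=> *; rewrite ?mulrDl ?pureDl ?pureDr // -mulrA pureZ mulrA.
Qed.
Lemma tmul_bal t : balanced (fun r s => tlift (fun r' s' => pure (r * r') (s * s')) t).
Proof. by apply: tlift_balanced2 => r s; [apply: tmul_bal1 | apply: tmul_bal2]. Qed.

Lemma tmul_pure r s r' s' : tmul (pure r s) (pure r' s') = pure (r * r') (s * s').
Proof. by rewrite /tmul tlift_pure ?tlift_pure //; [apply: tmul_bal1 | apply: tmul_bal]. Qed.
Fact tmulDl : left_distributive tmul +%R.
Proof. by move=> a b c; rewrite /tmul tlift_add //; apply: tmul_bal. Qed.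
Fact tmulC : commutative tmul.
Proof.
have aux r s (t : tensor) : tmul (pure r s) t = tmul t (pure r s).
  elim/tensor_ind: t => [r' s'|t t' h h']; first by rewrite !tmul_pure ![_ * r]mulrC ![_ * s]mulrC.
  rewrite tmulDl -h -h' /tmul !tlift_pure; try exact: tmul_bal.
  by rewrite tlift_add //; apply: tmul_bal1.
move=> a b; elim/tensor_ind: b => [r s|t t' h h']; first by rewrite aux.
rewrite tmulDl -h -h'; elim/tensor_ind: a {h h'} => [r s|u u' h h'].
  by rewrite !aux tmulDl.
by rewrite !tmulDl h h' addrACA.
Qed.
Fact tmulDr : right_distributive tmul +%R.
Proof. by move=> a b c; rewrite !(tmulC a) tmulDl. Qed.
Fact tmulA : associative tmul.
Proof.
move=> a b c; elim/tensor_ind: a => [r s|t t' h h']; last by rewrite !tmulDl h h'.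
elim/tensor_ind: b => [r1 s1|t t' h h']; last by rewrite tmulDl !tmulDr tmulDl h h'.
elim/tensor_ind: c => [r2 s2|t t' h h']; last by rewrite !tmulDr h h'.
by rewrite !tmul_pure !mulrA.
Qed.
Fact tmul1 : left_id (pure 1 1) tmul.
Proof.
move=> a; elim/tensor_ind: a => [r s|t t' h h']; last by rewrite tmulDr h h'.
by rewrite tmul_pure !mul1r.
Qed.

Lemma contractl_balanced f : klinear kR f -> balanced (fun r s => kS (f r) * s).
Proof.
case=> fD fZ; split=> *; rewrite ?fD ?rmorphD ?mulrDl ?mulrDr //.
by rewrite fZ rmorphM mulrAC mulrC.
Qed.
Lemma contractr_balanced g : klinear kS g -> balanced (fun r s => r * kR (g s)).
Proof.
case=> fD fZ; split=> *; rewrite ?fD ?rmorphD ?mulrDl ?mulrDr //.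
by rewrite fZ rmorphM mulrCA mulrA.
Qed.

(** Contracting the first factor with a functional that is 1 at 1 sends this tensor to 1 in [S]. *)
Fact tone_neq0 : pure 1 1 != 0.
Proof.
have [f [fl f1]] := klinear_one kR.
apply/eqP=> /(congr1 (tlift (fun r s => kS (f r) * s))).
rewrite (tlift0 (contractl_balanced fl)) tlift_pure; last exact: contractl_balanced.
by rewrite f1 rmorph1 mulr1; apply/eqP/oner_neq0.
Qed.
HB.instance Definition _ :=
  GRing.Zmodule_isComNzRing.Build tensor tmulA tmulC tmul1 tmulDl tone_neq0.

Lemma pureM r s r' s' : pure r s * pure r' s' = pure (r * r') (s * s').
Proof. exact: tmul_pure. Qed.

Definition tinl (r : R) : tensor := pure r 1.
Definition tinr (s : S) : tensor := pure 1 s.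
Fact tinl_add : zmod_morphism tinl.
Proof. by move=> a b; rewrite /tinl pureDl pureNl. Qed.
Fact tinl_mul : monoid_morphism tinl.
Proof. by split=> // a b; rewrite /tinl pureM mulr1. Qed.
HB.instance Definition _ := GRing.isZmodMorphism.Build R tensor tinl tinl_add.
HB.instance Definition _ := GRing.isMonoidMorphism.Build R tensor tinl tinl_mul.
Fact tinr_add : zmod_morphism tinr.
Proof.
move=> a b; rewrite /tinr pureDr; congr (_ + _).
by apply: (addIr (pure 1 b)); rewrite -pureDr !addNr pure0r.
Qed.
Fact tinr_mul : monoid_morphism tinr.
Proof. by split=> // a b; rewrite /tinr pureM mulr1. Qed.
HB.instance Definition _ := GRing.isZmodMorphism.Build S tensor tinr tinr_add.
HB.instance Definition _ := GRing.isMonoidMorphism.Build S tensor tinr tinr_mul.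

Lemma pureE r s : pure r s = tinl r * tinr s.
Proof. by rewrite pureM mulr1 mul1r. Qed.
Lemma tin_bal c : tinl (kR c) = tinr (kS c).
Proof. by rewrite /tinl -[kR c]mulr1 pureZ mulr1. Qed.

Lemma tensor_ring_ind (P : tensor -> Prop) :
  (forall r, P (tinl r)) -> (forall s, P (tinr s)) ->
  (forall t t', P t -> P t' -> P (t + t')) -> (forall t t', P t -> P t' -> P (t * t')) ->
  forall t, P t.
Proof. by move=> Pl Pr PD PM; apply: tensor_ind => // r s; rewrite pureE; apply: PM. Qed.

Section Maps.
Variables (U : comNzRingType) (a : {rmorphism R -> U}) (b : {rmorphism S -> U}).
Hypothesis ab : forall c, a (kR c) = b (kS c).

Lemma tensor_map : exists h : {rmorphism tensor -> U},
  (forall r, h (tinl r) = a r) /\ (forall s, h (tinr s) = b s).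
Proof.
have bal : balanced (fun r s => a r * b s).
  by split=> *; rewrite ?rmorphD ?mulrDl ?mulrDr // !rmorphM ab mulrCA mulrA.
have [||t t'|h hE] := @rmorph_of tensor U (tlift (fun r s => a r * b s)).
- by move=> t t'; rewrite tlift_add.
- by rewrite tlift_pure // !rmorph1 mulr1.
- elim/tensor_ind: t => [r s|u u' h h']; last by rewrite mulrDl !tlift_add // h h' mulrDl.
  elim/tensor_ind: t' => [r' s'|u u' h h']; last by rewrite mulrDr !tlift_add // h h' mulrDr.
  by rewrite pureM !tlift_pure // !rmorphM mulrACA.
by exists h; split=> u; rewrite hE tlift_pure // rmorph1 ?mulr1 ?mul1r.
Qed.
End Maps.

Lemma tensor_hom_ext (U : comNzRingType) (h h' : {rmorphism tensor -> U}) :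
  (forall r, h (tinl r) = h' (tinl r)) -> (forall s, h (tinr s) = h' (tinr s)) ->
  forall t, h t = h' t.
Proof.
move=> hl hr; apply: tensor_ring_ind => // t t' e e'; first by rewrite !rmorphD e e'.
by rewrite !rmorphM e e'.
Qed.

Lemma is_tensor_tensor : is_tensor kR kS tinl tinr.
Proof.
split; first exact: tin_bal.
move=> U a b ab; have [h [hl hr]] := tensor_map ab.
exists h; do 2?split=> //.
by move=> h' h'l h'r; apply: tensor_hom_ext => s; rewrite ?h'l ?h'r ?hl ?hr.
Qed.

Lemma tinr_inj : injective tinr.
Proof.
have [f [fl f1]] := klinear_one kR.
move=> s s' /(congr1 (tlift (fun r s => kS (f r) * s))).
by rewrite !tlift_pure ?f1 ?rmorph1 ?mul1r //; apply: contractl_balanced.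
Qed.

Section Derivation.
Variables (dk : k -> k) (D : R -> R) (E : S -> S).
Hypotheses (hD : is_derivation D) (hE : is_derivation E).
Hypotheses (Dk : forall c, D (kR c) = kR (dk c)) (Ek : forall c, E (kS c) = kS (dk c)).

Definition tder : tensor -> tensor := tlift (fun r s => pure (D r) s + pure r (E s)).

(** The two derivations must restrict to the same [dk] on [k]: the terms where a scalar is
    differentiated then match across the tensor sign. *)
Lemma tder_bal : balanced (fun r s => pure (D r) s + pure r (E s)).
Proof.
split=> [r r' s|r s s'|c r s].
- by rewrite (derD hD) !pureDl addrACA.
- by rewrite (derD hE) !pureDr addrACA.
rewrite (derM hD) (derM hE) Dk Ek pureDl pureDr (pureZ (dk c)) (pureZ c r).
by rewrite (pureZ c (D r)) [pure r _ + pure (D r) _]addrC addrA.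
Qed.

Lemma tder_pure r s : tder (pure r s) = pure (D r) s + pure r (E s).
Proof. exact: tlift_pure tder_bal. Qed.
Lemma tder_derivation : is_derivation tder.
Proof.
have tD a b : tder (a + b) = tder a + tder b by exact: tlift_add tder_bal.
split=> // a b; elim/tensor_ind: a => [r s|t t' h h']; last first.
  by rewrite mulrDl !tD !mulrDl h h' addrACA.
elim/tensor_ind: b => [r' s'|t t' h h']; last first.
  by rewrite mulrDr !tD !mulrDr h h' addrACA.
rewrite pureM !tder_pure mulrDl mulrDr !pureM (derM hD) (derM hE).
by rewrite pureDl pureDr addrACA.
Qed.
Lemma tder_inl r : tder (tinl r) = tinl (D r).
Proof. by rewrite tder_pure (der1 hE) pure0r addr0. Qed.
Lemma tder_inr s : tder (tinr s) = tinr (E s).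
Proof. by rewrite tder_pure (der1 hD) pure0l add0r. Qed.
End Derivation.
End Tensor.

(** The universal map to the concrete tensor product transports the injectivity of [tinr]. A plain
    function [f] appears because [Gal_pt] states its tensor product over [fun k => iF (inK k)],
    which is not a packaged morphism. *)
Lemma is_tensor_inj (k : fieldType) (R S T : comNzRingType) (kR : {rmorphism k -> R})
    (kS : {rmorphism k -> S}) (f : k -> R) (jR : {rmorphism R -> T}) (jS : {rmorphism S -> T}) :
  f =1 kR -> is_tensor f kS jR jS -> injective jS.
Proof.
move=> fE [_ univ].
have [|h [_ [hS _]]] := univ (tensor kR kS) (tinl kR kS) (tinr kR kS).
  by move=> c; rewrite fE; exact: (tin_bal kR kS).
by move=> s s' /(congr1 h); rewrite !hS; apply: tinr_inj.
Qed.

Lemma der_hom_eq (k : fieldType) (R S T : comNzRingType) (kR : {rmorphism k -> R})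
    (kS : {rmorphism k -> S}) (h : {rmorphism tensor kR kS -> T}) D E :
  is_derivation D -> is_derivation E ->
  (forall r, h (D (tinl kR kS r)) = E (h (tinl kR kS r))) ->
  (forall s, h (D (tinr kR kS s)) = E (h (tinr kR kS s))) ->
  forall t, h (D t) = E (h t).
Proof.
move=> hD hE hl hr; apply: tensor_ring_ind => // t t' e e'.
  by rewrite (derD hD) !rmorphD (derD hE) e e'.
by rewrite (derM hD) rmorphD !rmorphM (derM hE) e e'.
Qed.

(** * Linear differential operators *)

Section ApplyOp.
Variables (K : fieldType) (dK : K -> K) (S : comNzRingType) (kS : {rmorphism K -> S}).
Variables (dS : S -> S).
Hypothesis hS : dt_alg dK kS dS.
Let hd : is_derivation dS. Proof. by case: hS. Qed.
Notation "L @@ u" := (apply_op kS dS L u) (at level 40).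

Lemma apply_op_widen (L : {poly K}) u n : (size L <= n)%N ->
  L @@ u = \sum_(i < n) kS L`_i * iter i dS u.
Proof.
move=> le; rewrite /apply_op (big_ord_widen n (fun i => kS L`_i * iter i dS u)) //.
rewrite big_mkcond; apply: eq_bigr => i _; case: ltnP => // le'.
by rewrite nth_default // rmorph0 mul0r.
Qed.

Lemma apply_opD L M u : (L + M) @@ u = L @@ u + M @@ u.
Proof.
pose n := maxn (size L) (size M).
rewrite !(@apply_op_widen _ _ n) ?leq_maxl ?leq_maxr ?size_polyD //.
by rewrite -big_split; apply: eq_bigr => i _; rewrite coefD rmorphD mulrDl.
Qed.

Lemma apply_opZ c L u : (c *: L) @@ u = kS c * (L @@ u).
Proof.
rewrite (@apply_op_widen _ _ (size L)) ?size_scale_leq // mulr_sumr.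
by apply: eq_bigr => i _; rewrite coefZ rmorphM mulrA.
Qed.


Lemma apply_op1 u : 1 @@ u = u.
Proof. by rewrite /apply_op size_poly1 big_ord1 coef1 rmorph1 mul1r. Qed.

Lemma apply_op_add L u v : L @@ (u + v) = L @@ u + L @@ v.
Proof.
by rewrite -big_split; apply: eq_bigr => i _; rewrite (der_iterD hd) mulrDr.
Qed.
Lemma apply_op_sub L u v : L @@ (u - v) = L @@ u - L @@ v.
Proof.
by rewrite -sumrB; apply: eq_bigr => i _; rewrite (der_iterB hd) mulrBr.
Qed.
Lemma apply_op_0 L : L @@ 0 = 0.
Proof. by rewrite -[X in _ @@ X](subrr 0) apply_op_sub subrr. Qed.

Lemma apply_op_sum L I (r : seq I) (f : I -> S) :
  L @@ (\sum_(i <- r) f i) = \sum_(i <- r) L @@ f i.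
Proof. exact: (big_morph (fun u => L @@ u) (apply_op_add L) (apply_op_0 L)). Qed.

Lemma apply_op_cst L a u : dS a = 0 -> L @@ (a * u) = a * (L @@ u).
Proof.
move=> a0; rewrite mulr_sumr; apply: eq_bigr => i _.
suff -> : iter i dS (a * u) = a * iter i dS u by rewrite mulrCA.
by elim: (nat_of_ord i) => //= n ->; rewrite (derM hd) a0 mul0r add0r.
Qed.

(** The product of [{poly K}] is commutative and is not composition of operators in general.
    Multiplication by ['X] only shifts the coefficients, and so it is composition with the
    derivation on the right; this is how [L * 'X] encodes [L] after [dt]. *)
Lemma apply_opX L u : (L * 'X) @@ u = L @@ dS u.
Proof.
rewrite (@apply_op_widen _ _ (size L).+1); last first.
  by rewrite (leq_trans (size_polyMleq _ _)) // size_polyX addn2.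
rewrite big_ord_recl coefMX rmorph0 mul0r add0r; apply: eq_bigr => i _.
by rewrite /= coefMX /= -iterS iterSr.
Qed.

(** Composition with the derivation on the left also differentiates the coefficients, hence the
    second summand. *)
Lemma apply_op_der L u : dS (L @@ u) = (L * 'X + map_poly dK L) @@ u.
Proof.
have dK0 : dK 0 = 0.
  by apply: (fmorph_inj kS); case: hS => _ <-; rewrite !rmorph0 (der0 hd).
rewrite apply_opD apply_opX (@apply_op_widen (map_poly _ _) _ (size L)) ?size_poly //.
rewrite (der_sum hd) -big_split; apply: eq_bigr => i _ /=.
rewrite (derM hd) coef_map_id0 // -iterSr [RHS]addrC; case: hS => _ -> /=.
by [].
Qed.

Lemma apply_op_in L c : L @@ kS c = kS (apply_op id dK L c).
Proof.
rewrite /apply_op rmorph_sum; apply: eq_bigr => i _; rewrite rmorphM; congr (_ * _).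
by elim: (nat_of_ord i) => //= n ->; case: hS => _ ->.
Qed.
End ApplyOp.

Lemma apply_op_hom (K : fieldType) (S S' : comNzRingType) (kS : K -> S) (kS' : K -> S')
    (dS : S -> S) (dS' : S' -> S') (h : {rmorphism S -> S'}) L u :
  (forall c, h (kS c) = kS' c) -> (forall s, h (dS s) = dS' (h s)) ->
  h (apply_op kS dS L u) = apply_op kS' dS' L (h u).
Proof.
move=> hk hd; rewrite rmorph_sum; apply: eq_bigr => i _; rewrite rmorphM hk; congr (_ * _).
by elim: (nat_of_ord i) => //= n <-; rewrite hd.
Qed.

(** * Independent solutions and the order of an operator *)

Section Triangular.
Variables (K : fieldType) (dK : K -> K) (hK : is_derivation dK).
Notation "L @@ u" := (apply_op id dK L u) (at level 40).

Lemma dt_algK : dt_alg dK idfun dK. Proof. by []. Qed.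

(* [tri s M]: the monic operator [M] is built by killing the elements of [s] one
   after the other, [M' = (dt - dt(g)/g) M] with [g = M(f)]. This replaces Wronskians. *)
Inductive tri : seq K -> {poly K} -> Prop :=
| tri_nil : tri [::] 1
| tri_cons f s M : tri s M -> M @@ f != 0 ->
    tri (f :: s) (M * 'X + map_poly dK M - (dK (M @@ f) / (M @@ f)) *: M).

Lemma tri_size s M : tri s M -> M \is monic /\ size M = (size s).+1.
Proof.
elim=> [|f {}s {}M _ [mM sM] _]; first by rewrite monic1 size_poly1.
set c := _ / _.
have sz : (size (map_poly dK M - c *: M)%R < size (M * 'X)%R)%N.
  rewrite size_mulX ?monic_neq0 // ltnS (leq_trans (size_polyD _ _)) // geq_max.
  by rewrite size_poly /= size_polyN size_scale_leq.
rewrite monicE -addrA lead_coefDl // size_polyDl // size_mulX ?monic_neq0 // sM.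
by rewrite lead_coefMX (monicP mM).
Qed.

Section Alg.
Variables (S : comNzRingType) (kS : {rmorphism K -> S}) (dS : S -> S).
Hypothesis hS : dt_alg dK kS dS.
Let hd : is_derivation dS. Proof. by case: hS. Qed.

Lemma tri_consE f M (u : S) :
  apply_op kS dS (M * 'X + map_poly dK M - (dK (M @@ f) / (M @@ f)) *: M) u =
  dS (apply_op kS dS M u) - kS (dK (M @@ f) / (M @@ f)) * apply_op kS dS M u.
Proof. by rewrite -scaleNr apply_opD apply_opZ rmorphN mulNr (apply_op_der hS). Qed.

Lemma apply_op_lin L (a : S) c : dS a = 0 ->
  apply_op kS dS L (a * kS c) = a * kS (L @@ c).
Proof. by move=> a0; rewrite (apply_op_cst hS) // (apply_op_in hS). Qed.
End Alg.

Lemma tri_kills s M : tri s M -> forall f, f \in s -> M @@ f = 0.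
Proof.
elim=> [|f {}s {}M _ IH g0] // f'; rewrite (tri_consE dt_algK) /= inE.
case/orP=> [/eqP ->|/IH -> ]; last by rewrite mulr0 subr0 der0.
by rewrite mulfVK // subrr.
Qed.

Section Alg2.
Variables (S : comNzRingType) (kS : {rmorphism K -> S}) (dS : S -> S).
Hypothesis hS : dt_alg dK kS dS.
Let hd : is_derivation dS. Proof. by case: hS. Qed.
Let dSk c : dS (kS c) = kS (dK c). Proof. by case: hS. Qed.

Definition lincomb (s : seq K) (a : nat -> S) : S := \sum_(i < size s) a i * kS s`_i.

Lemma lincomb_cons f s a : lincomb (f :: s) a = a 0%N * kS f + lincomb s (a \o succn).
Proof. by rewrite /lincomb big_ord_recl. Qed.

Lemma kill_lincomb L s a : (forall i, dS (a i) = 0) -> (forall f, f \in s -> L @@ f = 0) ->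
  apply_op kS dS L (lincomb s a) = 0.
Proof.
move=> a0 Ls; rewrite (apply_op_sum hS) big1 // => i _.
by rewrite (apply_op_lin hS) // Ls ?mem_nth // rmorph0 mulr0.
Qed.

(** Order reduction: with [g = M f], the first-order factor says that [M u / g] is constant, and
    subtracting this constant times [f] leaves a solution of the shorter operator. Since [g] is a
    unit of [K], this works in every [dt]-algebra over [K]. *)
Lemma tri_sol s M : tri s M -> forall u, apply_op kS dS M u = 0 ->
  exists a, (forall i, dS (a i) = 0) /\ u = lincomb s a.
Proof.
elim=> [|f {}s {}M tM IH] => [|g0] u.
  rewrite apply_op1 => ->; exists (fun=> 0); split=> [i|]; first exact: der0.
  by rewrite /lincomb big_ord0.
move: g0; set g := M @@ f => g0.
rewrite (tri_consE hS) -/g; set v := apply_op _ _ M u => /eqP.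
rewrite subr_eq0 => /eqP dv; pose b := v * kS g^-1.
have b0 : dS b = 0.
  rewrite (derM hd) dv dSk.
  have -> : dK g^-1 = - (dK g / g / g).
    apply: (mulIf g0); rewrite mulNr mulfVK //.
    apply/eqP; rewrite -addr_eq0; apply/eqP.
    have := der1 hK; rewrite -(mulVf g0) derM //.
    by rewrite [g^-1 * _]mulrC.
  by rewrite rmorphN [X in - X]rmorphM mulrN mulrCA mulrA subrr.
have [|a [a0 ua]] := IH (u - b * kS f).
  rewrite (apply_op_sub hS) (apply_op_lin hS) // -/v -/g /b.
  by rewrite -mulrA -rmorphM mulVf // rmorph1 mulr1 subrr.
exists (fun i => if i is j.+1 then a j else b); split=> [[|i]|] //.
by rewrite lincomb_cons /= addrC -[LHS](subrK (b * kS f)) ua.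
Qed.

(** [M] kills every term except that of [f], where it leaves the coefficient times the unit
    [M f]. *)
Lemma tri_free s M : tri s M -> forall a, (forall i, dS (a i) = 0) ->
  lincomb s a = 0 -> forall i, (i < size s)%N -> a i = 0.
Proof.
elim=> [|f {}s {}M tM IH g0] a a0 e; first by [].
have h : a 0%N = 0.
  have := congr1 (apply_op kS dS M) e; rewrite lincomb_cons (apply_op_add hS).
  rewrite (apply_op_lin hS) // (kill_lincomb (fun i => a0 i.+1) (tri_kills tM)).
  rewrite addr0 (apply_op_0 hS) => /(congr1 (fun z => z * kS (M @@ f)^-1)).
  by rewrite mul0r -mulrA -rmorphM mulfV // rmorph1 mulr1.
move: e; rewrite lincomb_cons h mul0r add0r => e [|i] //= lti.
by apply: (IH (a \o succn)) => // j; apply: a0.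
Qed.
End Alg2.

(** After its top term is removed with a multiple of the monic [M], the operator is zero by
    induction, so [N = c M]; then [c (M f) = 0] with [M f] nonzero forces [c = 0]. *)
Lemma tri_order s M : tri s M -> forall N, (forall f, f \in s -> N @@ f = 0) ->
  (size N <= size s)%N -> N = 0.
Proof.
elim=> [|f {}s {}M tM IH g0] N Ns.
  by rewrite leqn0 size_poly_eq0 => /eqP.
move=> sN; have [mM sM] := tri_size tM.
have N0 : N - N`_(size s) *: M = 0.
  apply: IH => [f' f's|].
    rewrite -scaleNr (apply_opD idfun) (apply_opZ idfun) /= Ns ?inE ?f's ?orbT //.
    by rewrite (tri_kills tM) // mulr0 addr0.
  apply/leq_sizeP => j; rewrite leq_eqVlt => /orP[/eqP <-|lt].
    rewrite coefB coefZ; have := monicP mM; rewrite /lead_coef sM /= => ->.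
    by rewrite mulr1 subrr.
  by rewrite coefB coefZ (nth_default _ (leq_trans sN lt)) [M`_j]nth_default ?sM // mulr0 subr0.
move/eqP: N0; rewrite subr_eq0 => /eqP N0.
suff c0 : N`_(size s) = 0 by rewrite N0 c0 scale0r.
have := Ns f (mem_head f s); rewrite {1}N0 (apply_opZ idfun) /= => /eqP.
by rewrite mulf_eq0 (negPf g0) orbF => /eqP.
Qed.

(** An element that the current operator already kills is skipped; by [tri_sol] it is a combination
    of the chosen ones over the constants. So [s] is a basis of the span of [l], and [M] is the
    annihilator of that span. *)
Lemma tri_greedy (l : seq K) : exists s M, [/\ tri s M, {subset s <= l} &
  forall f, f \in l -> M @@ f = 0].
Proof.
elim: l => [|f l [s [M [tM sl Ml]]]]; first by exists [::], 1; split=> //; constructor.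
have [Mf|Mf] := eqVneq (M @@ f) 0.
  exists s, M; split=> // f'; first by move=> /sl h; rewrite inE h orbT.
  by rewrite inE => /orP[/eqP ->|/Ml].
exists (f :: s), (M * 'X + map_poly dK M - (dK (M @@ f) / (M @@ f)) *: M).
split; first exact: tri_cons.
  by move=> f'; rewrite !inE => /orP[->//|/sl ->]; rewrite orbT.
move=> f'; rewrite inE => /orP[/eqP ->|/Ml].
  exact: (tri_kills (tri_cons tM Mf)) (mem_head f s).
by rewrite (tri_consE dt_algK) /= => ->; rewrite mulr0 subr0 der0.
Qed.

(** If the operator built so far killed the next element, [tri_sol] would write that element in
    terms of the earlier ones, a relation with coefficient 1. *)
Lemma tri_indep s :
  (forall c : nat -> K, (forall i, dK (c i) = 0) -> lincomb idfun s c = 0 ->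
     forall i, (i < size s)%N -> c i = 0) -> exists M, tri s M.
Proof.
elim: s => [|f s IH] ind; first by exists 1; constructor.
have [|M tM] := IH.
  move=> c c0 e i lti.
  apply: (ind (fun j => if j is j'.+1 then c j' else 0) _ _ i.+1) => //.
    by case=> [|j] //; rewrite der0.
  by rewrite lincomb_cons /= mul0r add0r.
have [Mf|Mf] := eqVneq (M @@ f) 0; last by eexists; apply: tri_cons Mf.
have [a [a0 fa]] := tri_sol dt_algK tM Mf.
exfalso; move/eqP: (oner_neq0 K); apply.
apply: (ind (fun j => if j is j'.+1 then - a j' else 1) _ _ 0%N isT).
  by case=> [|j]; rewrite ?(der1 hK) // (derN hK) a0 oppr0.
rewrite lincomb_cons /= mul1r {1}fa -big_split big1 // => i _ /=.
by rewrite mulNr subrr.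
Qed.

(** Replaces independence over the constants by a chain of nonzero values [M f], the form in which
    orders can be compared and solutions in algebras over [K] can be described. *)
Lemma fundamental_setP P : fundamental_set dK P <->
  exists s M, [/\ tri s M, size s = (size P).-1 & forall f, f \in s -> P @@ f = 0].
Proof.
split=> [[f [fP find]]|[s [M [tM sz Ps]]]].
  pose s := [seq f i | i <- enum 'I_(size P).-1].
  have ss : size s = (size P).-1 by rewrite size_map size_enum_ord.
  have sE (i : 'I_(size P).-1) : s`_i = f i.
    by rewrite (nth_map i) ?size_enum_ord // nth_ord_enum.
  have [|M tM] := @tri_indep s.
    move=> c c0 e i; rewrite ss => lti.
    apply: (find (fun j => c j) _ _ (Ordinal lti)) => //.
    by rewrite -[RHS]e /lincomb ss; apply: eq_bigr => j _; rewrite /= sE.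
  exists s, M; split=> // g /mapP[i _ ->]; exact: fP.
rewrite /fundamental_set -sz; exists (fun i => s`_i); split=> [i|c c0 e i].
  by apply: Ps; rewrite mem_nth.
pose a j := oapp c 0 (insub j : option 'I_(size s)).
have aE (j : 'I_(size s)) : a j = c j by rewrite /a valK.
rewrite -aE; apply: (tri_free dt_algK tM) => // [j|].
  by rewrite /a; case: insub => [j'|] /=; rewrite ?c0 ?der0.
by rewrite -[RHS]e; apply: eq_bigr => j _; rewrite aE.
Qed.

Lemma tri_unique s M P : tri s M -> (forall f, f \in s -> P @@ f = 0) ->
  size P = (size s).+1 -> P = lead_coef P *: M.
Proof.
move=> tM Ps sP; have [mM sM] := tri_size tM.
apply/eqP; rewrite -subr_eq0; apply/eqP/(tri_order tM) => [f fs|].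
  by rewrite -scaleNr (apply_opD idfun) (apply_opZ idfun) /= Ps // (tri_kills tM) // mulr0 addr0.
apply/leq_sizeP => j; rewrite leq_eqVlt => /orP[/eqP <-|lt].
  rewrite coefB coefZ; have := monicP mM; rewrite /lead_coef sM sP /= => ->.
  by rewrite mulr1 subrr.
by rewrite coefB coefZ [P`_j]nth_default ?sP // [M`_j]nth_default ?sM // mulr0 subr0.
Qed.
End Triangular.

(** * Partial fractions and residues in K(x) *)

Lemma der_exp (R : comNzRingType) (D : R -> R) a n : is_derivation D ->
  D (a ^+ n.+1) = n.+1%:R * a ^+ n * D a.
Proof.
move=> hD; elim: n => [|n IH]; first by rewrite expr0 mulr1 mul1r.
by rewrite exprS (derM hD) IH -[n.+2]addn1 natrD !exprS; ring.
Qed.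

Lemma der_inv (R : fieldType) (D : R -> R) a : is_derivation D -> a != 0 ->
  D a^-1 = - (D a / a ^+ 2).
Proof.
move=> hD a0; apply: (mulfI a0); apply/eqP.
have := der1 hD; rewrite -(mulfV a0) (derM hD) => /eqP.
by rewrite addrC addr_eq0 => /eqP ->; apply/eqP; field.
Qed.

Section RationalFunctions.
Variables (K : closedFieldType) (dK : K -> K) (F : fieldType) (inK : {rmorphism K -> F}).
Variables (x : F) (dF dtF : F -> F).
Hypothesis charK : [pchar K] =i pred0.
Hypothesis hK : is_derivation dK.
Hypothesis hF : is_Kx_dfield inK dK x dF dtF.

Let ev (p : {poly K}) : F := (map_poly inK p).[x].
Let ev_eq0 p : ev p = 0 -> p = 0. Proof. by case: hF => + _; apply. Qed.
Let ev_frac f : exists p q, ev q != 0 /\ f * ev q = ev p.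
Proof. by case: hF => _ [+ _]; apply. Qed.
Lemma Kx_dF : is_derivation dF. Proof. by case: hF => _ [_ []]. Qed.
Lemma Kx_dtF : is_derivation dtF. Proof. by case: hF => _ [_ [_ []]]. Qed.
Lemma Kx_comm f : dF (dtF f) = dtF (dF f).
Proof. by case: hF => _ [_ [_ [_ [+ _]]]]; apply. Qed.
Lemma Kx_dFK k : dF (inK k) = 0.
Proof. by case: hF => _ [_ [_ [_ [_ [+ _]]]]]; apply. Qed.
Lemma Kx_dFx : dF x = 1.
Proof. by case: hF => _ [_ [_ [_ [_ [_ [+ _]]]]]]. Qed.
Lemma Kx_dtK k : dtF (inK k) = inK (dK k).
Proof. by case: hF => _ [_ [_ [_ [_ [_ [_ [+ _]]]]]]]; apply. Qed.
Lemma Kx_dtx : dtF x = 0.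
Proof. by case: hF => _ [_ [_ [_ [_ [_ [_ [_ +]]]]]]]. Qed.
Let hdF := Kx_dF. Let hdt := Kx_dtF.

Lemma dt_algF : dt_alg dK inK dtF. Proof. by split; [exact: Kx_dtF | exact: Kx_dtK]. Qed.

Let evD p q : ev (p + q) = ev p + ev q. Proof. by rewrite /ev rmorphD hornerD. Qed.
Let evB p q : ev (p - q) = ev p - ev q. Proof. by rewrite /ev rmorphB /= !hornerE. Qed.
Let evM p q : ev (p * q) = ev p * ev q. Proof. by rewrite /ev rmorphM hornerM. Qed.
Let evC c : ev c%:P = inK c. Proof. by rewrite /ev map_polyC hornerC. Qed.
Let evX : ev 'X = x. Proof. by rewrite /ev map_polyX hornerX. Qed.
Let ev1 : ev 1 = 1. Proof. by rewrite /ev rmorph1 hornerC. Qed.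
Let evXsub c : ev ('X - c%:P) = x - inK c. Proof. by rewrite evB evX evC. Qed.
Let ev_neq0 p : p != 0 -> ev p != 0. Proof. by apply: contraNneq => /ev_eq0/eqP. Qed.

Lemma natK_eq0 n : (n%:R == 0 :> K) = (n == 0)%N.
Proof. by move/pcharf0P: charK. Qed.
Lemma natK_inj : injective (fun n : nat => n%:R : K).
Proof.
move=> i j /= ij; wlog le : i j ij / (i <= j)%N.
  by move=> w; case: (leqP i j) => [|/ltnW] le; [exact: w | exact/esym/w].
move/eqP: ij; rewrite eq_sym -subr_eq0 -natrB // natK_eq0 subn_eq0 => le'.
by apply/eqP; rewrite eqn_leq le.
Qed.
Lemma natF n : inK n%:R = n%:R. Proof. exact: rmorph_nat. Qed.

Lemma xsub_neq0 c : x - inK c != 0.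
Proof. by rewrite -evXsub ev_neq0 // polyXsubC_eq0. Qed.

Lemma dF_xsub c : dF (x - inK c) = 1.
Proof. by rewrite (derB hdF) Kx_dFK Kx_dFx subr0. Qed.

Let dF_ev p : dF (ev p) = ev p^`().
Proof.
elim/poly_ind: p => [|p c IH].
  by rewrite deriv0 /ev rmorph0 horner0 (der0 hdF).
rewrite derivD derivC addr0 derivM derivX mulr1 !evD !evM evC evX.
by rewrite (derD hdF) (derM hdF) IH Kx_dFx Kx_dFK addr0 mulr1.
Qed.

(** If [f q = p] and [f] is constant then [f q' = p'], so the denominator can be differentiated
    until its derivative vanishes. Then [p'] vanishes too, and in characteristic zero both
    polynomials are constant. *)
Lemma dF_const f : dF f = 0 -> exists k, f = inK k.
Proof.
move=> f0.
have : exists n, exists p q, [/\ ev q != 0, f * ev q = ev p & (size q <= n)%N].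
  by have [p [q [q0 e]]] := ev_frac f; exists (size q), p, q.
case=> n; elim: n => [|n IH] [p [q [q0 e sz]]].
  move: sz q0; rewrite leqn0 size_poly_eq0 => /eqP ->.
  by rewrite /ev rmorph0 horner0 eqxx.
have e' : f * ev q^`() = ev p^`().
  by rewrite -!dF_ev -e (derM hdF) f0 mul0r add0r.
have [dq0|dq0] := eqVneq q^`() 0; last first.
  apply: IH; exists p^`(), q^`(); split=> //; first exact: ev_neq0.
  by rewrite -ltnS (leq_trans (lt_size_deriv _)) //; apply: contraNneq dq0 => ->; rewrite deriv0.
have const (r : {poly K}) : r^`() = 0 -> r = (r`_0)%:P.
  move=> r0; apply/polyP=> -[|i]; rewrite coefC //=.
  have /eqP := congr1 (fun s : {poly K} => s`_i) r0; rewrite coef_deriv coef0.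
  by rewrite -mulr_natr mulf_eq0 natK_eq0 orbF => /eqP.
move: e' e q0; rewrite dq0 {1}/ev rmorph0 horner0 mulr0 => /esym/ev_eq0/const ->.
rewrite (const _ dq0) !evC => e q0; exists (p`_0 / q`_0).
by rewrite rmorphM fmorphV -e mulfK.
Qed.

(** * Local behaviour of a rational function at a point *)

Section Pole.
Variable c : K.
Let t := x - inK c.
Let t0 : t != 0. Proof. exact: xsub_neq0. Qed.

(** Membership in the local ring of [K[x]] at [c]. *)
Definition regular f := exists p q, q.[c] != 0 /\ f * ev q = ev p.

Lemma regularD f g : regular f -> regular g -> regular (f + g).
Proof.
move=> [p [q [q0 e]]] [p' [q' [q'0 e']]]; exists (p * q' + p' * q), (q * q').
by rewrite hornerM mulf_neq0 //; split=> //; rewrite evD !evM -e -e'; ring.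
Qed.
Lemma regularM f g : regular f -> regular g -> regular (f * g).
Proof.
move=> [p [q [q0 e]]] [p' [q' [q'0 e']]]; exists (p * p'), (q * q').
by rewrite hornerM mulf_neq0 //; split=> //; rewrite !evM -e -e'; ring.
Qed.
Lemma regular_ev p : regular (ev p).
Proof. by exists p, 1; rewrite hornerC oner_neq0 ev1 mulr1. Qed.
Lemma regularK k : regular (inK k). Proof. by rewrite -evC; apply: regular_ev. Qed.
Lemma regular_t : regular t. Proof. by rewrite /t -evXsub; apply: regular_ev. Qed.
Lemma regularX f n : regular f -> regular (f ^+ n).
Proof.
move=> h; elim: n => [|n IH]; first by rewrite expr0 -(rmorph1 inK); apply: regularK.
by rewrite exprS; apply: regularM.
Qed.
Lemma regularN f : regular f -> regular (- f).
Proof. by move=> h; rewrite -mulN1r -(rmorph1 inK) -rmorphN; apply: regularM (regularK _) h. Qed.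
Lemma regular_dF f : regular f -> regular (dF f).
Proof.
move=> [p [q [q0 e]]]; exists (p^`() * q - p * q^`()), (q * q).
rewrite hornerM mulf_neq0 //; split=> //; rewrite evB !evM -e -!dF_ev -e (derM hdF); ring.
Qed.
Lemma regular_pole c' : c' != c -> regular (x - inK c')^-1.
Proof.
move=> cc; exists 1, ('X - c'%:P).
by rewrite !hornerE subr_eq0 eq_sym cc evXsub ev1 mulVf ?xsub_neq0.
Qed.

Lemma t_not_unit f : regular f -> t * f = 1 -> False.
Proof.
move=> [p [q [q0 e]]] tf.
have : ev (q - ('X - c%:P) * p) = 0.
  by rewrite evB evM evXsub -/t -e mulrA tf mul1r subrr.
move=> /ev_eq0/(congr1 (fun r : {poly K} => r.[c])); rewrite !hornerE subrr mul0r subr0.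
by move/eqP: q0.
Qed.

Lemma pole_order f : exists m, regular (f * t ^+ m).
Proof.
have [p [q [q0 e]]] := ev_frac f.
have [m [q1 nr qE]] := multiplicity_XsubC q c.
have qn0 : q != 0 by apply: contraNneq q0 => ->; rewrite /ev rmorph0 horner0.
have q1c : q1.[c] != 0 by move: nr; rewrite qn0.
have evXn : ev (('X - c%:P) ^+ m) = t ^+ m.
  by rewrite /t -evXsub; elim: (m) => [|n IH]; rewrite ?expr0 ?ev1 // !exprS evM IH.
by exists m, p, q1; split=> //; rewrite -e qE evM evXn; ring.
Qed.

(* Differentiating raises the order of a pole. *)
Lemma no_simple_pole a r f : regular r -> dF f = inK a / t + r -> a = 0.
Proof.
move=> rr e; apply/eqP; apply: contraT => a0.
(* Without a pole in [g], the equation exhibits an inverse of [t] in the local ring. *)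
have base g : regular g -> dF g = inK a / t + r -> False.
  move=> rg eg; apply: (@t_not_unit (inK a^-1 * (dF g - r))).
    apply: regularM; first exact: regularK.
    by apply: regularD; [apply: regular_dF | apply: regularN].
  by rewrite eg addrK fmorphV; field; rewrite t0 fmorph_eq0 a0.
have [m rm] := pole_order f.
elim: m rm => [|m IH] rm; first by rewrite expr0 mulr1 in rm; case: (base f).
apply: IH; set g := f * t ^+ m.+1 in rm.
have m0 : m.+1%:R != 0 :> K by rewrite natK_eq0.
(* The derivative of [g] is [(a / t + r) t^(m+1) + (m+1) f t^m]. Solving for [f t^m] expresses it by
   regular functions, so the pole order of [f] drops. *)
have gE : g = t * (inK m.+1%:R^-1 * (dF g - (inK a / t + r) * t ^+ m.+1)).
  rewrite fmorphV natF /g (derM hdF) (der_exp _ _ hdF) dF_xsub e mulr1 addrC addKr.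
  have: m.+1%:R != 0 :> F by rewrite -natF fmorph_eq0.
  by rewrite exprS; move: (m.+1%:R) (t ^+ m) => N u N0; field; rewrite ?N0 ?t0.
have -> : f * t ^+ m = inK m.+1%:R^-1 * (dF g - (inK a / t + r) * t ^+ m.+1).
  by apply: (mulfI t0); rewrite -gE /g exprS mulrCA.
apply: regularM; first exact: regularK.
apply: regularD; first exact: regular_dF.
apply: regularN; rewrite mulrDl; apply: regularD; last first.
  by apply: regularM => //; apply: regularX regular_t.
rewrite exprS mulrA mulfVK //; apply: regularM; first exact: regularK.
exact: regularX regular_t.
Qed.
End Pole.

Definition logsum (s : seq (K * K)) : F := \sum_(p <- s) inK p.1 / (x - inK p.2).

(** All other terms are regular at [p.2], so [no_simple_pole] applies to the coefficient of this
    pole. *)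
Lemma logsum_exact s f : uniq (unzip2 s) -> dF f = logsum s -> forall p, p \in s -> p.1 = 0.
Proof.
move=> us e p ps; move: e us; rewrite /logsum (big_rem p) //=.
rewrite (perm_uniq (perm_map snd (perm_to_rem ps))) /= => e /andP[np _].
apply: (no_simple_pole _ e).
elim: (rem p s) np => [|q l IH]; first by rewrite big_nil -(rmorph0 inK) => _; apply: regularK.
rewrite /= inE big_cons negb_or => /andP[pq /IH h]; apply: regularD => //.
by apply: regularM; [apply: regularK | apply: regular_pole; rewrite eq_sym].
Qed.

Lemma logsum_merge s : exists2 s', uniq (unzip2 s') & logsum s = logsum s'.
Proof.
pose cs := undup (unzip2 s).
exists [seq (\sum_(p <- s | p.2 == c) p.1, c) | c <- cs].
  by rewrite /unzip2 -map_comp (eq_map (g := id)) // map_id undup_uniq.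
rewrite /logsum big_map /=.
under [RHS]eq_bigr => c _ do rewrite rmorph_sum mulr_suml big_mkcond /=.
rewrite exchange_big /=; apply: eq_big_seq => p ps.
rewrite (bigD1_seq p.2) ?undup_uniq ?mem_undup ?map_f //= eqxx big1 ?addr0 //.
by move=> c; rewrite eq_sym => /negPf ->.
Qed.

(** * Partial fractions and Hermite reduction *)

Inductive pfspan : F -> Prop :=
| pf_add a b : pfspan a -> pfspan b -> pfspan (a + b)
| pf_scal k a : pfspan a -> pfspan (inK k * a)
| pf_mon n : pfspan (x ^+ n)
| pf_pole c n : pfspan ((x - inK c)^-1 ^+ n).

Lemma pf_div c b : pfspan b -> pfspan (b / (x - inK c)).
Proof.
elim=> [a b' _ h _ h'|k a _ h|n|c' n].
- by rewrite mulrDl; apply: pf_add.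
- by rewrite -mulrA; apply: pf_scal.
- elim: n => [|n IH]; first by rewrite expr0 mul1r -[_^-1]expr1; apply: pf_pole.
  have -> : x ^+ n.+1 / (x - inK c) = x ^+ n + inK c * (x ^+ n / (x - inK c)).
    by rewrite exprS; field; apply: xsub_neq0.
  by apply: pf_add (pf_mon _) (pf_scal _ IH).
elim: n => [|n IH]; first by rewrite expr0 mul1r -[_^-1]expr1; apply: pf_pole.
have [->|cc] := eqVneq c' c; first by rewrite -exprSr; apply: pf_pole.
(* This is [1/((x - c')(x - c)) = (c - c')^-1 (1/(x - c) - 1/(x - c'))] multiplied by [(x - c')^-n];
   it lowers the exponent of the other pole. *)
have -> : (x - inK c')^-1 ^+ n.+1 / (x - inK c) = inK (c - c')^-1 *
   ((x - inK c')^-1 ^+ n / (x - inK c) + inK (-1) * (x - inK c')^-1 ^+ n.+1).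
  rewrite fmorphV rmorphB rmorphN rmorph1 exprS; set u := _ ^+ n; field.
  by rewrite !xsub_neq0 subr_eq0 (inj_eq (fmorph_inj inK)) eq_sym cc.
by apply: pf_scal; apply: pf_add => //; apply: pf_scal; apply: pf_pole.
Qed.

(** As [K] is algebraically closed, the denominator splits, and its linear factors are divided out
    one at a time by [pf_div]. *)
Lemma pf_all b : pfspan b.
Proof.
have [p [q [q0 e]]] := ev_frac b.
have pfp : pfspan (ev p).
  elim/poly_ind: p {e} => [|p c IH].
    rewrite /ev rmorph0 horner0 -[0](mul0r 1) -(rmorph0 inK) -(expr0 x).
    exact: pf_scal (pf_mon _).
  rewrite evD evM evC evX; apply: pf_add; last first.
    by rewrite -[inK c]mulr1 -(expr0 x); apply: pf_scal (pf_mon _).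
  elim: IH => [a b' _ h _ h'|k a _ h|n|c' n].
  - by rewrite mulrDl; apply: pf_add.
  - by rewrite -mulrA; apply: pf_scal.
  - by rewrite -exprSr; apply: pf_mon.
  case: n => [|n]; first by rewrite expr0 mul1r -[x]expr1; apply: pf_mon.
  have -> : (x - inK c')^-1 ^+ n.+1 * x =
     (x - inK c')^-1 ^+ n + inK c' * (x - inK c')^-1 ^+ n.+1.
    by rewrite exprS; set u := _ ^+ n; field; apply: xsub_neq0.
  by apply: pf_add (pf_pole _ _) (pf_scal _ (pf_pole _ _)).
have [r qE] := closed_field_poly_normal q.
have lq : lead_coef q != 0.
  by rewrite lead_coef_eq0; apply: contraNneq q0 => ->; rewrite /ev rmorph0 horner0.
have -> : b = inK (lead_coef q)^-1 * (ev p / \prod_(z <- r) (x - inK z)).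
  have evr : ev (\prod_(z <- r) ('X - z%:P)) = \prod_(z <- r) (x - inK z).
    by elim: (r) => [|z l IH]; rewrite ?big_nil ?ev1 // !big_cons evM evXsub IH.
  rewrite -e {2}qE -mul_polyC evM evC evr fmorphV; field.
  rewrite fmorph_eq0 lq -evr; apply/andP; split=> //.
  by move: q0; rewrite qE -mul_polyC evM mulf_eq0 negb_or => /andP[].
apply: pf_scal; elim: r {qE} => [|z l IH]; first by rewrite big_nil divr1.
by rewrite big_cons invfM mulrA mulrAC; apply: pf_div.
Qed.

(** In characteristic zero powers of [x] and poles of order at least two have rational
    antiderivatives, so only the simple poles are left over. *)
Lemma hermite_reduction b : exists f s, uniq (unzip2 s) /\ b = dF f + logsum s.
Proof.
suff [f [s ->]] : exists f s, b = dF f + logsum s.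
  by have [s' us' ->] := logsum_merge s; exists f, s'.
elim: (pf_all b) => {b} [a b _ [f [s ->]] _ [f' [s' ->]]|k a _ [f [s ->]]|n|c n].
- exists (f + f'), (s ++ s'); rewrite (derD hdF) /logsum big_cat /=; ring.
- exists (inK k * f), [seq (k * p.1, p.2) | p <- s].
  rewrite (derM hdF) Kx_dFK mul0r add0r mulrDr /logsum big_map mulr_sumr; congr (_ + _).
  by apply: eq_bigr => p _ /=; rewrite rmorphM mulrA.
- exists (inK n.+1%:R^-1 * x ^+ n.+1), [::]; rewrite /logsum big_nil addr0.
  rewrite (derM hdF) Kx_dFK mul0r add0r (der_exp _ _ hdF) Kx_dFx mulr1 mulrA.
  by rewrite -(natF n.+1) -rmorphM mulVf ?natK_eq0 // rmorph1 mul1r.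
case: n => [|[|n]].
- by exists x, [::]; rewrite /logsum big_nil addr0 Kx_dFx expr0.
- by exists 0, [:: (1, c)]; rewrite /logsum big_seq1 (der0 hdF) add0r rmorph1 mul1r expr1.
exists (- (inK n.+1%:R^-1 * (x - inK c)^-1 ^+ n.+1)), [::]; rewrite /logsum big_nil addr0.
rewrite (derN hdF) (derM hdF) Kx_dFK mul0r add0r (der_exp _ _ hdF).
rewrite (der_inv hdF (xsub_neq0 c)) dF_xsub fmorphV natF.
have: n.+1%:R != 0 :> F by rewrite -natF fmorph_eq0 natK_eq0.
rewrite [(x - inK c)^-1 ^+ n.+2]exprS [(x - inK c)^-1 ^+ n.+1]exprS.
by move: (n.+1%:R) ((x - inK c)^-1 ^+ n) => N u N0; field; rewrite ?N0 ?xsub_neq0.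
Qed.

(** * Action of operators on residues *)

Lemma iter_comm n f : iter n dtF (dF f) = dF (iter n dtF f).
Proof. by elim: n => //= n ->; rewrite Kx_comm. Qed.

Lemma op_dF M f : apply_op inK dtF M (dF f) = dF (apply_op inK dtF M f).
Proof.
rewrite (der_sum hdF); apply: eq_bigr => i _.
by rewrite (derM hdF) Kx_dFK mul0r add0r iter_comm.
Qed.

(** The pole [c] moves with [dt], but this contributes [a dt(c) / (x - c)^2], the [d]-derivative of
    [- a dt(c) / (x - c)]. Modulo [d]-derivatives the operator therefore acts on the residue
    alone. *)
Lemma op_log M a c : exists h,
  apply_op inK dtF M (inK a / (x - inK c)) =
  inK (apply_op id dK M a) / (x - inK c) + dF h.
Proof.
have it n : exists h, iter n dtF (inK a / (x - inK c)) =
    inK (iter n dK a) / (x - inK c) + dF h.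
  elim: n => [|n [h IH]]; first by exists 0; rewrite (der0 hdF) addr0.
  set b := iter n dK a in IH *.
  exists (dtF h - inK (b * dK c) / (x - inK c)).
  rewrite !iterS IH -/b (derD hdt) (derM hdt) Kx_dtK -Kx_comm (derB hdF) (derM hdF) Kx_dFK.
  rewrite (der_inv hdt (xsub_neq0 c)) (der_inv hdF (xsub_neq0 c)) dF_xsub (derB hdt).
  by rewrite Kx_dtx Kx_dtK rmorphM; field; apply: xsub_neq0.
pose h n := sval (cid (it n)).
have hE n : iter n dtF (inK a / (x - inK c)) = inK (iter n dK a) / (x - inK c) + dF (h n).
  exact: svalP (cid (it n)).
exists (\sum_(i < size M) inK M`_i * h i).
rewrite /apply_op rmorph_sum mulr_suml (der_sum hdF) -big_split; apply: eq_bigr => i _ /=.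
by rewrite hE (derM hdF) Kx_dFK mul0r add0r mulrDr rmorphM mulrA.
Qed.

(** The list is chosen before [M]: it consists of the residues of [b]. By [op_log], [M] acts on them
    modulo [d]-derivatives, and by [logsum_exact] what remains is exact only if every new residue is
    zero. *)
Lemma residues b : exists l : seq K, forall M,
  (exists f, apply_op inK dtF M b = dF f) <-> (forall a, a \in l -> apply_op id dK M a = 0).
Proof.
have [f [s [us bE]]] := hermite_reduction b.
exists (unzip1 s) => M.
have [h hE] : exists h, apply_op inK dtF M b =
    dF h + logsum [seq (apply_op id dK M p.1, p.2) | p <- s].
  rewrite bE (apply_op_add dt_algF) op_dF; move: (apply_op _ _ _ f) => f1.
  rewrite (apply_op_sum dt_algF) /logsum big_map.
  elim: s {us bE} f1 => [|p s IH] f1; first by exists f1; rewrite !big_nil.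
  rewrite !big_cons; have [h ->] := op_log M p.1 p.2.
  have [h' e] := IH (f1 + h); exists h'.
  by rewrite [RHS]addrCA -e (derD hdF) /=; ring.
split=> [[g e] a /mapP[p ps ->]|la].
  have us' : uniq (unzip2 [seq (apply_op id dK M p.1, p.2) | p <- s]) by rewrite /unzip2 -map_comp.
  have e' : dF (g - h) = logsum [seq (apply_op id dK M p.1, p.2) | p <- s].
    by rewrite (derB hdF) -e hE addrC addKr.
  by have := logsum_exact us' e' (map_f _ ps).
exists h; rewrite hE /logsum big_map big_seq big1 ?addr0 // => p ps /=.
by rewrite la ?map_f // rmorph0 mul0r.
Qed.

(** At infinity a logarithmic derivative [f'/f] tends to 0, while [e (1 + logsum s)] tends to [e],
    which is nonzero. With [f = p/q] and [1 + logsum s = B/Q], where [B] and [Q] have equal size,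
    this is a comparison of degrees in [(p' q - p q') Q = e B p q]. *)
Lemma no_exp_solution s e f : e != 0 -> dF f = inK e * (1 + logsum s) * f -> f = 0.
Proof.
move=> e0 E.
have [B [Q [Q0 sBQ BQ]]] : exists B Q : {poly K}, [/\ Q != 0, size B = size Q & (1 + logsum s) * ev Q = ev B].
  elim: s {E} => [|[a c] s [B [Q [Q0 sBQ BQ]]]].
    by exists 1, 1; rewrite oner_neq0 /logsum big_nil addr0 ev1 mulr1.
  have s1 : size (B * ('X - c%:P)) = (size Q).+1.
    by rewrite size_Mmonic ?monicXsubC ?size_XsubC ?sBQ ?addn2 // -size_poly_eq0 sBQ size_poly_eq0.
  exists (B * ('X - c%:P) + a *: Q), (Q * ('X - c%:P)); split.
  - by rewrite mulf_neq0 // polyXsubC_eq0.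
  - rewrite size_polyDl ?s1 ?ltnS ?size_scale_leq //.
    by rewrite size_Mmonic ?monicXsubC ?size_XsubC ?addn2.
  rewrite /logsum big_cons -/(logsum s) evD -mul_polyC !evM evC evXsub -BQ /=; field.
  exact: xsub_neq0.
have [p [q [q0 pq]]] := ev_frac f.
have [p0|p0] := eqVneq p 0.
  move: pq; rewrite p0 {2}/ev rmorph0 horner0 => /eqP.
  by rewrite mulf_eq0 (negPf q0) orbF => /eqP.
have qn0 : q != 0 by apply: contraNneq q0 => ->; rewrite /ev rmorph0 horner0.
have B0 : B != 0 by rewrite -size_poly_eq0 sBQ size_poly_eq0.
have key : (p^`() * q - p * q^`()) * Q = e *: (B * p * q).
  apply/eqP; rewrite -subr_eq0; apply/eqP/ev_eq0.
  rewrite -mul_polyC evB !(evM, evB) evC -!dF_ev -BQ -pq (derM hdF) E; ring.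
have := congr1 (fun r : {poly K} => size r) key; rewrite /= size_scale // => sz.
exfalso; move: sz; rewrite [size (B * p * q)]size_mul ?mulf_neq0 // [size (B * p)]size_mul // sBQ.
have h1 := lt_size_deriv p0; have h2 := lt_size_deriv qn0.
have sp : (0 < size p)%N by rewrite size_poly_gt0.
have sq : (0 < size q)%N by rewrite size_poly_gt0.
have sQ : (0 < size Q)%N by rewrite size_poly_gt0.
have h3 : (size (p^`() * q - p * q^`())%R <= (size p + size q).-2)%N.
  rewrite (leq_trans (size_polyD _ _)) // size_polyN geq_max.
  have aux a c d : (a < c)%N -> ((a + d).-1 <= (c + d).-2)%N by lia.
  apply/andP; split; apply: leq_trans (size_polyMleq _ _) _; first exact: aux.
  by rewrite addnC [(size p + _)%N]addnC; apply: aux.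
have aux (a b c d n : nat) : (a <= (b + c).-2)%N -> (d <= (a + n).-1)%N ->
  (0 < b)%N -> (0 < c)%N -> (0 < n)%N -> d = (((n + b).-1 + c).-1)%N -> False by lia.
by move=> sz; apply: (aux _ _ _ _ _ h3 (size_polyMleq _ Q) sp sq sQ sz).
Qed.
End RationalFunctions.

(** * Algebras with two derivations *)

Section ConstantsMore.
Variables (T : comNzRingType) (D : T -> T) (hD : is_derivation D).

Definition cstv : {rmorphism csts hD -> T} := GRing.RMorphism.clone _ _ (@cst_val T D hD) val.
Lemma cstvE c : cstv c = cst_val c. Proof. by []. Qed.

Lemma csts_hom (A : comNzRingType) (h : {rmorphism A -> T}) : (forall a, D (h a) = 0) ->
  exists h' : {rmorphism A -> csts hD}, forall a, cst_val (h' a) = h a.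
Proof.
move=> h0; pose f a := sval (cid (csts_of hD (h0 a))).
have fE a : cstv (f a) = h a by exact: svalP (cid (csts_of hD (h0 a))).
have [|||h' hE] := @rmorph_of A (csts hD) f.
- by move=> a b; apply: cst_inj; rewrite -!cstvE rmorphD !fE rmorphD.
- by apply: cst_inj; rewrite -!cstvE fE !rmorph1.
- by move=> a b; apply: cst_inj; rewrite -!cstvE rmorphM !fE rmorphM.
by exists h' => a; rewrite hE -cstvE fE.
Qed.

Lemma csts_mx m n (M : 'M[T]_(m, n)) : map_mx D M = 0 ->
  exists M' : 'M[csts hD]_(m, n), map_mx cstv M' = M.
Proof.
move=> M0; have h i j : D (M i j) = 0 by move/matrixP/(_ i j): M0; rewrite !mxE.
exists (\matrix_(i, j) sval (cid (csts_of hD (h i j)))).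
by apply/matrixP=> i j; rewrite !mxE; exact: svalP (cid (csts_of hD (h i j))).
Qed.
End ConstantsMore.

Lemma cstv_mx_inj (T : comNzRingType) (D : T -> T) (hD : is_derivation D) m n :
  injective (fun M : 'M[csts hD]_(m, n) => map_mx (cstv hD) M).
Proof.
by move=> M N /matrixP e; apply/matrixP=> i j; apply: (@cst_inj _ _ hD); have := e i j; rewrite !mxE.
Qed.

Section DDAlg.
Variables (K : fieldType) (dK : K -> K).

(** Two commuting derivations are bundled because the [d]-constants then form a [dt]-algebra over
    [K], to which the group functor can be applied. *)
Record ddalg := DDAlg {
  dd_ring :> comNzRingType;
  dd_k : {rmorphism K -> dd_ring};
  dd_d : dd_ring -> dd_ring;
  dd_t : dd_ring -> dd_ring;
  dd_dP : is_derivation dd_d;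
  dd_tP : is_derivation dd_t;
  dd_comm : forall a, dd_d (dd_t a) = dd_t (dd_d a);
  dd_dk : forall k, dd_d (dd_k k) = 0;
  dd_tk : forall k, dd_t (dd_k k) = dd_k (dK k) }.

Definition dd_csts (E : ddalg) : comNzRingType := csts (dd_dP E).
Definition dd_val (E : ddalg) : {rmorphism dd_csts E -> E} := cstv (dd_dP E).

Definition dd_kc (E : ddalg) : {rmorphism K -> dd_csts E} :=
  sval (cid (csts_hom (dd_dP E) (@dd_dk E))).
Lemma dd_kcE (E : ddalg) k : dd_val E (dd_kc E k) = dd_k E k.
Proof. exact: (svalP (cid (csts_hom (dd_dP E) (@dd_dk E)))). Qed.

Lemma dd_val_d (E : ddalg) (c : dd_csts E) : dd_d (dd_val E c) = 0.
Proof. exact: cst_val0. Qed.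
Lemma dd_val_inj (E : ddalg) : injective (dd_val E). Proof. exact: cst_inj. Qed.

Lemma dd_t_cst (E : ddalg) (c : dd_csts E) : dd_d (dd_t (dd_val E c)) = 0.
Proof. by rewrite dd_comm dd_val_d (der0 (dd_tP E)). Qed.
Definition dd_tc (E : ddalg) (c : dd_csts E) : dd_csts E :=
  sval (cid (csts_of (dd_dP E) (dd_t_cst c))).
Lemma dd_tcE (E : ddalg) (c : dd_csts E) : dd_val E (dd_tc c) = dd_t (dd_val E c).
Proof. exact: (svalP (cid (csts_of (dd_dP E) (dd_t_cst c)))). Qed.

Lemma dd_csts_alg (E : ddalg) : dt_alg dK (dd_kc E) (@dd_tc E).
Proof.
split; first split=> a b.
- by apply: dd_val_inj; rewrite rmorphD !dd_tcE rmorphD (derD (dd_tP E)).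
- by apply: dd_val_inj; rewrite rmorphD !rmorphM !dd_tcE rmorphM (derM (dd_tP E)).
by move=> k; apply: dd_val_inj; rewrite dd_tcE !dd_kcE dd_tk.
Qed.

Lemma dd_hom (E E' : ddalg) (h : {rmorphism E -> E'}) :
  (forall a, h (dd_d a) = dd_d (h a)) -> (forall a, h (dd_t a) = dd_t (h a)) ->
  (forall k, h (dd_k E k) = dd_k E' k) ->
  exists h' : {rmorphism dd_csts E -> dd_csts E'},
    (forall c, dd_val E' (h' c) = h (dd_val E c)) /\
    dt_alg_hom (dd_kc E) (dd_kc E') (@dd_tc E) (@dd_tc E') h'.
Proof.
move=> hd ht hk; pose g : {rmorphism dd_csts E -> E'} := h \o dd_val E.
have [|h' hE] := @csts_hom _ _ (dd_dP E') _ g.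
  by move=> c /=; rewrite -hd dd_val_d rmorph0.
have hE' c : dd_val E' (h' c) = h (dd_val E c) by exact: hE.
exists h'; split=> //; split=> [k|c]; apply: dd_val_inj.
  by rewrite hE' !dd_kcE hk.
by rewrite hE' !dd_tcE hE' ht.
Qed.

Lemma dd_csts_hom (E : ddalg) (S : comNzRingType) (kS : {rmorphism K -> S}) dS
    (h : {rmorphism S -> E}) :
  (forall a, dd_d (h a) = 0) -> (forall a, h (dS a) = dd_t (h a)) ->
  (forall k, h (kS k) = dd_k E k) ->
  exists h' : {rmorphism S -> dd_csts E},
    (forall c, dd_val E (h' c) = h c) /\ dt_alg_hom kS (dd_kc E) dS (@dd_tc E) h'.
Proof.
move=> hd ht hk; have [h' hE] := csts_hom (dd_dP E) hd.
have hE' c : dd_val E (h' c) = h c by exact: hE.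
exists h'; split=> //; split=> [k|c]; apply: dd_val_inj.
  by rewrite hE' dd_kcE hk.
by rewrite hE' dd_tcE hE' ht.
Qed.
End DDAlg.

(** The maps to the concrete tensor product and back compose to the identity of [T] by the
    uniqueness clause, so [T] is generated by its two factors. *)
Lemma is_tensor_ind (k : fieldType) (R S T : comNzRingType) (f : k -> R)
    (kR : {rmorphism k -> R}) (kS : {rmorphism k -> S})
    (jR : {rmorphism R -> T}) (jS : {rmorphism S -> T}) (P : T -> Prop) :
  f =1 kR -> is_tensor f kS jR jS ->
  (forall r, P (jR r)) -> (forall s, P (jS s)) ->
  (forall t t', P t -> P t' -> P (t + t')) -> (forall t t', P t -> P t' -> P (t * t')) ->
  forall t, P t.
Proof.
move=> fE [jk univ] PR PS PD PM.
have [|h [hR [hS _]]] := univ (tensor kR kS) (tinl kR kS) (tinr kR kS).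
  by move=> c; rewrite fE; exact: (tin_bal kR kS).
have [|h' [h'R h'S]] := @tensor_map _ _ _ kR kS _ jR jS.
  by move=> c; rewrite -fE.
have [g [_ [_ guniq]]] := univ T jR jS jk.
move=> t; have -> : t = h' (h t).
  rewrite -[h' (h t)]/((h' \o h) t) (guniq (h' \o h)) => [|r|s].
  - by rewrite -(guniq idfun).
  - by rewrite /= hR h'R.
  - by rewrite /= hS h'S.
elim/tensor_ring_ind: (h t) => [r|s|u v|u v]; rewrite ?h'R ?h'S ?rmorphD ?rmorphM //.
- exact: PD.
- exact: PM.
Qed.

(** * Points of the Galois group *)

Section PPVRing.
Variables (K F : fieldType) (inK : {rmorphism K -> F}) (dK : K -> K) (dF dtF : F -> F).
Hypothesis dFK : forall k, dF (inK k) = 0.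
Hypothesis dtK : forall k, dtF (inK k) = inK (dK k).
Variables (R : comNzRingType) (iF : {rmorphism F -> R}) (dR dtR : R -> R).
Variables (n : nat) (A : 'M[F]_n) (Y : 'M[R]_n).
Hypothesis PPV : PPV_ring dF dtF iF dR dtR A Y.

Lemma ppv_d : is_derivation dR. Proof. by case: PPV. Qed.
Lemma ppv_t : is_derivation dtR. Proof. by case: PPV => _ []. Qed.
Lemma ppv_comm r : dR (dtR r) = dtR (dR r). Proof. by case: PPV => _ [_ []]. Qed.
Lemma ppv_dF f : dR (iF f) = iF (dF f). Proof. by case: PPV => _ [_ [_ []]]. Qed.
Lemma ppv_tF f : dtR (iF f) = iF (dtF f). Proof. by case: PPV => _ [_ [_ [_ []]]]. Qed.
Lemma ppv_Y : map_mx dR Y = map_mx iF A *m Y. Proof. by case: PPV => _ [_ [_ [_ [_ []]]]]. Qed.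
Lemma ppv_gen : exists dinv : R, \det Y * dinv = 1 /\
     forall P : R -> Prop,
       P 1 -> (forall a b, P a -> P b -> P (a - b)) -> (forall a b, P a -> P b -> P (a * b)) ->
       (forall f, P (iF f)) ->
       (forall k i j, P (iter k dtR (Y i j))) -> (forall k, P (iter k dtR dinv)) ->
       forall r, P r.
Proof. by case: PPV => _ [_ [_ [_ [_ [_ []]]]]]. Qed.

Let kR : {rmorphism K -> R} := iF \o inK.
Let hd := ppv_d. Let ht := ppv_t.

Lemma ppv_hom_ext (T : comNzRingType) (dt : T -> T) (a b : {rmorphism R -> T}) :
  (forall r, a (dtR r) = dt (a r)) -> (forall r, b (dtR r) = dt (b r)) ->
  (forall f, a (iF f) = b (iF f)) -> map_mx a Y = map_mx b Y -> forall r, a r = b r.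
Proof.
move=> ha hb ab abY; have [dinv [Yd gen]] := ppv_gen.
have it r k : a r = b r -> a (iter k dtR r) = b (iter k dtR r).
  by move=> e; elim: k => //= k IH; rewrite ha hb IH.
apply: gen => //.
- by rewrite !rmorph1.
- by move=> r s e e'; rewrite !rmorphB e e'.
- by move=> r s e e'; rewrite !rmorphM e e'.
- by move=> k i j; apply: it; have /matrixP/(_ i j) := abY; rewrite !mxE.
move=> k; apply: it.
have detE : a (\det Y) = b (\det Y) by rewrite -!det_map_mx abY.
have a1 : a (\det Y) * a dinv = 1 by rewrite -rmorphM Yd rmorph1.
have b1 : b (\det Y) * b dinv = 1 by rewrite -rmorphM Yd rmorph1.
by rewrite -[a dinv]mulr1 -b1 -detE mulrA [a dinv * _]mulrC a1 mul1r.
Qed.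

Lemma ppv_inverse : exists Yi : 'M[R]_n, [/\ Y *m Yi = 1%:M, Yi *m Y = 1%:M &
  map_mx dR Yi = - (Yi *m map_mx iF A)].
Proof.
have [dinv [Yd _]] := ppv_gen.
have Y1 : Y *m (dinv *: \adj Y) = 1%:M.
  by rewrite -scalemxAr mul_mx_adj scale_scalar_mx mulrC Yd.
have Y2 : (dinv *: \adj Y) *m Y = 1%:M.
  by rewrite -scalemxAl mul_adj_mx scale_scalar_mx mulrC Yd.
exists (dinv *: \adj Y); split=> //; set Yi := _ *: _ in Y1 Y2 *.
have /(congr1 (mulmx Yi)) : map_mx dR (Y *m Yi) = 0.
  by apply/matrixP=> i j; rewrite Y1 !mxE; case: eqP => _; rewrite ?(der1 hd) ?(der0 hd).
rewrite (der_mulmx hd) ppv_Y -[_ *m Y *m Yi]mulmxA Y1 mulmx1 mulmxDr mulmx0.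
by rewrite [Yi *m (Y *m _)]mulmxA Y2 mul1mx addrC => /eqP; rewrite addr_eq0 => /eqP.
Qed.

Section GalIntro.
Variables (S : comNzRingType) (kS : {rmorphism K -> S}) (dS : S -> S).
Hypothesis hS : dt_alg dK kS dS.
Let hdS : is_derivation dS. Proof. by case: hS. Qed.

Let zder : is_derivation (fun _ : S => 0).
Proof. by split=> a b; rewrite ?addr0 // mul0r mulr0 addr0. Qed.
Let kRd c : dR (kR c) = kR ((fun _ => 0) c).
Proof. by rewrite /= ppv_dF dFK !rmorph0. Qed.
Let kSd c : (fun _ : S => 0) (kS c) = kS ((fun _ => 0) c).
Proof. by rewrite rmorph0. Qed.
Let kRt c : dtR (kR c) = kR (dK c).
Proof. by rewrite /= ppv_tF dtK. Qed.
Let kSt c : dS (kS c) = kS (dK c). Proof. by case: hS. Qed.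

Definition gd : tensor kR kS -> tensor kR kS := @tder _ _ _ kR kS dR (fun _ => 0).
Definition gt : tensor kR kS -> tensor kR kS := @tder _ _ _ kR kS dtR dS.
Lemma gd_der : is_derivation gd. Proof. exact: (tder_derivation hd zder kRd kSd). Qed.
Lemma gt_der : is_derivation gt. Proof. exact: (tder_derivation ht hdS kRt kSt). Qed.
Lemma gd_inl r : gd (tinl kR kS r) = tinl kR kS (dR r).
Proof. exact: (tder_inl hd zder kRd kSd). Qed.
Lemma gd_inr s : gd (tinr kR kS s) = 0.
Proof. by rewrite /gd (tder_inr hd zder kRd kSd) rmorph0. Qed.
Lemma gt_inl r : gt (tinl kR kS r) = tinl kR kS (dtR r).
Proof. exact: (tder_inl ht hdS kRt kSt). Qed.
Lemma gt_inr s : gt (tinr kR kS s) = tinr kR kS (dS s).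
Proof. exact: (tder_inr ht hdS kRt kSt). Qed.

(** An automorphism over [F (x) S] is determined by its restriction to [R]; such a restriction can
    be built from generators of [R]. *)
Definition gal_hom (s : {rmorphism R -> tensor kR kS}) (g : 'M[S]_n) : Prop :=
  [/\ forall f, s (iF f) = tinl kR kS (iF f), forall r, s (dR r) = gd (s r),
      forall r, s (dtR r) = gt (s r) &
      map_mx s Y = map_mx (tinl kR kS) Y *m map_mx (tinr kR kS) g].

Lemma gal_ext (s : {rmorphism R -> tensor kR kS}) g : gal_hom s g ->
  exists h : {rmorphism tensor kR kS -> tensor kR kS},
   [/\ forall r, h (tinl kR kS r) = s r, forall u, h (tinr kR kS u) = tinr kR kS u,
       forall t, h (gd t) = gd (h t) & forall t, h (gt t) = gt (h t)].
Proof.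
move=> [sF sd st sY].
have [|h [hl hr]] := @tensor_map _ _ _ kR kS _ s (tinr kR kS).
  by move=> c; rewrite /= sF; apply: (tin_bal kR kS).
exists h; split=> //.
- apply: (der_hom_eq gd_der gd_der) => r; first by rewrite gd_inl !hl sd.
  by rewrite gd_inr !hr rmorph0 gd_inr.
- apply: (der_hom_eq gt_der gt_der) => r; first by rewrite gt_inl !hl st.
  by rewrite gt_inr !hr gt_inr.
Qed.

Lemma gal_cancel s s' g g' (h h' : {rmorphism tensor kR kS -> tensor kR kS}) :
  gal_hom s g -> gal_hom s' g' -> g *m g' = 1%:M ->
  (forall r, h (tinl kR kS r) = s r) -> (forall u, h (tinr kR kS u) = tinr kR kS u) ->
  (forall t, h (gt t) = gt (h t)) ->
  (forall r, h' (tinl kR kS r) = s' r) -> (forall u, h' (tinr kR kS u) = tinr kR kS u) ->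
  forall t, h (h' t) = t.
Proof.
move=> [sF _ _ sY] [s'F _ s't s'Y] gg' hl hr ht' h'l h'r t.
have -> : h (h' t) = (h \o h') t by [].
have -> : t = idfun t by [].
apply: (@tensor_hom_ext _ _ _ kR kS _ (h \o h') idfun) => [r|u] /=; last by rewrite h'r hr.
rewrite h'l; apply: (@ppv_hom_ext _ gt (h \o s') (tinl kR kS)) => [u|u|f|] /=.
- by rewrite s't ht'.
- by rewrite gt_inl.
- by rewrite s'F hl sF.
rewrite map_mx_comp s'Y map_mxM -!map_mx_comp.
have -> : map_mx (h \o tinl kR kS) Y = map_mx s Y by apply: eq_map_mx => r' /=; rewrite hl.
have -> : map_mx (h \o tinr kR kS) g' = map_mx (tinr kR kS) g'.
  by apply: eq_map_mx => r' /=; rewrite hr.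
by rewrite sY -mulmxA -map_mxM gg' map_mx1 mulmx1.
Qed.

(** The extensions attached to inverse matrices are inverse to each other, since they agree with the
    identity on [Y]. Bijectivity is thus obtained from a second map rather than proved directly. *)
Lemma gal_intro s s' g g' : gal_hom s g -> gal_hom s' g' ->
  g *m g' = 1%:M -> g' *m g = 1%:M -> Gal_pt inK dK iF dR dtR Y kS dS g.
Proof.
move=> hs hs' gg' g'g.
have [h [hl hr h1 h2]] := gal_ext hs; have [h' [h'l h'r h'1 h'2]] := gal_ext hs'.
split; first by exists g'.
exists (tensor kR kS), (tinl kR kS), (tinr kR kS), gd, gt, h.
split; first exact: is_tensor_tensor.
split; first exact: gd_der.
split; first exact: gt_der.
split; first exact: gd_inl.
split; first exact: gd_inr.
split; first exact: gt_inl.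
split; first exact: gt_inr.
split.
  exists h'; first exact: (gal_cancel hs' hs g'g).
  exact: (gal_cancel hs hs' gg').
do 2?split=> //; split; first by move=> f; rewrite hl; case: hs.
split=> //; case: hs => _ _ _ <-; by apply: eq_map_mx => r; rewrite hl.
Qed.

Lemma gal_tensor_inj (T : comNzRingType) (jR : {rmorphism R -> T}) (jS : {rmorphism S -> T}) :
  is_tensor (fun k => iF (inK k)) kS jR jS -> injective jS.
Proof. exact: (@is_tensor_inj _ _ _ _ kR). Qed.
End GalIntro.
End PPVRing.

(** * The torsor of a PPV-ring *)

Section Torsor.
Variables (K F : fieldType) (inK : {rmorphism K -> F}) (dK : K -> K) (dF dtF : F -> F).
Hypothesis dFK : forall k, dF (inK k) = 0.
Hypothesis dtK : forall k, dtF (inK k) = inK (dK k).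
Hypothesis dF_const : forall f, dF f = 0 -> exists k, f = inK k.
Variables (R : comNzRingType) (iF : {rmorphism F -> R}) (dR dtR : R -> R).
Variables (n : nat) (A : 'M[F]_n) (Y : 'M[R]_n).
Hypothesis PPV : PPV_ring dF dtF iF dR dtR A Y.
Let kR : {rmorphism K -> R} := iF \o inK.
Let hd := ppv_d PPV. Let ht := ppv_t PPV.

Lemma ppv_const r : dR r = 0 -> exists k, r = kR k.
Proof.
move=> r0; have [f rE] : exists f, r = iF f by case: PPV => _ [_ [_ [_ [_ [_ [_ [h _]]]]]]]; apply: h.
have [|k fE] := dF_const (f := f); last by exists k; rewrite rE fE.
by apply: (fmorph_inj iF); rewrite -(ppv_dF PPV) -rE r0 rmorph0.
Qed.

Lemma ppv_simple (I : R -> Prop) :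
     I 0 -> (forall a b, I a -> I b -> I (a + b)) -> (forall a b, I b -> I (a * b)) ->
     (forall a, I a -> I (dR a)) ->
     (forall r, I r -> r = 0) \/ (forall r, I r).
Proof. by case: PPV => _ [_ [_ [_ [_ [_ [_ [_ [_ h]]]]]]]]; apply: h. Qed.

Notation T2 := (tensor iF iF).
Notation inl2 := (tinl iF iF).
Notation inr2 := (tinr iF iF).
(** Here [d] acts on both factors, whereas [gd] is zero on the second one. The quotient of the two
    copies of [Y] is constant for this derivation. *)
Definition d2 : T2 -> T2 := @tder _ _ _ iF iF dR dR.
Definition t2 : T2 -> T2 := @tder _ _ _ iF iF dtR dtR.
Lemma d2_der : is_derivation d2. Proof. exact: (tder_derivation hd hd (ppv_dF PPV) (ppv_dF PPV)). Qed.
Lemma t2_der : is_derivation t2. Proof. exact: (tder_derivation ht ht (ppv_tF PPV) (ppv_tF PPV)). Qed.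
Lemma d2_inl r : d2 (inl2 r) = inl2 (dR r).
Proof. exact: (tder_inl hd hd (ppv_dF PPV) (ppv_dF PPV)). Qed.
Lemma d2_inr r : d2 (inr2 r) = inr2 (dR r).
Proof. exact: (tder_inr hd hd (ppv_dF PPV) (ppv_dF PPV)). Qed.
Lemma t2_inl r : t2 (inl2 r) = inl2 (dtR r).
Proof. exact: (tder_inl ht ht (ppv_tF PPV) (ppv_tF PPV)). Qed.
Lemma t2_inr r : t2 (inr2 r) = inr2 (dtR r).
Proof. exact: (tder_inr ht ht (ppv_tF PPV) (ppv_tF PPV)). Qed.

Lemma comm_step (T : comNzRingType) (D E : T -> T) a b : is_derivation D -> is_derivation E ->
  D (E a) = E (D a) -> D (E b) = E (D b) ->
  D (E (a + b)) = E (D (a + b)) /\ D (E (a * b)) = E (D (a * b)).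
Proof.
move=> hD hE ea eb; split; first by rewrite (derD hE) (derD hD) (derD hD) (derD hE) ea eb.
rewrite (derM hE) (derD hD) !(derM hD) (derD hE) !(derM hE) ea eb.
by rewrite addrACA.
Qed.

Lemma d2_t2 a : d2 (t2 a) = t2 (d2 a).
Proof.
elim/tensor_ring_ind: a => [r|r|a b ea eb|a b ea eb].
- by rewrite t2_inl !d2_inl t2_inl (ppv_comm PPV).
- by rewrite t2_inr !d2_inr t2_inr (ppv_comm PPV).
- by case: (comm_step d2_der t2_der ea eb).
- by case: (comm_step d2_der t2_der ea eb).
Qed.

Definition k2 : {rmorphism K -> T2} := inl2 \o kR.
Lemma d2_k2 k : d2 (k2 k) = 0.
Proof. by rewrite /= d2_inl (ppv_dF PPV) dFK !rmorph0. Qed.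
Lemma t2_k2 k : t2 (k2 k) = k2 (dK k).
Proof. by rewrite /= t2_inl (ppv_tF PPV) dtK. Qed.
Definition DD2 : ddalg dK := DDAlg d2_der t2_der d2_t2 d2_k2 t2_k2.
Notation C2 := (dd_csts DD2).
Lemma t2_val (c : C2) : dd_val DD2 (dd_tc c) = t2 (dd_val DD2 c). Proof. exact: (dd_tcE c). Qed.
Lemma d2_val (c : C2) : d2 (dd_val DD2 c) = 0. Proof. exact: (dd_val_d c). Qed.

(** Structure map for the triple tensor product, formed as [T2 (x)_F R]; the cocycle identity lives
    there. *)
Definition f2 : {rmorphism F -> T2} := inl2 \o iF.
Notation T3 := (tensor f2 iF).
Notation inl3 := (tinl f2 iF).
Notation inr3 := (tinr f2 iF).
Lemma d2_f2 f : d2 (f2 f) = f2 (dF f). Proof. by rewrite /= d2_inl (ppv_dF PPV). Qed.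
Lemma t2_f2 f : t2 (f2 f) = f2 (dtF f). Proof. by rewrite /= t2_inl (ppv_tF PPV). Qed.
Definition d3 : T3 -> T3 := @tder _ _ _ f2 iF d2 dR.
Definition t3 : T3 -> T3 := @tder _ _ _ f2 iF t2 dtR.
Lemma d3_der : is_derivation d3. Proof. exact: (tder_derivation d2_der hd d2_f2 (ppv_dF PPV)). Qed.
Lemma t3_der : is_derivation t3. Proof. exact: (tder_derivation t2_der ht t2_f2 (ppv_tF PPV)). Qed.
Lemma d3_inl r : d3 (inl3 r) = inl3 (d2 r).
Proof. exact: (tder_inl d2_der hd d2_f2 (ppv_dF PPV)). Qed.
Lemma d3_inr r : d3 (inr3 r) = inr3 (dR r).
Proof. exact: (tder_inr d2_der hd d2_f2 (ppv_dF PPV)). Qed.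
Lemma t3_inl r : t3 (inl3 r) = inl3 (t2 r).
Proof. exact: (tder_inl t2_der ht t2_f2 (ppv_tF PPV)). Qed.
Lemma t3_inr r : t3 (inr3 r) = inr3 (dtR r).
Proof. exact: (tder_inr t2_der ht t2_f2 (ppv_tF PPV)). Qed.
Lemma d3_t3 a : d3 (t3 a) = t3 (d3 a).
Proof.
elim/tensor_ring_ind: a => [r|r|a b ea eb|a b ea eb].
- by rewrite t3_inl !d3_inl t3_inl d2_t2.
- by rewrite t3_inr !d3_inr t3_inr (ppv_comm PPV).
- by case: (comm_step d3_der t3_der ea eb).
- by case: (comm_step d3_der t3_der ea eb).
Qed.
Definition k3 : {rmorphism K -> T3} := inl3 \o k2.
Lemma d3_k3 k : d3 (k3 k) = 0.
Proof. by rewrite /= d3_inl d2_k2 rmorph0. Qed.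
Lemma t3_k3 k : t3 (k3 k) = k3 (dK k).
Proof. by rewrite /= t3_inl t2_k2. Qed.
Definition DD3 : ddalg dK := DDAlg d3_der t3_der d3_t3 d3_k3 t3_k3.

(** Both images of [Y] solve the same system [d Y = A Y], so they differ by a constant matrix. *)
Lemma hom_matrix_cst (T : comNzRingType) (D : T -> T) (a b : {rmorphism R -> T}) (Yi : 'M[R]_n) :
  is_derivation D -> (forall r, D (a r) = a (dR r)) -> (forall r, D (b r) = b (dR r)) ->
  (forall f, a (iF f) = b (iF f)) -> map_mx dR Yi = - (Yi *m map_mx iF A) ->
  map_mx D (map_mx a Yi *m map_mx b Y) = 0.
Proof.
move=> hD Da Db ab dYi; rewrite (der_mulmx hD).
have -> : map_mx D (map_mx a Yi) = map_mx a (map_mx dR Yi).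
  by apply/matrixP=> i j; rewrite !mxE Da.
have -> : map_mx D (map_mx b Y) = map_mx b (map_mx dR Y).
  by apply/matrixP=> i j; rewrite !mxE Db.
rewrite dYi (ppv_Y PPV) map_mxN !map_mxM mulNmx -!mulmxA.
have -> : map_mx a (map_mx iF A) = map_mx b (map_mx iF A).
  by apply/matrixP=> i j; rewrite !mxE ab.
by rewrite addNr.
Qed.

Let inlr f : inl2 (iF f) = inr2 (iF f). Proof. exact: (tin_bal iF iF). Qed.

Lemma torsor_matrix : exists G G' : 'M[C2]_n,
  [/\ map_mx inl2 Y *m map_mx (dd_val DD2) G = map_mx inr2 Y,
      map_mx inr2 Y *m map_mx (dd_val DD2) G' = map_mx inl2 Y,
      G *m G' = 1%:M & G' *m G = 1%:M].
Proof.
have [Yi [Y1 Y2 dYi]] := ppv_inverse PPV.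
have [|G GE] := @csts_mx _ _ d2_der _ _ (map_mx inl2 Yi *m map_mx inr2 Y).
  by apply: (hom_matrix_cst d2_der _ _ _ dYi) => r; rewrite /= ?d2_inl ?d2_inr ?inlr.
have [|G' G'E] := @csts_mx _ _ d2_der _ _ (map_mx inr2 Yi *m map_mx inl2 Y).
  by apply: (hom_matrix_cst d2_der _ _ _ dYi) => r; rewrite /= ?d2_inl ?d2_inr ?inlr.
have YYi (h : {rmorphism R -> T2}) : map_mx h Y *m map_mx h Yi = 1%:M.
  by rewrite -map_mxM Y1 map_mx1.
have YiY (h : {rmorphism R -> T2}) : map_mx h Yi *m map_mx h Y = 1%:M.
  by rewrite -map_mxM Y2 map_mx1.
exists G, G'; split.
- by rewrite [map_mx _ G]GE mulmxA YYi mul1mx.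
- by rewrite [map_mx _ G']G'E mulmxA YYi mul1mx.
- apply: (@cstv_mx_inj _ _ d2_der); rewrite map_mxM GE G'E map_mx1.
  by rewrite mulmxA -(mulmxA _ (map_mx inr2 Y)) YYi mulmx1 YiY.
- apply: (@cstv_mx_inj _ _ d2_der); rewrite map_mxM GE G'E map_mx1.
  by rewrite mulmxA -(mulmxA _ (map_mx inl2 Y)) YYi mulmx1 YiY.
Qed.

Notation kC := (dd_kc DD2).
Notation TK := (tensor kR kC).

Lemma torsor_map : exists iota : {rmorphism TK -> T2},
  (forall r, iota (tinl kR kC r) = inl2 r) /\ (forall c, iota (tinr kR kC c) = dd_val DD2 c).
Proof. by apply: tensor_map => c; rewrite dd_kcE. Qed.

Definition kspan (cs : seq C2) (c : C2) : Prop :=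
  exists k : nat -> K, c = \sum_(i < size cs) kC (k i) * cs`_i.
Fixpoint kfree (cs : seq C2) : Prop :=
  if cs is c :: cs' then ~ kspan cs' c /\ kfree cs' else True.
Definition Rcomb (cs : seq C2) (a : nat -> R) : T2 :=
  \sum_(i < size cs) inl2 (a i) * dd_val DD2 cs`_i.

Lemma kfree_rep (t : TK) : exists cs (a : nat -> R), kfree cs /\ t = \sum_(i < size cs) pure kR kC (a i) cs`_i.
Proof.
rewrite [t]tensor_sum; elim: (repr t) => [|[r c] l [cs [a [fcs IH]]]].
  by exists [::], (fun=> 0); rewrite !big_nil big_ord0.
rewrite big_cons IH /=; have [[k cE]|nsp] := pselect (kspan cs c); last first.
  exists (c :: cs), (fun i => if i is j.+1 then a j else r); split=> //.
  by rewrite big_ord_recl.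
exists cs, (fun i => kR (k i) * r + a i); split=> //.
rewrite cE (big_morph (pure kR kC r) (pureDr kR kC r) (pure0r kR kC r)) -big_split.
by apply: eq_bigr => i _ /=; rewrite pureDl (pureZ kR kC).
Qed.

(* Constants of R (x)_F R that are independent over K stay independent over R:
   the possible leading coefficients of a relation form a d-ideal of R. *)
Lemma kfree_Rfree cs : kfree cs -> forall a, Rcomb cs a = 0 ->
  forall i, (i < size cs)%N -> a i = 0.
Proof.
elim: cs => [|c cs IH] //= [nsp /IH{}IH] a.
have RcombS b : Rcomb (c :: cs) b = inl2 (b 0%N) * dd_val DD2 c + Rcomb cs (b \o succn).
  by rewrite /Rcomb big_ord_recl.
have RcombD b b' : Rcomb cs (fun i => b i + b' i) = Rcomb cs b + Rcomb cs b'.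
  by rewrite -big_split; apply: eq_bigr => i _; rewrite rmorphD mulrDl.
have RcombZ r b : Rcomb cs (fun i => r * b i) = inl2 r * Rcomb cs b.
  by rewrite mulr_sumr; apply: eq_bigr => i _; rewrite rmorphM mulrA.
have Rcombd b : d2 (Rcomb cs b) = Rcomb cs (fun i => dR (b i)).
  rewrite (der_sum d2_der); apply: eq_bigr => i _.
  by rewrite (derM d2_der) d2_val mulr0 addr0 d2_inl.
pose I r := exists b, inl2 r * dd_val DD2 c + Rcomb cs b = 0.
have [||||I0|I1] := @ppv_simple I.
- exists (fun=> 0); rewrite rmorph0 mul0r add0r /Rcomb big1 // => i _.
  by rewrite rmorph0 mul0r.
- move=> r r' [b e] [b' e']; exists (fun i => b i + b' i).
  by rewrite rmorphD mulrDl RcombD addrACA e e' addr0.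
- move=> r r' [b e]; exists (fun i => r * b i).
  by rewrite rmorphM -mulrA RcombZ -mulrDr e mulr0.
- move=> r [b e]; exists (fun i => dR (b i)); have := congr1 d2 e.
  rewrite (derD d2_der) (derM d2_der) d2_val mulr0 addr0 d2_inl Rcombd.
  by rewrite (der0 d2_der).
- move=> e; have a0 : a 0%N = 0 by apply: I0; exists (a \o succn); rewrite -RcombS.
  move: e; rewrite RcombS a0 rmorph0 mul0r add0r => /IH h [|i] //=.
  exact: h.
have [b e] := I1 1; exfalso; apply: nsp.
(* Once 1 is a leading coefficient, differentiating the relation removes its leading term. By
   induction the other coefficients are constants of [R], hence lie in [K], so [c] is in the span of
   [cs]. *)
have db i : (i < size cs)%N -> dR (b i) = 0.
  apply: (IH (fun i => dR (b i))); rewrite -Rcombd.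
  have := congr1 d2 e; rewrite (derD d2_der) rmorph1 mul1r d2_val add0r.
  by rewrite (der0 d2_der).
have kb i : exists k, (i < size cs)%N -> b i = kR k.
  have [/db/ppv_const[k ->]|lt] := boolP (i < size cs)%N; first by exists k.
  by exists 0.
exists (fun i => - sval (cid (kb i))); apply: (@dd_val_inj _ _ DD2).
move: e; rewrite rmorph1 mul1r => /eqP; rewrite addr_eq0 => /eqP ->.
rewrite rmorph_sum -sumrN; apply: eq_bigr => i _.
rewrite rmorphM dd_kcE rmorphN mulNr; congr (- (_ * _)).
by have := svalP (cid (kb i)) (ltn_ord i); move: (sval _) => k ->.
Qed.

Lemma torsor_inj (iota : {rmorphism TK -> T2}) :
  (forall r, iota (tinl kR kC r) = inl2 r) -> (forall c, iota (tinr kR kC c) = dd_val DD2 c) ->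
  injective iota.
Proof.
move=> il ir; suff ker t : iota t = 0 -> t = 0.
  move=> t t' /eqP; rewrite -subr_eq0 -rmorphB => /eqP/ker/eqP.
  by rewrite subr_eq0 => /eqP.
have [cs [a [fcs ->]]] := kfree_rep t.
rewrite rmorph_sum => e; rewrite big1 // => i _.
rewrite (@kfree_Rfree cs fcs a) ?pure0l // -[RHS]e.
by apply: eq_bigr => j _; rewrite pureE rmorphM il ir.
Qed.

(** The image is a [dt]-stable ring containing the first copy of [R] and the constants. It contains
    [1 (x) Y = (Y (x) 1) G], and the inverse of [1 (x) det Y] is the inverse of [det Y (x) 1] times
    [det G']. *)
Lemma torsor_surj (iota : {rmorphism TK -> T2}) :
  (forall r, iota (tinl kR kC r) = inl2 r) -> (forall c, iota (tinr kR kC c) = dd_val DD2 c) ->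
  forall r, exists t, iota t = inr2 r.
Proof.
move=> il ir; have [G [G' [YG YG' GG' _]]] := torsor_matrix.
have iot t : iota (@gt _ _ inK _ iF dtR _ kC (@dd_tc _ _ DD2) t) = t2 (iota t).
  apply: (der_hom_eq (gt_der dtK PPV (dd_csts_alg DD2)) t2_der) => s.
    by rewrite (gt_inl dtK PPV (dd_csts_alg DD2)) !il t2_inl.
  by rewrite (gt_inr dtK PPV (dd_csts_alg DD2)) !ir; exact: t2_val.
have it r : (exists t, iota t = inr2 r) -> forall k, exists t, iota t = inr2 (iter k dtR r).
  move=> h; elim=> [|k [t e]] //=; eexists; rewrite -t2_inr -e -iot; reflexivity.
have [dinv [Yd gen]] := ppv_gen PPV.
apply: gen.
- by exists 1; rewrite !rmorph1.
- by move=> a b [t e] [t' e']; exists (t - t'); rewrite !rmorphB e e'.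
- by move=> a b [t e] [t' e']; exists (t * t'); rewrite !rmorphM e e'.
- by move=> f; exists (tinl kR kC (iF f)); rewrite il inlr.
- move=> k i j; apply: it.
  exists (\sum_l tinl kR kC (Y i l) * tinr kR kC (G l j)); rewrite rmorph_sum.
  have /matrixP/(_ i j) := YG; rewrite !mxE => <-; apply: eq_bigr => l _.
  by rewrite rmorphM il ir !mxE.
move=> k; apply: it; exists (tinl kR kC dinv * tinr kR kC (\det G')).
rewrite rmorphM il ir -det_map_mx.
have e1 : inr2 (\det Y) * inr2 dinv = 1 by rewrite -rmorphM Yd rmorph1.
have e2 : inl2 (\det Y) * inl2 dinv = 1 by rewrite -rmorphM Yd rmorph1.
rewrite -[LHS]mulr1 -[X in _ * X]e1.
have -> : inl2 dinv * \det (map_mx (dd_val DD2) G') * (inr2 (\det Y) * inr2 dinv)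
  = (\det (map_mx inr2 Y *m map_mx (dd_val DD2) G') * inl2 dinv) * inr2 dinv.
  rewrite det_mulmx [in RHS]det_map_mx mulrA; congr (_ * _).
  by rewrite mulrC -mulrA; congr (_ * _); rewrite mulrC.
by rewrite YG' det_map_mx e2 mul1r.
Qed.

(** Through [R (x)_K C = R (x)_F R] the map [r |-> 1 (x) r] becomes a map from [R] to [R (x)_K C]
    that sends [Y] to [Y G]. The map for [G'] comes from exchanging the two factors, which induces
    on [C] a map taking [G] to [G']. *)
Lemma torsor_gal (G G' : 'M[C2]_n) :
  map_mx inl2 Y *m map_mx (dd_val DD2) G = map_mx inr2 Y ->
  map_mx inr2 Y *m map_mx (dd_val DD2) G' = map_mx inl2 Y ->
  G *m G' = 1%:M -> G' *m G = 1%:M ->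
  Gal_pt inK dK iF dR dtR Y kC (@dd_tc _ _ DD2) G.
Proof.
move=> YG YG' GG' G'G.
have hC := dd_csts_alg DD2.
have [iota [il ir]] := torsor_map.
have inj := torsor_inj il ir; have surj := torsor_surj il ir.
pose f r := sval (cid (surj r)).
have fE r : iota (f r) = inr2 r by exact: svalP (cid (surj r)).
have [|||s sf] := @rmorph_of R TK f.
- by move=> a b; apply: inj; rewrite rmorphD !fE rmorphD.
- by apply: inj; rewrite fE !rmorph1.
- by move=> a b; apply: inj; rewrite rmorphM !fE rmorphM.
have sE r : iota (s r) = inr2 r by rewrite sf fE.
pose GD := @gd _ _ inK _ iF dR _ kC : TK -> TK.
pose GT := @gt _ _ inK _ iF dtR _ kC (@dd_tc _ _ DD2) : TK -> TK.
have hGD : is_derivation GD by exact: (gd_der dFK PPV kC).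
have hGT : is_derivation GT by exact: (gt_der dtK PPV hC).
have iod t : iota (GD t) = d2 (iota t).
  apply: (der_hom_eq hGD d2_der) => c.
    by rewrite /GD (gd_inl dFK PPV) !il d2_inl.
  by rewrite /GD (gd_inr dFK PPV) !ir rmorph0 d2_val.
have iot t : iota (GT t) = t2 (iota t).
  apply: (der_hom_eq hGT t2_der) => c.
    by rewrite /GT (gt_inl dtK PPV hC) !il t2_inl.
  by rewrite /GT (gt_inr dtK PPV hC) !ir; exact: t2_val.
have hs : gal_hom dR dtR Y (@dd_tc _ _ DD2) s G.
  split=> [c|r|r|].
  - by apply: inj; rewrite sE il inlr.
  - by apply: inj; rewrite [RHS]iod !sE d2_inr.
  - by apply: inj; rewrite [RHS]iot !sE t2_inr.
  apply/matrixP=> i j; rewrite !mxE; apply: inj; rewrite sE rmorph_sum.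
  have /matrixP/(_ i j) := YG; rewrite !mxE => <-; apply: eq_bigr => l _.
  by rewrite !mxE rmorphM il ir.
have [tau [taul taur]] := @tensor_map _ _ _ iF iF _ inr2 inl2 (fun c => esym (inlr c)).
have [|||tauC [tauE [tauk taut]]] := @dd_hom _ _ DD2 DD2 tau.
- by apply: (der_hom_eq d2_der d2_der) => r; rewrite /= ?d2_inl ?d2_inr ?taul ?taur ?d2_inl ?d2_inr.
- by apply: (der_hom_eq t2_der t2_der) => r; rewrite /= ?t2_inl ?t2_inr ?taul ?taur ?t2_inl ?t2_inr.
- by move=> k /=; rewrite taul inlr.
have tauG : map_mx tauC G = G'.
  have : map_mx inr2 Y *m map_mx (dd_val DD2) (map_mx tauC G) = map_mx inl2 Y.
    have := congr1 (map_mx tau) YG; rewrite map_mxM -!map_mx_comp.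
    have -> : map_mx (tau \o inl2) Y = map_mx inr2 Y by apply: eq_map_mx => r /=; rewrite taul.
    have -> : map_mx (tau \o inr2) Y = map_mx inl2 Y by apply: eq_map_mx => r /=; rewrite taur.
    move=> <-; congr (_ *m _); apply: eq_map_mx => c /=; exact: tauE.
  rewrite -YG'; have [Yi [_ Y2 _]] := ppv_inverse PPV.
  move/(congr1 (mulmx (map_mx inr2 Yi))); rewrite !mulmxA -map_mxM Y2 map_mx1 !mul1mx.
  exact: cstv_mx_inj.
have [|h [hl hr]] := @tensor_map _ _ _ kR kC _ (tinl kR kC) (tinr kR kC \o tauC).
  by move=> c /=; rewrite tauk; apply: (tin_bal kR kC).
have [hF hsd hst hsY] := hs.
have hs' : gal_hom dR dtR Y (@dd_tc _ _ DD2) (h \o s) G'.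
  split=> [c|r|r|] /=.
  - by rewrite hF hl.
  - rewrite hsd; apply: (der_hom_eq hGD hGD) => c.
      by rewrite /GD hl !(gd_inl dFK PPV) hl.
    by rewrite /GD hr !(gd_inr dFK PPV) rmorph0.
  - rewrite hst; apply: (der_hom_eq hGT hGT) => c.
      by rewrite /GT hl !(gt_inl dtK PPV hC) hl.
    by rewrite /GT hr !(gt_inr dtK PPV hC) hr /= taut.
  rewrite map_mx_comp hsY map_mxM -!map_mx_comp -tauG; congr (_ *m _).
    by apply: eq_map_mx => r /=; rewrite hl.
  by rewrite -map_mx_comp; apply: eq_map_mx => c /=; rewrite hr.
exact: (gal_intro dFK dtK PPV hC hs hs').
Qed.
End Torsor.

(** * The universal cocycle *)

Section Contraction.
Variables (k : fieldType) (R S : comNzRingType).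
Variables (kR : {rmorphism k -> R}) (kS : {rmorphism k -> S}).

Definition contract (f : S -> k) : tensor kR kS -> R := tlift (fun r s => r * kR (f s)).

Lemma contract_pure f r s : klinear kS f -> contract f (pure kR kS r s) = r * kR (f s).
Proof. by move=> fl; apply: tlift_pure; apply: contractr_balanced. Qed.
Lemma contractD f t t' : klinear kS f -> contract f (t + t') = contract f t + contract f t'.
Proof. by move=> fl; apply: tlift_add; apply: contractr_balanced. Qed.
Lemma contract_linear f r t : klinear kS f ->
  contract f (tinl kR kS r * t) = r * contract f t.
Proof.
move=> fl; elim/tensor_ind: t => [r' s|t t' h h']; last by rewrite mulrDr !contractD // h h' mulrDr.
by rewrite /tinl pureM !contract_pure // mul1r mulrA.
Qed.

(** Induction on the length of a representation: either the first right-hand entry lies in the span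
    of the others and the sum can be shortened, or a functional vanishing on the others isolates its
    left-hand entry, which is then 0. *)
Lemma contract_eq0 t : (forall f, klinear kS f -> contract f t = 0) -> t = 0.
Proof.
rewrite [t]tensor_sum; move: (repr t) => l.
have [n] := ubnP (size l); elim: n l => // n IH [|[r s] l] /= ltn h; first by rewrite big_nil.
pose W z := exists c : nat -> k, z = \sum_(i < size l) kS (c i) * (nth (0, 0) l i).2.
have sumE (g : R * S -> tensor kR kS) : \sum_(p <- l) g p = \sum_(i < size l) g (nth (0, 0) l i).
  by rewrite (big_nth (0, 0)) big_mkord.
have [[c sE]|nW] := pselect (W s).
  pose l' := [seq ((nth (0, 0) l i).1 + kR (c i) * r, (nth (0, 0) l i).2) | i <- index_iota 0 (size l)].
  have e : \sum_(p <- (r, s) :: l) pure kR kS p.1 p.2 = \sum_(p <- l') pure kR kS p.1 p.2.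
    rewrite big_cons sumE /= sE (big_morph (pure kR kS r) (pureDr kR kS r) (pure0r kR kS r)).
    rewrite -big_split big_map big_mkord.
    by apply: eq_bigr => i _ /=; rewrite pureDl (pureZ kR kS) addrC.
  rewrite e; apply: IH; first by rewrite size_map size_iota subn0.
  by move=> f fl; rewrite -e; apply: h.
have sW : ksubspace kS W.
  split; first by exists (fun=> 0); rewrite big1 // => i _; rewrite rmorph0 mul0r.
  split.
    move=> a b [c ->] [c' ->]; exists (fun i => c i + c' i); rewrite -big_split.
    by apply: eq_bigr => i _; rewrite rmorphD mulrDl.
  move=> c a [c' ->]; exists (fun i => c * c' i); rewrite mulr_sumr.
  by apply: eq_bigr => i _; rewrite rmorphM mulrA.
have [f [fl [fW fs]]] := klinear_sep sW nW.
have lW p : p \in l -> W p.2.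
  move=> pl; exists (fun i => (i == index p l)%:R); have lt : (index p l < size l)%N by rewrite index_mem.
  rewrite (bigD1 (Ordinal lt)) //= eqxx rmorph1 mul1r nth_index // big1 ?addr0 // => i ni.
  rewrite [_ == _](_ : _ = false) ?rmorph0 ?mul0r //; apply/negbTE.
  by apply: contra ni => /eqP e; apply/eqP/val_inj.
have r0 : r = 0.
  have := h f fl; rewrite big_cons contractD // contract_pure // fs rmorph1 mulr1 /=.
  rewrite [X in _ + X](_ : _ = 0) ?addr0 // big_seq.
  elim/big_rec: _ => [|p t' pl e].
    by rewrite -(pure0l kR kS 0) contract_pure // mul0r.
  by rewrite contractD // e addr0 contract_pure // fW ?rmorph0 ?mulr0 //; apply: lW.
rewrite big_cons /= r0 pure0l add0r; apply: IH => // f' fl'.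
by have := h f' fl'; rewrite big_cons /= r0 pure0l add0r.
Qed.
End Contraction.

Section Cocycle.
Variables (K F : fieldType) (inK : {rmorphism K -> F}) (dK : K -> K) (dF dtF : F -> F).
Hypothesis dFK : forall k, dF (inK k) = 0.
Hypothesis dtK : forall k, dtF (inK k) = inK (dK k).
Hypothesis dF_const : forall f, dF f = 0 -> exists k, f = inK k.
Variables (R : comNzRingType) (iF : {rmorphism F -> R}) (dR dtR : R -> R).
Variables (n : nat) (A : 'M[F]_n) (Y : 'M[R]_n).
Hypothesis PPV : PPV_ring dF dtF iF dR dtR A Y.
Let kR : {rmorphism K -> R} := iF \o inK.
Let hd := ppv_d PPV. Let ht := ppv_t PPV.
Notation T2 := (tensor iF iF).
Notation inl2 := (tinl iF iF).
Notation inr2 := (tinr iF iF).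
Notation T3 := (tensor (f2 iF) iF).
Notation inl3 := (tinl (f2 iF) iF).
Notation inr3 := (tinr (f2 iF) iF).
Notation DD2 := (DD2 dFK dtK PPV).
Notation DD3 := (DD3 dFK dtK PPV).
Notation C2 := (dd_csts DD2).

(** The embeddings of [R (x)_F R] on the factors 1,3 and 2,3 of the triple product; the one on 1,2
    is [inl3]. *)
Lemma cross_maps : exists q13 q23 : {rmorphism T2 -> T3},
  [/\ forall a, q13 (inl2 a) = inl3 (inl2 a), forall b, q13 (inr2 b) = inr3 b,
      forall a, q23 (inl2 a) = inl3 (inr2 a) & forall b, q23 (inr2 b) = inr3 b].
Proof.
have [|q13 [l1 r1]] := @tensor_map _ _ _ iF iF _ (inl3 \o inl2) inr3.
  by move=> f; exact: (tin_bal (f2 iF) iF f).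
have [|q23 [l2 r2]] := @tensor_map _ _ _ iF iF _ (inl3 \o inr2) inr3.
  by move=> f /=; rewrite -(tin_bal iF iF); exact: (tin_bal (f2 iF) iF f).
by exists q13, q23.
Qed.

Variables (Gpt : forall S : comNzRingType, {rmorphism K -> S} -> (S -> S) -> S -> Prop).
Variable (Gmul : forall S : comNzRingType, S -> S -> S).
Variable phi : forall S : comNzRingType, {rmorphism K -> S} -> (S -> S) -> S -> 'M[S]_n.
Hypothesis phiP : forall (S : comNzRingType) (kS : {rmorphism K -> S}) dS, dt_alg dK kS dS ->
   (forall u, Gpt kS dS u -> Gal_pt inK dK iF dR dtR Y kS dS (phi kS dS u)) /\
   (forall u v, Gpt kS dS u -> Gpt kS dS v -> phi kS dS u = phi kS dS v -> u = v) /\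
   (forall g, Gal_pt inK dK iF dR dtR Y kS dS g -> exists u, Gpt kS dS u /\ phi kS dS u = g) /\
   (forall u v, Gpt kS dS u -> Gpt kS dS v ->
      phi kS dS (Gmul u v) = phi kS dS u *m phi kS dS v).
Hypothesis phi_nat : forall (S S' : comNzRingType) (kS : {rmorphism K -> S})
   (kS' : {rmorphism K -> S'}) dS dS' (h : {rmorphism S -> S'}),
   dt_alg dK kS dS -> dt_alg dK kS' dS' -> dt_alg_hom kS kS' dS dS' h ->
   forall u, Gpt kS dS u -> phi kS' dS' (h u) = map_mx h (phi kS dS u).
Hypothesis Gpt_nat : forall (S S' : comNzRingType) (kS : {rmorphism K -> S})
   (kS' : {rmorphism K -> S'}) dS dS' (h : {rmorphism S -> S'}),
   dt_alg dK kS dS -> dt_alg dK kS' dS' -> dt_alg_hom kS kS' dS dS' h ->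
   forall u, Gpt kS dS u -> Gpt kS' dS' (h u).
Hypothesis Gmul_pt : forall (S : comNzRingType) (kS : {rmorphism K -> S}) dS,
   dt_alg dK kS dS -> forall u v, Gpt kS dS u -> Gpt kS dS v -> Gpt kS dS (Gmul u v).

Let inlr f : inl2 (iF f) = inr2 (iF f). Proof. exact: (tin_bal iF iF). Qed.

(** The point [u] corresponds to [G] under [phi]. Its cocycle identity is
    [(Y1^-1 Y2)(Y2^-1 Y3) = Y1^-1 Y3] for the three copies of [Y], carried to the group by
    naturality and injectivity of [phi]. The last clause is universality: every point [m], seen in
    an extension of its ring, is an image of [u]. *)
Lemma galois_cocycle : exists (u : C2) (q13 q23 : {rmorphism T2 -> T3})
    (c12 c13 c23 : dd_csts DD3),
  [/\ Gpt (dd_kc DD2) (@dd_tc _ _ DD2) u,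
      (forall a, q13 (inl2 a) = inl3 (inl2 a)) /\ (forall b, q13 (inr2 b) = inr3 b),
      (forall a, q23 (inl2 a) = inl3 (inr2 a)) /\ (forall b, q23 (inr2 b) = inr3 b),
      [/\ dd_val DD3 c12 = inl3 (dd_val DD2 u), dd_val DD3 c13 = q13 (dd_val DD2 u),
          dd_val DD3 c23 = q23 (dd_val DD2 u) & c13 = Gmul c12 c23] &
      forall (S : comNzRingType) (kS : {rmorphism K -> S}) dS m,
        dt_alg dK kS dS -> Gpt kS dS m ->
        exists (E : comNzRingType) (kE : {rmorphism K -> E}) (dE : E -> E)
               (jS : {rmorphism S -> E}) (psi : {rmorphism C2 -> E}),
        [/\ dt_alg dK kE dE, dt_alg_hom kS kE dS dE jS, injective jS,
            dt_alg_hom (dd_kc DD2) kE (@dd_tc _ _ DD2) dE psi & jS m = psi u]].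
Proof.
have [G [G' [YG YG' GG' G'G]]] := torsor_matrix dFK dtK PPV.
have hC2 := dd_csts_alg DD2; have hC3 := dd_csts_alg DD3.
have [Yi [_ YiY _]] := ppv_inverse PPV.
have canc (T : comNzRingType) (h : {rmorphism R -> T}) (M N : 'M[T]_n) :
    map_mx h Y *m M = map_mx h Y *m N -> M = N.
  by move/(congr1 (mulmx (map_mx h Yi))); rewrite !mulmxA -map_mxM YiY map_mx1 !mul1mx.
have [_ [_ [surj _]]] := phiP hC2.
have [u [Gu phiu]] := surj _ (torsor_gal dF_const YG YG' GG' G'G).
have [q13 [q23 [l13 r13 l23 r23]]] := cross_maps.
have hd2 := d2_der PPV; have ht2 := t2_der PPV.
have hd3 := d3_der PPV; have ht3 := t3_der PPV.
have [|||p12 [p12E h12]] := @dd_hom _ _ DD2 DD3 inl3.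
- by move=> a; rewrite /= (d3_inl PPV).
- by move=> a; rewrite /= (t3_inl PPV).
- by [].
have [|||p13 [p13E h13]] := @dd_hom _ _ DD2 DD3 q13.
- apply: (der_hom_eq hd2 hd3) => r.
    by rewrite /= (d2_inl PPV) !l13 (d3_inl PPV) (d2_inl PPV).
  by rewrite /= (d2_inr PPV) !r13 (d3_inr PPV).
- apply: (der_hom_eq ht2 ht3) => r.
    by rewrite /= (t2_inl PPV) !l13 (t3_inl PPV) (t2_inl PPV).
  by rewrite /= (t2_inr PPV) !r13 (t3_inr PPV).
- by move=> c /=; rewrite l13.
have [|||p23 [p23E h23]] := @dd_hom _ _ DD2 DD3 q23.
- apply: (der_hom_eq hd2 hd3) => r.
    by rewrite /= (d2_inl PPV) !l23 (d3_inl PPV) (d2_inr PPV).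
  by rewrite /= (d2_inr PPV) !r23 (d3_inr PPV).
- apply: (der_hom_eq ht2 ht3) => r.
    by rewrite /= (t2_inl PPV) !l23 (t3_inl PPV) (t2_inr PPV).
  by rewrite /= (t2_inr PPV) !r23 (t3_inr PPV).
- by move=> c /=; rewrite l23 -inlr.
exists u, q13, q23, (p12 u), (p13 u), (p23 u); split=> //.
  split=> //.
  have [_ [inj [_ mul]]] := phiP hC3.
  have G12 := Gpt_nat hC2 hC3 h12 Gu.
  have G13 := Gpt_nat hC2 hC3 h13 Gu.
  have G23 := Gpt_nat hC2 hC3 h23 Gu.
  apply: inj => //; first exact: Gmul_pt.
  rewrite mul // !(phi_nat hC2 hC3 _ Gu) // phiu.
  apply: (@cstv_mx_inj _ _ (dd_dP DD3)); apply: (canc _ (inl3 \o inl2)); rewrite map_mxM mulmxA.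
  have E12 : map_mx (inl3 \o inl2) Y *m map_mx (cstv (dd_dP DD3)) (map_mx p12 G) =
             map_mx (inl3 \o inr2) Y.
    have := congr1 (map_mx inl3) YG; rewrite map_mxM -!map_mx_comp => <-.
    by congr (_ *m _); apply: eq_map_mx => c /=; exact: p12E.
  have E13 : map_mx (inl3 \o inl2) Y *m map_mx (cstv (dd_dP DD3)) (map_mx p13 G) = map_mx inr3 Y.
    have := congr1 (map_mx q13) YG; rewrite map_mxM -!map_mx_comp.
    have -> : map_mx (q13 \o inr2) Y = map_mx inr3 Y by apply: eq_map_mx => r /=.
    have -> : map_mx (q13 \o inl2) Y = map_mx (inl3 \o inl2) Y by apply: eq_map_mx => r /=.
    move=> <-; congr (_ *m _); apply: eq_map_mx => c /=; exact: p13E.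
  have E23 : map_mx (inl3 \o inr2) Y *m map_mx (cstv (dd_dP DD3)) (map_mx p23 G) = map_mx inr3 Y.
    have := congr1 (map_mx q23) YG; rewrite map_mxM -!map_mx_comp.
    have -> : map_mx (q23 \o inr2) Y = map_mx inr3 Y by apply: eq_map_mx => r /=.
    have -> : map_mx (q23 \o inl2) Y = map_mx (inl3 \o inr2) Y by apply: eq_map_mx => r /=.
    move=> <-; congr (_ *m _); apply: eq_map_mx => c /=; exact: p23E.
  by rewrite E12 E13 E23.
move=> S kS dS m hS Gm; have [gal [injS _]] := phiP hS.
have [_ [T [jR [jS [dT [dtT [sigma [ten H]]]]]]]] := gal _ Gm.
have [hdT [hdtT [dTR [dTS [tTR [tTS H']]]]]] := H.
have [_ [sd [st [sF [_ sY]]]]] := H'.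
have comm t : dT (dtT t) = dtT (dT t).
  apply: (@is_tensor_ind _ _ _ _ _ kR kS jR jS (fun t => dT (dtT t) = dtT (dT t)) _ ten) => //.
  - by move=> r; rewrite tTR !dTR tTR (ppv_comm PPV).
  - by move=> s; rewrite tTS !dTS (der0 hdtT).
  - by move=> a b ea eb; case: (comm_step hdT hdtT ea eb).
  - by move=> a b ea eb; case: (comm_step hdT hdtT ea eb).
have jk k : jR (iF (inK k)) = jS (kS k) by case: ten.
pose kT : {rmorphism K -> T} := jR \o kR.
have dkT k : dT (kT k) = 0 by rewrite /= jk dTS.
have tkT k : dtT (kT k) = kT (dK k) by rewrite /= tTR (ppv_tF PPV) dtK.
pose E0 : ddalg dK := DDAlg hdT hdtT comm dkT tkT.
(* The automorphism that represents [m] gives the map [a (x) b |-> a sigma(b)], which carries [G] to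
   the matrix of [m]. It maps [d]-constants to [d]-constants of [T], among which [S] embeds. *)
have [|psi [psil psir]] := @tensor_map _ _ _ iF iF _ jR (sigma \o jR).
  by move=> c /=; rewrite sF.
have [|||psiC [psiE hpsi]] := @dd_hom _ _ DD2 E0 psi.
- apply: (der_hom_eq hd2 hdT) => r; first by rewrite /= (d2_inl PPV) !psil dTR.
  by rewrite /= (d2_inr PPV) !psir /= -dTR sd.
- apply: (der_hom_eq ht2 hdtT) => r; first by rewrite /= (t2_inl PPV) !psil tTR.
  by rewrite /= (t2_inr PPV) !psir /= -tTR st.
- by move=> c /=; rewrite psil.
have [|||jC [jE hj]] := @dd_csts_hom _ _ E0 _ kS dS jS.
- by move=> s /=; rewrite dTS.
- by move=> s /=; rewrite tTS.
- by move=> c /=; rewrite jk.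
exists (dd_csts E0), (dd_kc E0), (@dd_tc _ _ E0), jC, psiC.
have hE := dd_csts_alg E0; split=> //.
  by move=> s s' e; apply: (gal_tensor_inj ten); rewrite -!jE e.
have [_ [injE _]] := phiP hE.
apply: injE; [exact: (Gpt_nat hS hE hj) | exact: (Gpt_nat hC2 hE hpsi) |].
rewrite (phi_nat hS hE hj Gm) (phi_nat hC2 hE hpsi Gu) phiu.
apply: (@cstv_mx_inj _ _ hdT); apply: (canc _ jR).
have -> : map_mx (cstv hdT) (map_mx jC (phi kS dS m)) = map_mx jS (phi kS dS m).
  by rewrite -map_mx_comp; apply: eq_map_mx => c /=; exact: jE.
have := congr1 (map_mx psi) YG; rewrite map_mxM -!map_mx_comp.
have -> : map_mx (psi \o inr2) Y = map_mx (fun r => sigma (jR r)) Y.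
  by apply: eq_map_mx => r /=; rewrite psir.
have -> : map_mx (psi \o inl2) Y = map_mx jR Y by apply: eq_map_mx => r /=.
rewrite -sY => <-; congr (_ *m _); apply: eq_map_mx => c /=; exact: esym (psiE _).
Qed.
End Cocycle.

(** * Necessity *)

Section SquareZero.
Variables (K : fieldType) (dK : K -> K) (hK : is_derivation dK) (L : {poly K}).

(* K + eps V with eps^2 = 0, where V = {poly K} carries the differential module
   structure in which eps * 1 is a generic solution of L. *)
Definition sqz : Type := (K * {poly K})%type.
HB.instance Definition _ := GRing.Zmodule.on sqz.

Definition sqz_mul (a b : sqz) : sqz := (a.1 * b.1, a.1 *: b.2 + b.1 *: a.2).
Definition sqz_one : sqz := (1, 0).
Fact sqz_mulA : associative sqz_mul.
Proof.
move=> a b c; congr (_, _) => /=; first by rewrite mulrA.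
by rewrite !scalerDr !scalerA addrA [c.1 * _]mulrC [c.1 * _]mulrC.
Qed.
Fact sqz_mulC : commutative sqz_mul.
Proof. by move=> a b; rewrite /sqz_mul mulrC addrC. Qed.
Fact sqz_mul1 : left_id sqz_one sqz_mul.
Proof. by case=> a b; rewrite /sqz_mul /= mul1r scale1r scaler0 addr0. Qed.
Fact sqz_mulD : left_distributive sqz_mul +%R.
Proof.
move=> a b c; congr (_, _) => /=; first by rewrite mulrDl.
by rewrite scalerDl scalerDr addrACA.
Qed.
Fact sqz_one_neq0 : sqz_one != 0.
Proof. by apply/eqP=> /(congr1 fst) /=; apply/eqP/oner_neq0. Qed.
HB.instance Definition _ :=
  GRing.Zmodule_isComNzRing.Build sqz sqz_mulA sqz_mulC sqz_mul1 sqz_mulD sqz_one_neq0.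

Definition sqz_in (k : K) : sqz := (k, 0).
Fact sqz_in_add : zmod_morphism sqz_in.
Proof. by move=> a b; congr (_, _); rewrite /= subr0. Qed.
Fact sqz_in_mul : monoid_morphism sqz_in.
Proof. by split=> // a b; congr (_, _); rewrite /= !scaler0 addr0. Qed.
HB.instance Definition _ := GRing.isZmodMorphism.Build K sqz sqz_in sqz_in_add.
HB.instance Definition _ := GRing.isMonoidMorphism.Build K sqz sqz_in sqz_in_mul.

(** The companion connection of [L]: ['X^i] stands for the i-th derivative of the generic solution,
    and the reduction modulo [L] imposes the equation. *)
Definition sqz_d (a : sqz) : sqz := (dK a.1, map_poly dK a.2 + ('X * a.2) %% L).

Lemma map_derD (p q : {poly K}) : map_poly dK (p + q) = map_poly dK p + map_poly dK q.
Proof. by apply/polyP=> i; rewrite coefD !coef_map_id0 ?(der0 hK) // coefD (derD hK). Qed.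

Lemma sqz_alg : dt_alg dK sqz_in sqz_d.
Proof.
split; first split=> a b.
- congr (_, _); rewrite /= ?(derD hK) // map_derD mulrDr modpD; ring.
- congr (_, _); rewrite /= ?(derM hK) // map_derD mulrDr modpD -!scalerAr !modpZl.
  have mZ (c : K) (p : {poly K}) : map_poly dK (c *: p) = dK c *: p + c *: map_poly dK p.
    apply/polyP=> i; rewrite coefD !coefZ !coef_map_id0 ?(der0 hK) //.
    by rewrite coefZ (derM hK).
  by rewrite !mZ !scalerDr; ring.
move=> k; congr (_, _) => /=; rewrite mulr0 mod0p addr0.
by apply/polyP=> i; rewrite coef_map_id0 ?(der0 hK) // coef0 (der0 hK).
Qed.

Hypothesis L_gt1 : (1 < size L)%N.

(** The bound on [i] ensures that only unreduced powers, whose coefficients are constant, get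
    differentiated. *)
Lemma sqz_iter i : (i < size L)%N -> iter i sqz_d (0, 1) = (0, 'X^i %% L).
Proof.
elim: i => [|i IH] lti; first by rewrite /= expr0 modp_small // size_poly1.
rewrite iterS IH ?(ltnW lti) // modp_small ?size_polyXn // /sqz_d /= (der0 hK) -exprS.
congr (_, _); rewrite [map_poly _ _](_ : _ = 0) ?add0r //.
apply/polyP=> j; rewrite coef_map_id0 ?(der0 hK) // coefXn coef0.
by case: eqP; rewrite ?(der1 hK) ?(der0 hK).
Qed.

Lemma sqz_op (N : {poly K}) : (size N <= size L)%N -> apply_op sqz_in sqz_d N (0, 1) = (0, N %% L).
Proof.
move=> sN; rewrite /apply_op.
have -> : N %% L = \sum_(i < size N) N`_i *: ('X^i %% L).
  rewrite -[N in LHS]coefK poly_def.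
  rewrite (big_morph (fun p => p %% L) (id1 := 0) (op1 := +%R)) ?mod0p //; last exact: modpD.
  by apply: eq_bigr => i _; rewrite modpZl.
rewrite (eq_bigr (fun i : 'I__ => ((0, N`_i *: ('X^i %% L)) : sqz))); last first.
  move=> i _; rewrite sqz_iter ?(leq_trans (ltn_ord i)) //.
  by congr (_, _) => /=; rewrite ?mulr0 // scaler0 addr0.
by elim/big_rec2: _ => // i p q _ ->; congr (_, _) => /=; rewrite addr0.
Qed.
End SquareZero.

(** The generic solution is a point of the group, since [L] reduces to 0 modulo itself; an operator
    of smaller order is its own remainder, so it kills this point only if it is 0. *)
Lemma Ga_test (K : fieldType) (dK : K -> K) (L M : {poly K}) : is_derivation dK ->
  (size M < size L)%N ->
  (forall (S : comNzRingType) (kS : {rmorphism K -> S}) dS m, dt_alg dK kS dS ->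
     Ga_pt L kS dS m -> apply_op kS dS M m = 0) -> M = 0.
Proof.
move=> hK ltML h; have [L1|L1] := ltnP 1 (size L); last first.
  by apply/eqP; rewrite -size_poly_eq0; move: ltML L1; lia.
have hS := sqz_alg hK L.
have := h (sqz K : comNzRingType) (@sqz_in K) (sqz_d dK L) (0, 1) hS; rewrite /Ga_pt !(sqz_op hK L1) ?(ltnW ltML) //.
by rewrite modpp modp_small // => /(_ erefl) [].
Qed.

(** The unit [1 + eps], with [eps] a generic solution of [L * 'X], has logarithmic derivative
    [dt(eps)]. On it [N] acts as [N * 'X] acts on [eps], which reduces the matter to remainders
    modulo [L * 'X]. *)
Lemma Gm_test (K : fieldType) (dK : K -> K) (L M : {poly K}) : is_derivation dK ->
  (size M < size L)%N ->
  (forall (S : comNzRingType) (kS : {rmorphism K -> S}) dS m v, dt_alg dK kS dS ->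
     Gm_pt L kS dS m -> m * v = 1 -> apply_op kS dS M (dS m * v) = 0) -> M = 0.
Proof.
move=> hK ltML h; have L0 : L != 0 by rewrite -size_poly_gt0; move: ltML; lia.
have sLX : size (L * 'X) = (size L).+1 by rewrite size_mulX.
have L1 : (1 < size (L * 'X)%R)%N by rewrite sLX ltnS size_poly_gt0.
have hS := sqz_alg hK (L * 'X).
pose l : sqz K := (1, 1); pose v : sqz K := (1, -1).
have lv : l * v = 1 by congr (_, _); rewrite /= ?mulr1 // !scale1r addNr.
have dl : sqz_d dK (L * 'X) l * v = sqz_d dK (L * 'X) (0, 1).
  congr (_, _); rewrite /= ?(der1 hK) ?(der0 hK) ?mul0r // scale0r add0r scale1r //.
have e (N : {poly K}) : (size N <= size L)%N ->
    apply_op (@sqz_in K) (sqz_d dK (L * 'X)) N (sqz_d dK (L * 'X) l * v) = (0, (N * 'X) %% (L * 'X)).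
  move=> sN; rewrite dl -apply_opX (sqz_op hK L1) // sLX.
  by rewrite (leq_trans (size_polyMleq _ _)) // size_polyX addn2.
have Gl : Gm_pt L (@sqz_in K) (sqz_d dK (L * 'X)) l.
  by exists v; split=> //; rewrite e // modpp.
have := h (sqz K : comNzRingType) (@sqz_in K) (sqz_d dK (L * 'X)) l v hS Gl lv.
rewrite e ?(ltnW ltML) // modp_small; last first.
  by rewrite sLX ltnS (leq_trans (size_polyMleq _ _)) // size_polyX addn2.
by case=> /eqP; rewrite mulf_eq0 polyX_eq0 orbF => /eqP.
Qed.

(** * Descent to [F] and exactness of primitives *)

Section Primitive.
Variables (K F : fieldType) (inK : {rmorphism K -> F}) (dK : K -> K) (dF dtF : F -> F).
Hypothesis dFK : forall k, dF (inK k) = 0.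
Hypothesis dtK : forall k, dtF (inK k) = inK (dK k).
Variables (R : comNzRingType) (iF : {rmorphism F -> R}) (dR dtR : R -> R).
Variables (n : nat) (A : 'M[F]_n) (Y : 'M[R]_n).
Hypothesis PPV : PPV_ring dF dtF iF dR dtR A Y.
Let kR : {rmorphism K -> R} := iF \o inK.
Notation inl2 := (tinl iF iF).
Notation inr2 := (tinr iF iF).

(** Contracting the second factor with a functional [l] normalised at 1 turns the equality into
    [y = iF (l y)]. *)
Lemma descent y : inl2 y = inr2 y <-> exists f, y = iF f.
Proof.
split=> [e|[f ->]]; last exact: (tin_bal iF iF).
have [l [ll l1]] := klinear_one iF.
have := congr1 (contract l) e; rewrite !contract_pure // l1 rmorph1 mulr1 mul1r => ->.
by exists (l y).
Qed.

(** [M w] is a primitive of [M b] in [R], and two primitives differ by a constant, which lies in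
    [F]. Hence [M b] is exact in [F] exactly when [M w] itself lies in [F]. *)
Lemma primitive_op w b M : dR w = iF b ->
  (exists f, apply_op inK dtF M b = dF f) <->
  inl2 (apply_op kR dtR M w) = inr2 (apply_op kR dtR M w).
Proof.
move=> dw; rewrite descent; have hd := ppv_d PPV.
have dM : dR (apply_op kR dtR M w) = iF (apply_op inK dtF M b).
  rewrite (der_sum hd) rmorph_sum; apply: eq_bigr => i _.
  rewrite (derM hd) rmorphM /= (ppv_dF PPV) dFK rmorph0 mul0r add0r; congr (_ * _).
  elim: (nat_of_ord i) => //= j IH.
  by rewrite (ppv_comm PPV) IH (ppv_tF PPV).
split=> [[f e]|[f e]]; last first.
  by exists f; apply: (fmorph_inj iF); rewrite -dM e (ppv_dF PPV).
have [f' e'] : exists f', apply_op kR dtR M w - iF f = iF f'.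
  case: PPV => _ [_ [_ [_ [_ [_ [_ [h _]]]]]]]; apply: h.
  by rewrite (derB hd) dM e (ppv_dF PPV) subrr.
by exists (f' + f); rewrite rmorphD -e' subrK.
Qed.
End Primitive.

(** * The universal point as a coboundary *)

Section Forward.
Variables (K F : fieldType) (inK : {rmorphism K -> F}) (dK : K -> K) (dF dtF : F -> F).
Hypothesis dFK : forall k, dF (inK k) = 0.
Hypothesis dtK : forall k, dtF (inK k) = inK (dK k).
Hypothesis dF_const : forall f, dF f = 0 -> exists k, f = inK k.
Variable L : {poly K}.

Lemma apply_op_val (E : ddalg dK) M (c : dd_csts E) :
  dd_val E (apply_op (dd_kc E) (@dd_tc _ _ E) M c) = apply_op (dd_k E) (@dd_t _ _ E) M (dd_val E c).
Proof. by apply: apply_op_hom => [k|s]; [apply: dd_kcE | apply: dd_tcE]. Qed.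

Lemma Ga_forward : is_PPV_group inK dK dF dtF (Ga_pt L) (fun S => (@GRing.add S)) ->
  exists b, (exists f, apply_op inK dtF L b = dF f) /\
   forall M, (exists f, apply_op inK dtF M b = dF f) ->
   forall (S : comNzRingType) (kS : {rmorphism K -> S}) dS m, dt_alg dK kS dS ->
     Ga_pt L kS dS m -> apply_op kS dS M m = 0.
Proof.
move=> [n [A [R [iF [dR [dtR [Y [PPV [phi [phiP phin]]]]]]]]]].
have [||u [q13 [q23 [c12 [c13 [c23 [Gu [l13 r13] [l23 r23] [v12 v13 v23 ce] test]]]]]]] :=
  galois_cocycle dFK dtK dF_const PPV phiP phin.
- move=> S S' kS kS' dS dS' h _ _ [hk hdt] m; rewrite /Ga_pt => e.
  by rewrite -(apply_op_hom _ _ hk hdt) e rmorph0.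
- by move=> S kS dS hS m m'; rewrite /Ga_pt (apply_op_add hS) => -> ->; rewrite addr0.
set E := DD2 dFK dtK PPV in u Gu v12 v13 v23 test.
pose W : tensor iF iF := dd_val E u.
have eW : q13 W = tinl (f2 iF) iF W + q23 W by rewrite /W -v12 -v13 -v23 ce rmorphD.
have [l [ll l1]] := klinear_one iF.
pose w := contract l W.
(* Contracting the third factor turns the two cofaces of the point into [w (x) 1] and [1 (x) w]. *)
have c13E t : contract l (q13 t) = tinl iF iF (contract l t).
  elim/tensor_ind: t => [a b|t t' h h']; last by rewrite rmorphD !contractD // h h' rmorphD.
  rewrite pureE rmorphM l13 r13 contract_linear // -pureE contract_pure // contract_pure //.
  by rewrite mul1r rmorphM.
have c23E t : contract l (q23 t) = tinr iF iF (contract l t).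
  elim/tensor_ind: t => [a b|t t' h h']; last by rewrite rmorphD !contractD // h h' rmorphD.
  rewrite pureE rmorphM l23 r23 contract_linear // -pureE contract_pure // contract_pure //.
  by rewrite mul1r rmorphM /= (tin_bal iF iF).
have wW : tinl iF iF w - tinr iF iF w = W.
  rewrite -c13E -c23E eW contractD // addrK contract_pure // l1 rmorph1 mulr1 //.
(* The universal point is [d]-constant, so [d w (x) 1 = 1 (x) d w], and [d w] descends to [F]. *)
have [b dw] : exists b, dR w = iF b.
  apply/(descent iF); apply/eqP; rewrite -subr_eq0; apply/eqP.
  rewrite -(d2_inl PPV) -(d2_inr PPV) -(derB (d2_der PPV)) wW; exact: (dd_val_d u).
have opW M : apply_op (dd_k E) (@dd_t _ _ E) M W =
  tinl iF iF (apply_op (iF \o inK) dtR M w) - tinr iF iF (apply_op (iF \o inK) dtR M w).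
  have hE : dt_alg dK (dd_k E) (@dd_t _ _ E) by split; [apply: dd_tP | apply: dd_tk].
  rewrite -wW (apply_op_sub hE); congr (_ - _); symmetry; apply: apply_op_hom => //.
  - by move=> s; rewrite /= (t2_inl PPV).
  - by move=> c /=; rewrite -(tin_bal iF iF).
  - by move=> s; rewrite /= (t2_inr PPV).
have opu M : (exists f, apply_op inK dtF M b = dF f) <->
    apply_op (dd_kc E) (@dd_tc _ _ E) M u = 0.
  rewrite (primitive_op dFK PPV M dw); split=> e.
    by apply: (@dd_val_inj _ _ E); rewrite apply_op_val -/W opW e subrr rmorph0.
  apply/eqP; rewrite -subr_eq0 -opW; apply/eqP.
  by rewrite /W -apply_op_val e rmorph0.
exists b; split; first by apply/opu.
move=> M /opu Mu S kS dS m hS Gm.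
have [E' [kE [dE [jS [psi [hE [jk jd] jinj [pk pd] e]]]]]] := test S kS dS m hS Gm.
apply: jinj; rewrite (apply_op_hom _ _ jk jd) e -(apply_op_hom _ _ pk pd) Mu !rmorph0 //.
Qed.

Lemma Gm_forward : is_PPV_group inK dK dF dtF (Gm_pt L) (fun S => (@GRing.mul S)) ->
  is_derivation dtF ->
  exists b, (exists f, apply_op inK dtF L (dtF b) = dF f) /\
   forall M, (exists f, apply_op inK dtF M (dtF b) = dF f) ->
   forall (S : comNzRingType) (kS : {rmorphism K -> S}) dS m v, dt_alg dK kS dS ->
     Gm_pt L kS dS m -> m * v = 1 -> apply_op kS dS M (dS m * v) = 0.
Proof.
move=> [n [A [R [iF [dR [dtR [Y [PPV [phi [phiP phin]]]]]]]]]] hdt.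
have inv_uniq (S : comNzRingType) (m v v' : S) : m * v = 1 -> m * v' = 1 -> v = v'.
  by move=> e e'; rewrite -[v]mulr1 -e' mulrA [v * m]mulrC e mul1r.
have [||u [q13 [q23 [c12 [c13 [c23 [Gu [l13 r13] [l23 r23] [v12 v13 v23 ce] test]]]]]]] :=
  galois_cocycle dFK dtK dF_const PPV phiP phin.
- move=> S S' kS kS' dS dS' h _ _ [hk hdtS] m [v [mv e]].
  exists (h v); rewrite -rmorphM mv rmorph1; split=> //.
  by rewrite -hdtS -rmorphM -(apply_op_hom _ _ hk hdtS) e rmorph0.
- move=> S kS dS hS m m' [v [mv e]] [v' [mv' e']]; have [hd _] := hS.
  exists (v * v'); rewrite mulrACA mv mv' mulr1; split=> //.
  have -> : dS (m * m') * (v * v') = (dS m * v) * (m' * v') + (m * v) * (dS m' * v').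
    by rewrite (derM hd); ring.
  by rewrite mv mv' mulr1 mul1r (apply_op_add hS) e e' addr0.
set E := DD2 dFK dtK PPV in u Gu v12 v13 v23 test.
have hd := ppv_d PPV; have ht := ppv_t PPV.
have [ui [uui Lu]] := Gu.
pose W : tensor iF iF := dd_val E u.
pose V : tensor iF iF := dd_val E ui.
have WV : W * V = 1 by rewrite -(rmorph1 (dd_val E)) -uui rmorphM.
have eW : q13 W = tinl (f2 iF) iF W * q23 W by rewrite /W -v12 -v13 -v23 ce rmorphM.
(* Normalising at 1 would not ensure [w != 0] here. A suitable functional exists because the
   universal point is a unit, hence nonzero, and functionals separate tensors. *)
have [l [ll w0]] : exists l, klinear iF l /\ contract l W != 0.
  apply: contrapT => h; have /eqP := oner_neq0 (tensor iF iF); apply.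
  rewrite -WV (@contract_eq0 _ _ _ iF iF W) ?mul0r // => l ll.
  by apply: contrapT => /eqP nz; apply: h; exists l.
pose w := contract l W.
have c13E t : contract l (q13 t) = tinl iF iF (contract l t).
  elim/tensor_ind: t => [a b|t t' h h']; last by rewrite rmorphD !contractD // h h' rmorphD.
  rewrite pureE rmorphM l13 r13 contract_linear // -pureE contract_pure // contract_pure //.
  by rewrite mul1r rmorphM.
have c23E t : contract l (q23 t) = tinr iF iF (contract l t).
  elim/tensor_ind: t => [a b|t t' h h']; last by rewrite rmorphD !contractD // h h' rmorphD.
  rewrite pureE rmorphM l23 r23 contract_linear // -pureE contract_pure // contract_pure //.
  by rewrite mul1r rmorphM /= (tin_bal iF iF).
have wW : tinl iF iF w = W * tinr iF iF w.
  by rewrite -c13E -c23E eW contract_linear.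
have dW : d2 dR W = 0 by exact: (dd_val_d u).
have dwW : tinl iF iF (dR w) = W * tinr iF iF (dR w).
  by rewrite -(d2_inl PPV) wW (derM (d2_der PPV)) dW mul0r add0r (d2_inr PPV).
(* Both [w] and [d w] are multiplied by the point when moved across the tensor sign, so
   [w (x) d w = d w (x) w]. A functional equal to 1 at [w] then gives the proportionality factor. *)
have [b dw] : exists b, dR w = iF b * w.
  have [||l' [ll' [_ l'w]]] := @klinear_sep _ _ iF (fun z => z = 0) w.
  - by split=> //; split=> [a c -> ->|c a ->]; rewrite ?addr0 ?mulr0.
  - exact/eqP.
  have : pure iF iF w (dR w) = pure iF iF (dR w) w.
    by rewrite !pureE wW dwW -!mulrA [tinr _ _ (dR w) * _]mulrC.
  move/(congr1 (contract l')); rewrite !contract_pure // l'w rmorph1 mulr1 => <-.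
  by exists (l' (dR w)); rewrite mulrC.
(* The ideal generated by [w] is stable under [d] because [d w = b w]; it is nonzero, hence
   everything. *)
have [wi wwi] : exists wi, w * wi = 1.
  have [||||h|h] := @ppv_simple _ _ _ _ _ _ _ _ _ _ PPV (fun r => exists a, r = a * w).
  - by exists 0; rewrite mul0r.
  - by move=> _ _ [a ->] [c ->]; exists (a + c); rewrite mulrDl.
  - by move=> a _ [c ->]; exists (a * c); rewrite mulrA.
  - by move=> _ [c ->]; exists (dR c + c * iF b); rewrite (derM hd) dw; ring.
  - by move/eqP: w0; case; apply: h; exists 1; rewrite mul1r.
  by have [wi e] := h 1; exists wi; rewrite mulrC -e.
(* The logarithmic [dt]-derivative reduces to the additive situation: [dt(u)/u = v (x) 1 - 1 (x) v],
   where [v] is a primitive of [dt b]. *)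
pose v := dtR w * wi.
have dv : dR v = iF (dtF b).
  have dwi : dR wi = - (iF b * wi).
    have /eqP : dR (w * wi) = 0 by rewrite wwi (der1 hd).
    rewrite (derM hd) dw -mulrA wwi mulr1 addrC addr_eq0 => /eqP e.
    by rewrite -[dR wi]mul1r -wwi mulrAC e mulNr.
  rewrite /v (derM hd) (ppv_comm PPV) dw (derM ht) (ppv_tF PPV) dwi.
  by rewrite -[RHS]mulr1 -[X in _ = _ * X]wwi; ring.
have Z : dd_t (dd_val E u) * V = tinl iF iF v - tinr iF iF v.
  have dtw : dtR w = v * w by rewrite /v -mulrA [wi * w]mulrC wwi mulr1.
  have e1 : t2 dtR W * tinr iF iF w + W * tinr iF iF (v * w) = tinl iF iF (v * w).
    by rewrite -dtw -(t2_inl PPV) wW (derM (t2_der PPV)) (t2_inr PPV).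
  have ww : tinr iF iF w * tinr iF iF wi = 1 by rewrite -rmorphM wwi rmorph1.
  have -> : dd_t (dd_val E u) * V = t2 dtR W * tinr iF iF w * (tinr iF iF wi * V).
    by rewrite mulrA -[t2 dtR W * _ * _]mulrA ww mulr1.
  move/eqP: e1; rewrite eq_sym -subr_eq => /eqP <-.
  rewrite (rmorphM (tinl iF iF)) (rmorphM (tinr iF iF)) /= wW.
  have -> : tinl iF iF v - tinr iF iF v =
    (tinl iF iF v - tinr iF iF v) * (W * V) * (tinr iF iF w * tinr iF iF wi).
    by rewrite WV ww !mulr1.
  ring.
have opZ M : apply_op (dd_k E) (@dd_t _ _ E) M (dd_t (dd_val E u) * V) =
  tinl iF iF (apply_op (iF \o inK) dtR M v) - tinr iF iF (apply_op (iF \o inK) dtR M v).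
  have hE : dt_alg dK (dd_k E) (@dd_t _ _ E) by split; [apply: dd_tP | apply: dd_tk].
  rewrite Z (apply_op_sub hE); congr (_ - _); symmetry; apply: apply_op_hom => //.
  - by move=> s; rewrite /= (t2_inl PPV).
  - by move=> c /=; rewrite -(tin_bal iF iF).
  - by move=> s; rewrite /= (t2_inr PPV).
have opu M : (exists f, apply_op inK dtF M (dtF b) = dF f) <->
    apply_op (dd_kc E) (@dd_tc _ _ E) M (dd_tc u * ui) = 0.
  rewrite (primitive_op dFK PPV M dv); split=> e.
    apply: (@dd_val_inj _ _ E); rewrite apply_op_val rmorphM dd_tcE.
    by rewrite opZ e subrr rmorph0.
  apply/eqP; rewrite -subr_eq0 -opZ; apply/eqP.
  by rewrite /V -dd_tcE -rmorphM -apply_op_val e rmorph0.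
exists b; split; first by apply/opu.
move=> M /opu Mu S kS dS m mi hS Gm mmi.
have [E' [kE [dE [jS [psi [hE [jk jd] jinj [pk pd] e]]]]]] := test S kS dS m hS Gm.
have ei : jS mi = psi ui.
  by apply: (inv_uniq _ (jS m)); [rewrite -rmorphM mmi rmorph1 | rewrite e -rmorphM uui rmorph1].
apply: jinj; rewrite (apply_op_hom _ _ jk jd) rmorphM jd ei e -pd -rmorphM.
by rewrite -(apply_op_hom _ _ pk pd) Mu !rmorph0.
Qed.
End Forward.

(** * From residues to fundamental sets *)

Section ForwardFundamental.
Variables (K : closedFieldType) (dK : K -> K) (F : fieldType) (inK : {rmorphism K -> F}).
Variables (x : F) (dF dtF : F -> F) (L : {poly K}).
Hypothesis charK : [pchar K] =i pred0.
Hypothesis hK : is_derivation dK.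
Hypothesis hF : is_Kx_dfield inK dK x dF dtF.
Hypothesis L0 : L != 0.

Lemma Ga_forward_fundamental :
  is_PPV_group inK dK dF dtF (Ga_pt L) (fun S => (@GRing.add S)) -> fundamental_set dK L.
Proof.
move=> /(Ga_forward (Kx_dFK hF) (Kx_dtK hF) (dF_const charK hF)) [b [Lb test]].
have [l lE] := residues charK hF b.
have [s [M [tM sl Ml]]] := tri_greedy hK l.
have Ls f : f \in s -> apply_op id dK L f = 0 by move/sl; exact: (lE L).1 Lb f.
apply/(fundamental_setP hK); exists s, M; split=> //.
have [mM sM] := tri_size tM.
(* [M] kills the residues of [b], hence every point of the group, so by [Ga_test] its order is at
   least that of [L]. In the other direction [L] kills the [size s] independent residues. *)
have le1 : (size L <= (size s).+1)%N.
  rewrite leqNgt; apply/negP=> lt; have := monic_neq0 mM; apply/negP; rewrite negbK.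
  by apply/eqP/(Ga_test hK (L := L)); rewrite ?sM //; apply: test; apply/lE.
have le2 : (size s < size L)%N.
  by rewrite ltnNge; apply/negP=> le; have := tri_order hK tM Ls le; apply/eqP.
have aux (a c : nat) : (c <= a.+1)%N -> (a < c)%N -> a = c.-1 by lia.
exact: aux.
Qed.

Lemma Gm_forward_fundamental :
  is_PPV_group inK dK dF dtF (Gm_pt L) (fun S => (@GRing.mul S)) -> fundamental_set dK (L * 'X).
Proof.
move=> /(Gm_forward (Kx_dFK hF) (Kx_dtK hF) (dF_const charK hF))/(_ (Kx_dtF hF)) [b [Lb test]].
have [l lE] := residues charK hF b.
have lE' N : (exists f, apply_op inK dtF N (dtF b) = dF f) <->
    (forall a, a \in [seq dK a | a <- l] -> apply_op id dK N a = 0).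
  (* For the class of [dt b] modulo [d]-derivatives the residues of [b] are replaced by their
     derivatives. The solutions found are thus derivatives of elements of [K]. *)
  rewrite -apply_opX lE; split=> h a => [/mapP[a' al ->]|al].
    by have := h a' al; rewrite (apply_opX idfun).
  by rewrite (apply_opX idfun) h // map_f.
have [s [M [tM sl Ml]]] := tri_greedy hK [seq dK a | a <- l].
have Ls f : f \in s -> apply_op id dK L f = 0 by move/sl; exact: (lE' L).1 Lb f.
have [mM sM] := tri_size tM.
have le1 : (size L <= (size s).+1)%N.
  rewrite leqNgt; apply/negP=> lt; have := monic_neq0 mM; apply/negP; rewrite negbK.
  by apply/eqP/(Gm_test hK (L := L)); rewrite ?sM //; apply: test; apply/lE'.
have le2 : (size s < size L)%N.
  by rewrite ltnNge; apply/negP=> le; have := tri_order hK tM Ls le; apply/eqP.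
have [s' sE] : exists s', s = [seq dK a | a <- s'].
  elim: s sl {tM sM Ls le1 le2} => [|a s IH] sl; first by exists [::].
  have [|s' ->] := IH; first by move=> f fs; apply: sl; rewrite inE fs orbT.
  by have /mapP[a' _ ->] := sl a (mem_head _ _); exists (a' :: s').
have ss : size s' = size s by rewrite sE size_map.
(* The constant 1 supplies the additional solution of [L * 'X]. Differentiating a relation among
   [1 :: s'] gives one among the derivatives [s], which are independent. *)
have [|N tN] := @tri_indep _ _ hK (1 :: s').
  move=> c c0 e.
  have h i : (i < size s')%N -> c i.+1 = 0.
    rewrite ss; have tf := tri_free hK (dt_algK hK) tM.
    apply: (tf (c \o succn)) => [j|]; first exact: c0.
    have := congr1 dK e; rewrite (der0 hK) lincomb_cons (derD hK) /= mulr1 c0 add0r => e'.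
    rewrite -[RHS]e' (der_sum hK) /lincomb -ss; apply: eq_bigr => j _ /=.
    by rewrite (derM hK) c0 mul0r add0r sE (nth_map 0).
  case=> [_|i] /=; last exact: h.
  move: e; rewrite lincomb_cons /= mulr1 /lincomb big1 ?addr0 // => i _.
  by rewrite /= h // mul0r.
apply/(fundamental_setP hK); exists (1 :: s'), N; split=> //.
  have aux (a c : nat) : (c <= a.+1)%N -> (a < c)%N -> a.+1 = c by lia.
  by rewrite /= size_mulX // ss; apply: aux.
move=> f; rewrite inE (apply_opX idfun) => /orP[/eqP ->|fs'].
  by rewrite (der1 hK) (apply_op_0 (dt_algK hK)).
by apply: Ls; rewrite sE map_f.
Qed.
End ForwardFundamental.

(** * Adjoining logarithms *)

Definition d_simple (R : comNzRingType) (dR : R -> R) : Prop :=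
  forall I : R -> Prop,
     I 0 -> (forall a b, I a -> I b -> I (a + b)) -> (forall a b, I b -> I (a * b)) ->
     (forall a, I a -> I (dR a)) ->
     (forall r, I r -> r = 0) \/ (forall r, I r).

Section PolyDerivation.
Variables (R : comNzRingType) (D : R -> R) (hD : is_derivation D) (g : {poly R}).

Definition pder (p : {poly R}) : {poly R} := map_poly D p + g * p^`().

Lemma coef_mapder (p : {poly R}) i : (map_poly D p)`_i = D p`_i.
Proof. by rewrite coef_map_id0 // (der0 hD). Qed.

Lemma pder_derivation : is_derivation pder.
Proof.
split=> p q.
  rewrite /pder derivD mulrDr addrACA; congr (_ + _).
  by apply/polyP=> i; rewrite coefD !coef_mapder coefD (derD hD).
have mM : map_poly D (p * q) = map_poly D p * q + p * map_poly D q.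
  apply/polyP=> i; rewrite coefD coef_mapder !coefM (der_sum hD) -big_split.
  by apply: eq_bigr => j _; rewrite (derM hD) !coef_mapder.
rewrite /pder mM derivM; ring.
Qed.
Lemma pderC c : pder c%:P = (D c)%:P.
Proof.
rewrite /pder derivC mulr0 addr0; apply/polyP=> i; rewrite coef_mapder !coefC.
by case: eqP => //; rewrite (der0 hD).
Qed.
Lemma pderX : pder 'X = g.
Proof.
rewrite /pder derivX mulr1 [map_poly _ _](_ : _ = 0) ?add0r //.
apply/polyP=> i; rewrite coef_mapder coefX coef0.
by case: eqP; rewrite ?(der1 hD) ?(der0 hD).
Qed.
End PolyDerivation.

(* A nonzero ideal of R[X] stable under a derivation that acts triangularly on leading
   coefficients contains a monic polynomial of minimal degree, since those leading
   coefficients form a stable ideal of the d-simple ring R. *)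
Lemma minimal_monic (R : comNzRingType) (dR : R -> R) (D : {poly R} -> {poly R})
    (e : nat -> R) (I : {poly R} -> Prop) :
  d_simple dR -> I 0 -> (forall a b, I a -> I b -> I (a + b)) ->
  (forall a b, I b -> I (a * b)) -> (forall a, I a -> I (D a)) ->
  (forall (p : {poly R}) n, (size p <= n.+1)%N ->
     (size (D p) <= n.+1)%N /\ (D p)`_n = dR p`_n + e n * p`_n) ->
  (exists2 p, I p & p != 0) ->
  exists n p, [/\ I p, (size p <= n.+1)%N, p`_n = 1 &
    forall q, I q -> (size q <= n)%N -> q = 0].
Proof.
move=> simp I0 ID IM Id Dp [p0 Ip0 p00].
have [n [[p [Ip pn0 sp]] minn]] : exists n, (exists p, [/\ I p, p != 0 & (size p <= n.+1)%N]) /\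
    forall q, I q -> (size q <= n)%N -> q = 0.
  have [m] := ubnP (size p0); elim: m p0 Ip0 p00 => // m IH p Ip pn0 sp.
  have [[q Iq [qn0 sq]]|no] := pselect (exists2 q, I q & q != 0 /\ (size q < size p)%N).
    by apply: (IH q) => //; apply: leq_trans sq _.
  have sp0 : (0 < size p)%N by rewrite size_poly_gt0.
  exists (size p).-1; split; first by exists p; rewrite prednK.
  move=> q Iq sq; apply/eqP; apply: contrapT => /negP qn0; apply: no; exists q => //.
  by split=> //; rewrite -(prednK sp0) ltnS.
pose J r := exists p, [/\ I p, (size p <= n.+1)%N & p`_n = r].
have [||||J0|J1] := simp J.
- by exists 0; rewrite size_poly0 coef0.
- move=> _ _ [q [Iq sq <-]] [q' [Iq' sq' <-]]; exists (q + q').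
  rewrite coefD; split=> //; first exact: ID.
  by rewrite (leq_trans (size_polyD _ _)) // geq_max sq.
- move=> a _ [q [Iq sq <-]]; exists (a%:P * q); rewrite coefCM; split=> //; first exact: IM.
  by rewrite mul_polyC (leq_trans (size_scale_leq _ _)).
- move=> _ [q [Iq sq <-]]; have [sD Dn] := Dp q n sq.
  (* Subtracting [e n * q] leaves exactly [dR] of the previous leading coefficient. *)
  exists (D q + (- e n)%:P * q); rewrite coefD coefCM Dn; split.
  + by apply: ID; [apply: Id | apply: IM].
  + rewrite (leq_trans (size_polyD _ _)) // geq_max sD mul_polyC.
    by rewrite (leq_trans (size_scale_leq _ _)).
  + by rewrite mulNr addrK.
- case/negP: pn0; apply/eqP/minn => //.
  have pn : p`_n = 0 by apply: J0; exists p.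
  apply/leq_sizeP => j; rewrite leq_eqVlt => /orP[/eqP <- //|lt].
  by rewrite nth_default // (leq_trans sp).
have [q [Iq sq q1]] := J1 1.
by exists n, q.
Qed.

Section LogExtension.
Variables (K : closedFieldType) (dK : K -> K) (F : fieldType) (inK : {rmorphism K -> F}).
Variables (x : F) (dF dtF : F -> F).
Hypothesis charK : [pchar K] =i pred0.
Hypothesis hK : is_derivation dK.
Hypothesis hF : is_Kx_dfield inK dK x dF dtF.

(** Integers serve as poles: in characteristic zero they are distinct, and they are constant for
    [dt], so each adjoined logarithm can be given [dt]-derivative 0. *)
Definition lpole (i : nat) : F := (x - inK i%:R)^-1.

Lemma dt_lpole i : dtF (lpole i) = 0.
Proof.
rewrite (der_inv (Kx_dtF hF) (xsub_neq0 hF _)) (derB (Kx_dtF hF)) (Kx_dtx hF) (Kx_dtK hF).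
by rewrite (der_nat hK) rmorph0 subr0 mul0r oppr0.
Qed.

(** The invariants carried along while logarithms are adjoined one at a time. [le_prim] guarantees
    that the next logarithm is new, [le_logder] is kept for the exponential adjoined later, and
    [le_univ] expresses freeness, from which automorphisms are built. *)
Record log_ext (d : nat) (R : comNzRingType) (iF : {rmorphism F -> R}) (dR dtR : R -> R)
    (z : nat -> R) : Prop := LogExt {
  le_d : is_derivation dR;
  le_t : is_derivation dtR;
  le_comm : forall r, dR (dtR r) = dtR (dR r);
  le_dF : forall f, dR (iF f) = iF (dF f);
  le_tF : forall f, dtR (iF f) = iF (dtF f);
  le_dz : forall i, (i < d)%N -> dR (z i) = iF (lpole i);
  le_tz : forall i, (i < d)%N -> dtR (z i) = 0;
  le_gen : forall P : R -> Prop,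
    P 1 -> (forall a b, P a -> P b -> P (a - b)) -> (forall a b, P a -> P b -> P (a * b)) ->
    (forall f, P (iF f)) -> (forall i, (i < d)%N -> P (z i)) -> forall r, P r;
  le_cst : forall r, dR r = 0 -> exists k, r = iF (inK k);
  le_simple : d_simple dR;
  le_prim : forall b r, dR r = iF b ->
    exists f (k : nat -> K), b = dF f + \sum_(i < d) inK (k i) * lpole i;
  le_logder : forall c r, r != 0 -> dR r = iF c * r -> exists2 f, f != 0 & dF f = c * f;
  le_univ : forall (U : comNzRingType) (h : {rmorphism F -> U}) (zU : nat -> U),
    exists g : {rmorphism R -> U}, (forall f, g (iF f) = h f) /\
      forall i, (i < d)%N -> g (z i) = zU i }.

Lemma field_d_simple : d_simple dF.
Proof.
move=> I I0 ID IM Id.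
have [[r Ir r0]|no] := pselect (exists2 r, I r & r != 0).
  by right=> s; rewrite -[s](mulfVK r0); apply: IM.
by left=> r Ir; apply/eqP; apply: contrapT => /negP r0; apply: no; exists r.
Qed.

Lemma log_ext0 : log_ext 0 idfun dF dtF (fun=> 0).
Proof.
split=> //=.
- exact: Kx_dF hF.
- exact: Kx_dtF hF.
- exact: Kx_comm hF.
- exact: (dF_const charK hF).
- exact: field_d_simple.
- by move=> b r <-; exists r, (fun=> 0); rewrite big_ord0 addr0.
- by move=> c r r0 e; exists r.
- by move=> U h zU; exists h.
Qed.

Section Step.
Variables (d : nat) (R : comNzRingType) (iF : {rmorphism F -> R}) (dR dtR : R -> R).
Variables (z : nat -> R).
Hypothesis lR : log_ext d iF dR dtR z.

Let hdR := le_d lR. Let htR := le_t lR.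

(** By [le_prim] such an [r] would make a sum of simple poles at distinct integers, with residue [e]
    at [d], a derivative in [F]. *)
Lemma lpole_indep e r : dR r = iF (inK e * lpole d) -> e = 0.
Proof.
move=> /(le_prim lR)[f [k E]].
pose s := (e, d%:R) :: [seq (- k i, i%:R) | i <- index_iota 0 d] : seq (K * K).
have us : uniq (unzip2 s).
  have -> : unzip2 s = [seq n%:R | n <- d :: index_iota 0 d].
    by rewrite /s /unzip2 /= -map_comp.
  by rewrite (map_inj_uniq (natK_inj charK)) /= mem_index_iota ltnn andbF iota_uniq.
have e' : dF f = logsum inK x s.
  rewrite /logsum big_cons big_map big_mkord /=; move/eqP: E; rewrite -subr_eq => /eqP <-.
  congr (_ + _); rewrite -sumrN; apply: eq_bigr => i _.
  by rewrite rmorphN mulNr.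
exact: (logsum_exact charK hF us e' (mem_head _ _)).
Qed.

Let a : R := iF (lpole d).
Definition log_d : {poly R} -> {poly R} := pder dR a%:P.
Definition log_t : {poly R} -> {poly R} := pder dtR 0.
Definition log_z (i : nat) : {poly R} := if (i < d)%N then (z i)%:P else 'X.
Let log_in : {rmorphism F -> {poly R}} := polyC \o iF.

Let hd : is_derivation log_d. Proof. exact: pder_derivation. Qed.
Let ht : is_derivation log_t. Proof. exact: pder_derivation. Qed.

Lemma coef_log_d p i : (log_d p)`_i = dR p`_i + a * p`_i.+1 * i.+1%:R.
Proof. by rewrite coefD coef_mapder // coefCM coef_deriv -[p`_i.+1 *+ _]mulr_natr mulrA. Qed.


(** In degree [m >= 2] the top coefficient would be a constant [k], and the next one would be a
    primitive of [- m k / (x - d)], which is impossible unless [k = 0]. Degree 1 survives, since the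
    derivative of ['X] has degree 0. *)
Lemma log_top (p : {poly R}) : (forall i, (log_d p)`_i.+1 = 0) -> (size p <= 2)%N.
Proof.
move=> h; rewrite leqNgt; apply/negP=> lt.
have [n sp] : exists n, size p = n.+3 by exists (size p - 3)%N; move: lt; lia.
have pn0 : p`_n.+2 != 0.
  have := lead_coef_eq0 p; rewrite /lead_coef sp /= => ->.
  by rewrite -size_poly_eq0 sp.
have h1 := h n.+1; have h0 := h n.
move: h1; rewrite coef_log_d [p`_n.+3]nth_default ?sp // mulr0 mul0r addr0.
move=> /(le_cst lR)[k pk]; move: h0; rewrite coef_log_d pk => /eqP.
rewrite addr_eq0 => /eqP e.
have : - (k * n.+2%:R) = 0.
  apply: (lpole_indep (r := p`_n.+1)); rewrite e /a -(rmorph_nat iF) -!rmorphM -rmorphN.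
  by congr (iF _); rewrite rmorphN rmorphM rmorph_nat; ring.
move/eqP; rewrite oppr_eq0 mulf_eq0 (natK_eq0 charK) orbF => /eqP k0.
by move: pn0; rewrite pk k0 !rmorph0 eqxx.
Qed.

Lemma log_top1 (p : {poly R}) : (forall i, (log_d p)`_i.+1 = 0) ->
  exists k, p`_1 = iF (inK k) /\ (log_d p)`_0 = dR p`_0 + iF (inK k * lpole d).
Proof.
move=> h; have sp := log_top h; have := h 0%N.
rewrite coef_log_d [p`_2]nth_default // mulr0 mul0r addr0 => /(le_cst lR)[k pk].
exists k; split=> //; rewrite coef_log_d pk mulr1 rmorphM mulrC; congr (_ + _); exact: mulrC.
Qed.

Lemma log_cst p : log_d p = 0 -> exists k, p = log_in (inK k).
Proof.
move=> e; have h i : (log_d p)`_i.+1 = 0 by rewrite e coef0.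
have [k [pk]] := log_top1 h; rewrite e coef0 => /esym/eqP; rewrite addr_eq0 -rmorphN => /eqP e0.
have k0 : k = 0.
  apply/eqP; rewrite -oppr_eq0; apply/eqP/(lpole_indep (r := p`_0)).
  by rewrite e0 -mulNr -rmorphN.
have [|k' pk'] := le_cst lR (r := p`_0); first by rewrite e0 k0 rmorph0 mul0r oppr0 rmorph0.
exists k'; apply/polyP=> -[|[|i]]; rewrite /= coefC //=.
  by rewrite pk k0 !rmorph0.
by rewrite nth_default // (leq_trans (log_top h)).
Qed.

Lemma log_extS : log_ext d.+1 log_in log_d log_t log_z.
Proof.
have dC c : log_d c%:P = (dR c)%:P by rewrite /log_d pderC.
have tC c : log_t c%:P = (dtR c)%:P by rewrite /log_t pderC.
have dX : log_d 'X = a%:P by rewrite /log_d pderX.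
have tX : log_t 'X = 0 by rewrite /log_t pderX.
split=> //.
- move=> p; elim/poly_ind: p => [|p c IH]; first by rewrite !(der0 ht, der0 hd).
  have eC : log_d (log_t c%:P) = log_t (log_d c%:P) by rewrite tC !dC tC (le_comm lR).
  have eX : log_d (log_t 'X) = log_t (log_d 'X).
    by rewrite tX dX (der0 hd) tC /a (le_tF lR) dt_lpole rmorph0.
  have [_ eM] := comm_step hd ht IH eX.
  by have [] := comm_step hd ht eM eC.
- by move=> f /=; rewrite dC (le_dF lR).
- by move=> f /=; rewrite tC (le_tF lR).
- move=> i; rewrite ltnS leq_eqVlt /log_z => /orP[/eqP ->|lt]; first by rewrite ltnn dX.
  by rewrite lt dC (le_dz lR).
- move=> i; rewrite ltnS leq_eqVlt /log_z => /orP[/eqP ->|lt]; first by rewrite ltnn tX.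
  by rewrite lt tC (le_tz lR).
- move=> P P1 PB PM PF Pz.
  have P0 : P 0 by rewrite -(subrr 1); apply: PB.
  have PD p q : P p -> P q -> P (p + q).
    by move=> Pp Pq; rewrite -[q]opprK; apply: (PB) => //; rewrite -sub0r; apply: PB.
  have PC c : P c%:P.
    apply: (le_gen lR (P := fun c => P c%:P)) => //.
    + by move=> r s Pr Ps; rewrite polyCB; apply: PB.
    + by move=> r s Pr Ps; rewrite polyCM; apply: PM.
    + by move=> i lt; have := Pz i (ltnW lt); rewrite /log_z lt.
  have PX : P 'X by have := Pz d (ltnSn d); rewrite /log_z ltnn.
  by elim/poly_ind => // p c Pp; apply: (PD) => //; apply: PM.
- exact: log_cst.
- move=> I I0 ID IM Id.
  have [ex|no] := pselect (exists2 p, I p & p != 0); last first.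
    by left=> r Ir; apply/eqP; apply: contrapT => /negP r0; apply: no; exists r.
  right=> q.
  have [|n [p [Ip sp p1 minp]]] :=
    minimal_monic (e := fun=> 0) (le_simple lR) I0 ID IM Id _ ex.
    move=> p n sp; rewrite mul0r addr0 coef_log_d [p`_n.+1]nth_default // mulr0 mul0r addr0.
    split=> //; apply/leq_sizeP => j le; rewrite coef_log_d !nth_default ?(leq_trans sp) //.
      by rewrite (der0 hdR) mulr0 mul0r addr0.
    by rewrite ltnW.
  (* The derivative of a monic polynomial of minimal degree has smaller degree and stays in the
     ideal, so it vanishes. Then [p] is a nonzero constant, hence a unit. *)
  have dp0 : log_d p = 0.
    apply: minp; first exact: Id.
    apply/leq_sizeP => j; rewrite leq_eqVlt => /orP[/eqP <-|lt].
      by rewrite coef_log_d p1 (der1 hdR) add0r nth_default // mulr0 mul0r.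
    rewrite coef_log_d !nth_default ?(leq_trans sp) //; last exact: leqW.
    by rewrite (der0 hdR) mulr0 mul0r addr0.
  have [k pk] := log_cst dp0.
  have k0 : inK k != 0.
    apply/eqP=> k0; move: p1; rewrite pk k0 rmorph0 coef0 => /esym/eqP.
    by rewrite oner_eq0.
  rewrite -[q]mulr1 -(rmorph1 log_in) -(mulVf k0) rmorphM mulrA -pk; exact: IM.
- move=> b p e.
  (* A primitive of an element of [F] has the form [k 'X + r], so [b - k lpole d] already has the
     primitive [r] in [R]. *)
  have h i : (log_d p)`_i.+1 = 0 by rewrite e /= coefC.
  have [k [pk]] := log_top1 h; rewrite e /= coefC eqxx => e0.
  have [|f [k' bE]] := le_prim lR (b := b - inK k * lpole d) (r := p`_0).
    by rewrite rmorphB e0 addrK.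
  exists f, (fun i => if i == d then k else k' i).
  rewrite big_ord_recr /= eqxx; move/eqP: bE; rewrite subr_eq => /eqP ->.
  rewrite -addrA; congr (_ + (_ + _)); apply: eq_bigr => i _ /=.
  by rewrite ltn_eqF.
(* The leading coefficient satisfies the same equation over [R]. *)
- move=> c p p0 e; apply: (le_logder lR (r := lead_coef p)); first by rewrite lead_coef_eq0.
  have := congr1 (fun q : {poly R} => q`_(size p).-1) e.
  rewrite coef_log_d /= coefCM [p`__.+1]nth_default ?mulr0 ?mul0r ?addr0 //.
  by rewrite prednK // size_poly_gt0.
- move=> U h zU; have [g [gF gz]] := le_univ lR h zU.
  have [|||G GE] := @rmorph_of {poly R} U (fun p => (map_poly g p).[zU d]).
  + by move=> p q; rewrite rmorphD hornerD.
  + by rewrite rmorph1 hornerC.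
  + by move=> p q; rewrite rmorphM hornerM.
  exists G; split=> [f|i]; first by rewrite GE /= map_polyC hornerC /= gF.
  rewrite ltnS leq_eqVlt GE /log_z => /orP[/eqP ->|lt].
    by rewrite ltnn map_polyX hornerX.
  by rewrite lt map_polyC hornerC /= gz.
Qed.
End Step.

Lemma log_ext_exists d : exists (R : comNzRingType) (iF : {rmorphism F -> R})
  (dR dtR : R -> R) (z : nat -> R), log_ext d iF dR dtR z.
Proof.
elim: d => [|d [R [iF [dR [dtR [z lR]]]]]].
  by exists F, idfun, dF, dtF, (fun=> 0); apply: log_ext0.
by eexists _, _, _, _, _; apply: (log_extS lR).
Qed.
End LogExtension.

(** * Laurent polynomials *)

Section Laurent.
Variable A : comNzRingType.

(* The pair [(p, n)] stands for the Laurent polynomial [p / X^n]. *)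
Definition laur_rel (u v : {poly A} * nat) : bool := u.1 * 'X^(v.2) == v.1 * 'X^(u.2).

Lemma mulXn_inj n (p q : {poly A}) : p * 'X^n = q * 'X^n -> p = q.
Proof. exact: (monic_rreg (monicXn A n)). Qed.

Lemma laur_rel_refl : reflexive laur_rel. Proof. by move=> u; apply: eqxx. Qed.
Lemma laur_rel_sym : symmetric laur_rel.
Proof. by move=> u v; apply: eq_sym. Qed.
Lemma laur_rel_trans : transitive laur_rel.
Proof.
move=> [q m] [p n] [r l] /eqP /= e1 /eqP /= e2; apply/eqP/(@mulXn_inj m) => /=.
by rewrite mulrAC e1 mulrAC e2 mulrAC.
Qed.
Canonical laur_equiv := EquivRel laur_rel laur_rel_refl laur_rel_sym laur_rel_trans.
Definition laur := {eq_quot laur_rel}%qT.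
HB.instance Definition _ := Choice.on laur.

Definition lfrac (p : {poly A}) (n : nat) : laur := (\pi_laur (p, n))%qT.

Lemma lfracP p n q m : lfrac p n = lfrac q m <-> p * 'X^m = q * 'X^n.
Proof. by split=> [/eqmodP/eqP|/eqP h]; last apply/eqmodP. Qed.
Lemma lfrac_eq p n q m : p = q -> n = m -> lfrac p n = lfrac q m.
Proof. by move=> -> ->. Qed.
Lemma lfrac_repr (x : laur) : x = lfrac (repr x).1 (repr x).2.
Proof. by rewrite -[LHS]reprK; case: (repr x). Qed.
Lemma lfrac_reprP p n :
  (repr (lfrac p n)).1 * 'X^n = p * 'X^((repr (lfrac p n)).2).
Proof. by apply/lfracP; rewrite -lfrac_repr. Qed.

Definition ladd (x y : laur) : laur :=
  lfrac ((repr x).1 * 'X^((repr y).2) + (repr y).1 * 'X^((repr x).2)) ((repr x).2 + (repr y).2).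
Definition lopp (x : laur) : laur := lfrac (- (repr x).1) (repr x).2.
Definition lmul (x y : laur) : laur := lfrac ((repr x).1 * (repr y).1) ((repr x).2 + (repr y).2).

Lemma lfrac_add p n q m : ladd (lfrac p n) (lfrac q m) = lfrac (p * 'X^m + q * 'X^n) (n + m).
Proof.
apply/lfracP; have := lfrac_reprP p n; have := lfrac_reprP q m.
move: (repr (lfrac q m)) (repr (lfrac p n)) => [q' m'] [p' n'] /= eq ep; rewrite !exprD.
move: ('X^n) ('X^m) ('X^n') ('X^m') ep eq => u v u' v' ep eq.
have -> : (p' * v' + q' * u') * (u * v) = (p' * u) * (v' * v) + (q' * v) * (u' * u) by ring.
by rewrite ep eq; ring.
Qed.
Lemma lfrac_opp p n : lopp (lfrac p n) = lfrac (- p) n.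
Proof. by apply/lfracP; rewrite !mulNr lfrac_reprP. Qed.
Lemma lfrac_mul p n q m : lmul (lfrac p n) (lfrac q m) = lfrac (p * q) (n + m).
Proof.
apply/lfracP; have := lfrac_reprP p n; have := lfrac_reprP q m.
move: (repr (lfrac q m)) (repr (lfrac p n)) => [q' m'] [p' n'] /= eq ep.
by rewrite !exprD mulrACA eq ep mulrACA.
Qed.

Fact laddA : associative ladd.
Proof.
move=> a b c; rewrite (lfrac_repr a) (lfrac_repr b) (lfrac_repr c) !lfrac_add.
move: (repr a) (repr b) (repr c) => [p n] [q m] [r l] /=; apply: lfrac_eq; last by rewrite addnA.
by rewrite !exprD; move: ('X^n) ('X^m) ('X^l) => u v w; ring.
Qed.
Fact laddC : commutative ladd.
Proof. by move=> a b; rewrite (lfrac_repr a) (lfrac_repr b) !lfrac_add addnC addrC. Qed.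
Fact ladd0 : left_id (lfrac 0 0) ladd.
Proof. by move=> a; rewrite (lfrac_repr a) lfrac_add mul0r add0r expr0 mulr1. Qed.
Fact laddN : left_inverse (lfrac 0 0) lopp ladd.
Proof.
move=> a; rewrite (lfrac_repr a) lfrac_opp lfrac_add mulNr addNr.
by apply/lfracP; rewrite !mul0r.
Qed.
HB.instance Definition _ := GRing.isZmodule.Build laur laddA laddC ladd0 laddN.
Fact lmulA : associative lmul.
Proof.
move=> a b c; rewrite (lfrac_repr a) (lfrac_repr b) (lfrac_repr c) !lfrac_mul.
by rewrite mulrA addnA.
Qed.
Fact lmulC : commutative lmul.
Proof. by move=> a b; rewrite (lfrac_repr a) (lfrac_repr b) !lfrac_mul mulrC addnC. Qed.
Fact lmul1 : left_id (lfrac 1 0) lmul.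
Proof. by move=> a; rewrite (lfrac_repr a) lfrac_mul mul1r. Qed.
Fact lmulD : left_distributive lmul ladd.
Proof.
move=> a b c; rewrite (lfrac_repr a) (lfrac_repr b) (lfrac_repr c) lfrac_add !lfrac_mul lfrac_add.
move: (repr a) (repr b) (repr c) => [p n] [q m] [r l] /=; apply/lfracP; rewrite !exprD.
by move: ('X^n) ('X^m) ('X^l) => u v w; ring.
Qed.
Fact lone_neq0 : lfrac 1 0 != lfrac 0 0.
Proof. by apply/eqP=> /lfracP/eqP; rewrite mul0r mul1r expr0 oner_eq0. Qed.
HB.instance Definition _ :=
  GRing.Zmodule_isComNzRing.Build laur lmulA lmulC lmul1 lmulD lone_neq0.

Lemma lfracD p n q m : lfrac p n + lfrac q m = lfrac (p * 'X^m + q * 'X^n) (n + m).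
Proof. exact: lfrac_add. Qed.
Lemma lfracM p n q m : lfrac p n * lfrac q m = lfrac (p * q) (n + m).
Proof. exact: lfrac_mul. Qed.
Lemma lfracN p n : - lfrac p n = lfrac (- p) n. Proof. exact: lfrac_opp. Qed.
Lemma lfrac0 n : lfrac 0 n = 0.
Proof. by apply/lfracP; rewrite !mul0r. Qed.
Lemma lfracDs p q n : lfrac p n + lfrac q n = lfrac (p + q) n.
Proof. by rewrite lfracD; apply/lfracP; rewrite exprD; move: ('X^n) => u; ring. Qed.

Definition lin (p : {poly A}) : laur := lfrac p 0.
Fact lin_add : zmod_morphism lin.
Proof. by move=> p q; rewrite /lin lfracN lfracDs. Qed.
Fact lin_mul : monoid_morphism lin.
Proof. by split=> // p q; rewrite /lin lfracM. Qed.
HB.instance Definition _ := GRing.isZmodMorphism.Build {poly A} laur lin lin_add.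
HB.instance Definition _ := GRing.isMonoidMorphism.Build {poly A} laur lin lin_mul.

Definition lw : laur := lin 'X.
Definition lwi : laur := lfrac 1 1.
Lemma lwwi : lw * lwi = 1.
Proof. by rewrite /lw /lin lfracM mulr1; apply/lfracP; rewrite expr0 expr1 mulr1 mul1r. Qed.
Lemma lfracE p n : lfrac p n = lin p * lwi ^+ n.
Proof.
elim: n => [|n IH]; first by rewrite expr0 mulr1.
rewrite exprSr mulrA -IH /lwi lfracM mulr1 addn1 //.
Qed.

Section LaurentDer.
Variables (D : A -> A) (hD : is_derivation D) (e : A).

(** When the variable satisfies [d X = e X], the derivative of [p / X^n] is [(d p - n e p) / X^n]:
    the denominator does not change. *)
Definition wder (n : nat) (p : {poly A}) : {poly A} :=
  pder D (e%:P * 'X) p - (e *+ n)%:P * p.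

Let hp : is_derivation (pder D (e%:P * 'X)). Proof. exact: pder_derivation. Qed.

Lemma coef_wder n (p : {poly A}) i : (wder n p)`_i = D p`_i + (e *+ i - e *+ n) * p`_i.
Proof.
rewrite /wder /pder coefB coefD coef_mapder // -mulrA !coefCM coefXM coef_deriv mulrBl addrA.
case: i => [|i] /=; first by rewrite mulr0 mulr0n mul0r.
by rewrite mulrnAr !mulrnAl.
Qed.

Lemma wderD n p q : wder n (p + q) = wder n p + wder n q.
Proof. by rewrite /wder (derD hp) mulrDr opprD addrACA. Qed.
Lemma wderM n m p q : wder (n + m) (p * q) = wder n p * q + p * wder m q.
Proof. by rewrite /wder (derM hp) mulrnDr polyCD; ring. Qed.
Lemma wderXn m : wder m 'X^m = 0.
Proof.
apply/polyP=> i; rewrite coef_wder coefXn coef0.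
by case: eqP => [->|_]; rewrite ?(der1 hD) ?(der0 hD) ?subrr ?mul0r ?mulr0 addr0.
Qed.
Lemma wderMX n m p : wder (n + m) (p * 'X^m) = wder n p * 'X^m.
Proof. by rewrite wderM wderXn mulr0 addr0. Qed.

Definition ld (x : laur) : laur := lfrac (wder (repr x).2 (repr x).1) (repr x).2.

Lemma ld_frac p n : ld (lfrac p n) = lfrac (wder n p) n.
Proof.
apply/lfracP; have := lfrac_reprP p n; move: (repr _) => [q m] /= h.
by rewrite -wderMX h addnC wderMX.
Qed.

Lemma ld_derivation : is_derivation ld.
Proof.
split=> x y; rewrite (lfrac_repr x) (lfrac_repr y); move: (repr x) (repr y) => [p n] [q m] /=.
  by rewrite lfracD !ld_frac lfracD wderD wderMX [(n + m)%N]addnC wderMX.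
by rewrite lfracM !ld_frac !lfracM lfracDs wderM.
Qed.
Lemma ld_inC c : ld (lin c%:P) = lin (D c)%:P.
Proof.
rewrite /lin ld_frac; apply: lfrac_eq => //; apply/polyP=> i; rewrite coef_wder !coefC mulr0n subr0.
by case: i => [|i] /=; rewrite ?mulr0n ?mul0r ?mulr0 ?addr0 // (der0 hD).
Qed.
Lemma ld_w : ld lw = lin e%:P * lw.
Proof.
rewrite /lw /lin ld_frac lfracM; apply: lfrac_eq => //; apply/polyP=> i.
rewrite coef_wder coefCM coefX mulr0n subr0.
by case: eqP => [->|_]; rewrite ?(der1 hD) ?(der0 hD) ?mulr0 ?addr0 // add0r.
Qed.

Hypothesis no_sol : forall j k r, j <> k -> D r + (e *+ j - e *+ k) * r = 0 -> r = 0.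

(** The derivation preserves each weight, acting in weight [i - n] by [D + (i - n) e]; [no_sol]
    excludes every nonzero weight. *)
Lemma wder_eq0 n p : wder n p = 0 -> p = (p`_n)%:P * 'X^n /\ D p`_n = 0.
Proof.
move=> w0; have c i : D p`_i + (e *+ i - e *+ n) * p`_i = 0 by rewrite -coef_wder w0 coef0.
split; last by have := c n; rewrite subrr mul0r addr0.
apply/polyP=> i; rewrite coefCM coefXn.
by case: eqP => [->|ne]; rewrite ?mulr1 // mulr0; apply: no_sol (c i).
Qed.

Lemma ld_cst x : ld x = 0 -> exists2 c, D c = 0 & x = lin c%:P.
Proof.
rewrite (lfrac_repr x); move: (repr x) => [p n] /=; rewrite ld_frac => /lfracP.
rewrite mul0r expr0 mulr1 => /wder_eq0[pE dc]; exists p`_n => //.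
by apply/lfracP; rewrite mulr1 {1}pE.
Qed.

(** For a monic [p] of minimal degree [n] in the ideal, [wder n p] has smaller degree and stays in
    the ideal. It vanishes, so [p = 'X^n], which is a unit. *)
Lemma ld_simple : d_simple D -> d_simple ld.
Proof.
move=> simp I I0 ID IM Id.
have [[x Ix x0]|no] := pselect (exists2 x, I x & x != 0); last first.
  by left=> r Ir; apply/eqP; apply: contrapT => /negP r0; apply: no; exists r.
right=> y; pose J p := I (lin p).
have [||||||n [p [Jp sp p1 minp]]] := @minimal_monic A D (wder 0) (fun n => e *+ n) J simp.
- by rewrite /J rmorph0.
- by move=> p q Jp Jq; rewrite /J rmorphD; apply: ID.
- by move=> p q Jq; rewrite /J rmorphM; apply: IM.
- by move=> p Jp; rewrite /J /lin -ld_frac; apply: Id.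
- move=> p n sp; rewrite coef_wder mulr0n subr0; split=> //.
  apply/leq_sizeP => j le; rewrite coef_wder nth_default ?(leq_trans sp) //.
  by rewrite (der0 hD) mulr0 addr0.
- move: Ix x0; rewrite (lfrac_repr x); move: (repr x) => [q m] /= Iq q0; exists q.
    rewrite /J; have -> : lin q = lw ^+ m * lfrac q m by rewrite lfracE mulrCA -exprMn lwwi expr1n mulr1.
    exact: IM.
  by apply: contraNneq q0 => ->; rewrite lfrac0.
have w0 : wder n p = 0.
  apply: minp.
    have -> : wder n p = wder 0 p - (e *+ n)%:P * p.
      by rewrite /wder mulr0n polyC0 mul0r subr0.
    rewrite /J rmorphB -mulN1r; apply: ID; first by rewrite /= /lin -ld_frac; apply: Id.
    by apply: (IM); rewrite rmorphM; apply: IM.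
  apply/leq_sizeP => j; rewrite leq_eqVlt coef_wder => /orP[/eqP <-|lt].
    by rewrite p1 (der1 hD) subrr mul0r addr0.
  by rewrite nth_default ?(leq_trans sp) // (der0 hD) mulr0 addr0.
have [pE _] := wder_eq0 w0; rewrite p1 mul1r in pE.
have -> : y = (y * lwi ^+ n) * lin p.
  rewrite pE rmorphXn -mulrA -exprMn [lwi * _]mulrC -/lw lwwi expr1n mulr1 //.
exact: IM.
Qed.
End LaurentDer.

Lemma laur_ind (P : laur -> Prop) :
  (forall a b, P a -> P b -> P (a + b)) -> (forall a b, P a -> P b -> P (a * b)) ->
  (forall c, P (lin c%:P)) -> P lw -> P lwi -> forall x, P x.
Proof.
move=> PD PM PC Pw Pwi x; rewrite (lfrac_repr x) lfracE.
have P1 : P 1 by rewrite -(rmorph1 lin); apply: PC.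
have Plin p : P (lin p).
  elim/poly_ind: p => [|p c IH]; first exact: (PC 0).
  by rewrite rmorphD rmorphM; apply: (PD) => //; apply: PM.
by apply: (PM) => //; elim: (_.2) => [|n IH]; rewrite ?expr0 // exprS; apply: PM.
Qed.

Lemma laur_univ (U : comNzRingType) (g : {rmorphism A -> U}) (wU wV : U) : wU * wV = 1 ->
  exists h : {rmorphism laur -> U}, (forall c, h (lin c%:P) = g c) /\ h lw = wU.
Proof.
move=> wwV; pose H (p : {poly A}) := (map_poly g p).[wU].
have HM p q : H (p * q) = H p * H q by rewrite /H rmorphM hornerM.
have HD p q : H (p + q) = H p + H q by rewrite /H rmorphD hornerD.
have HXn n : H 'X^n = wU ^+ n by rewrite /H map_polyXn hornerXn.
pose f (x : laur) := H (repr x).1 * wV ^+ (repr x).2.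
have WV n : wU ^+ n * wV ^+ n = 1 by rewrite -exprMn wwV expr1n.
have fE p n : f (lfrac p n) = H p * wV ^+ n.
  rewrite /f; have := lfrac_reprP p n; move: (repr _) => [q m] /= /(congr1 H).
  rewrite !HM !HXn => h.
  rewrite -[LHS]mulr1 -(WV n) -[RHS]mulr1 -(WV m).
  have -> : H q * wV ^+ m * (wU ^+ n * wV ^+ n) = (H q * wU ^+ n) * (wV ^+ m * wV ^+ n) by ring.
  rewrite h; ring.
have [|||h hE] := @rmorph_of laur U f.
- move=> x y; rewrite (lfrac_repr x) (lfrac_repr y); move: (repr x) (repr y) => [p n] [q m] /=.
  rewrite lfracD !fE HD !HM !HXn exprD.
  rewrite -[X in _ = X + _]mulr1 -(WV m) -[X in _ = _ + X]mulr1 -(WV n); ring.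
- by rewrite -[1]/(lfrac 1 0) fE /H rmorph1 hornerC mulr1.
- move=> x y; rewrite (lfrac_repr x) (lfrac_repr y); move: (repr x) (repr y) => [p n] [q m] /=.
  rewrite lfracM !fE HM exprD; ring.
exists h; split=> [c|]; rewrite hE /lin fE /H ?map_polyC ?map_polyX ?hornerC ?hornerX expr0 mulr1 //.
Qed.
End Laurent.

(** * Unipotent matrices and solutions *)

Section HomDer.
Variables (R T : comNzRingType) (s : {rmorphism R -> T}) (D : R -> R) (E : T -> T).
Hypotheses (hD : is_derivation D) (hE : is_derivation E).
Let P r := s (D r) = E (s r).

Lemma hom_der1 : P 1. Proof. by rewrite /P (der1 hD) rmorph0 rmorph1 (der1 hE). Qed.
Lemma hom_derB a b : P a -> P b -> P (a - b).
Proof. by rewrite /P (derB hD) !rmorphB (derB hE) => -> ->. Qed.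
Lemma hom_derD a b : P a -> P b -> P (a + b).
Proof. by rewrite /P (derD hD) !rmorphD (derD hE) => -> ->. Qed.
Lemma hom_derM a b : P a -> P b -> P (a * b).
Proof. by rewrite /P (derM hD) rmorphD !rmorphM (derM hE) => -> ->. Qed.
End HomDer.

Lemma der_inverse (R : comNzRingType) (D : R -> R) a b : is_derivation D -> a * b = 1 ->
  D b = - (b * b * D a).
Proof.
move=> hD ab; have := der1 hD; rewrite -ab (derM hD) => /(congr1 (fun r => b * r)) e.
apply/eqP; rewrite -addr_eq0 -[X in _ == X](mulr0 b) -e; apply/eqP.
by rewrite -[D b in LHS]mul1r -ab; ring.
Qed.

Lemma hom_der_inv (R T : comNzRingType) (s : {rmorphism R -> T}) (D : R -> R) (E : T -> T) a b :
  is_derivation D -> is_derivation E -> a * b = 1 -> s (D a) = E (s a) -> s (D b) = E (s b).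
Proof.
move=> hD hE ab e; have sab : s a * s b = 1 by rewrite -rmorphM ab rmorph1.
by rewrite (der_inverse hD ab) (der_inverse hE sab) rmorphN !rmorphM e.
Qed.

Section Unipotent.
Variable d : nat.

(** Multiplication of these matrices adds their rows [a]. With the logarithms as the row, this is
    the fundamental matrix of the system they solve. *)
Definition ublk (T : comNzRingType) (a : nat -> T) : 'M[T]_(1 + d) :=
  block_mx 1%:M (\row_(i < d) a i) 0 1%:M.

Lemma ublk_mul (T : comNzRingType) (a b : nat -> T) :
  ublk a *m ublk b = ublk (fun i => a i + b i).
Proof.
rewrite /ublk mulmx_block !mulmx0 !mul0mx !mulmx1 !mul1mx addr0 add0r.
congr block_mx; rewrite ?addr0 ?add0r //.
by apply/rowP=> i; rewrite !mxE addrC.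
Qed.
Lemma det_ublk (T : comNzRingType) (a : nat -> T) : \det (ublk a) = 1.
Proof. by rewrite det_ublock !det1 mulr1. Qed.
Lemma map_ublk (T U : comNzRingType) (h : {rmorphism T -> U}) (a : nat -> T) :
  map_mx h (ublk a) = ublk (fun i => h (a i)).
Proof.
rewrite /ublk map_block_mx !map_mx1 map_mx0; congr block_mx.
by apply/rowP=> i; rewrite !mxE.
Qed.
Lemma ublk_ext (T : comNzRingType) (a b : nat -> T) :
  (forall i, (i < d)%N -> a i = b i) -> ublk a = ublk b.
Proof. by move=> h; congr block_mx; apply/rowP=> i; rewrite !mxE h. Qed.
Lemma ublkE (T : comNzRingType) (a : nat -> T) (i : 'I_d) :
  ublk a (lshift d ord0) (rshift 1 i) = a i.
Proof. by rewrite block_mxEur mxE. Qed.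
Lemma ublk_inj (T : comNzRingType) (a b : nat -> T) i :
  ublk a = ublk b -> (i < d)%N -> a i = b i.
Proof. by move=> e lt; rewrite -[i]/(val (Ordinal lt)) -!ublkE e. Qed.
Lemma ublk0 (T : comNzRingType) : ublk (fun _ => 0 : T) = 1%:M.
Proof.
rewrite [RHS]scalar_mx_block; congr block_mx; by apply/rowP=> i; rewrite !mxE.
Qed.
Lemma ublkK (T : comNzRingType) (a : nat -> T) : ublk a *m ublk (fun i => - a i) = 1%:M.
Proof. by rewrite ublk_mul -(ublk0 T); apply: ublk_ext => i _; rewrite subrr. Qed.
Lemma ublkVK (T : comNzRingType) (a : nat -> T) : ublk (fun i => - a i) *m ublk a = 1%:M.
Proof. by rewrite ublk_mul -(ublk0 T); apply: ublk_ext => i _; rewrite addNr. Qed.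

Lemma ublk_solve (T : comNzRingType) (a b : nat -> T) (g : 'M[T]_(1 + d)) :
  ublk a *m g = ublk b -> g = ublk (fun i => b i - a i).
Proof.
move/(congr1 (mulmx (ublk (fun i => - a i)))); rewrite mulmxA ublkVK mul1mx ublk_mul => ->.
by apply: ublk_ext => i _; rewrite addrC.
Qed.

Lemma ublk_descend (S T : comNzRingType) (j : {rmorphism S -> T}) (g : 'M[S]_(1 + d))
    (b : nat -> T) : injective j -> map_mx j g = ublk b ->
  exists a : nat -> S, [/\ g = ublk a, forall i, (i < d)%N -> j (a i) = b i &
    forall i, (d <= i)%N -> a i = 0].
Proof.
move=> jinj e.
(* The default 0 beyond [d] allows [dS (a i) = 0] to be asserted for every [i], as [sol]
   requires. *)
pose a i := oapp (fun k : 'I_d => g (lshift d ord0) (rshift 1 k)) 0 (insub i).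
have ja i : (i < d)%N -> j (a i) = b i.
  move=> lt; rewrite /a (insubT (fun k => (k < d)%N) lt) /=.
  by have /matrixP/(_ (lshift d ord0) (rshift 1 (Ordinal lt))) := e; rewrite ublkE mxE.
exists a; split=> //; last by move=> i le; rewrite /a insubF // ltnNge le.
apply/matrixP=> k l; apply: jinj.
have /matrixP/(_ k l) : map_mx j g = map_mx j (ublk a).
  by rewrite e map_ublk; apply: ublk_ext => i lt; rewrite ja.
by rewrite !mxE.
Qed.
End Unipotent.
Arguments ublk d {T} a.

(** * Constant coordinates of solutions *)

Section Solutions.
Variables (K : fieldType) (dK : K -> K) (hK : is_derivation dK) (L : {poly K}).
Variables (s : seq K) (M : {poly K}).
Hypothesis tM : tri dK s M.
Hypothesis Ls : forall f, f \in s -> apply_op id dK L f = 0.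
Hypothesis sL : size L = (size s).+1.

Section OneAlg.
Variables (S : comNzRingType) (kS : {rmorphism K -> S}) (dS : S -> S).
Hypothesis hS : dt_alg dK kS dS.
Let hd : is_derivation dS. Proof. by case: hS. Qed.

Definition sol (u : S) (a : nat -> S) : Prop :=
  (forall i, dS (a i) = 0) /\ u = lincomb kS s a.

(** [L] has order [size s] and kills [s], so it is a scalar multiple of the triangular [M], whose
    solutions in [S] are described by [tri_sol]. *)
Lemma sol_exists u : apply_op kS dS L u = 0 -> exists a, sol u a.
Proof.
have L0 : lead_coef L != 0 by rewrite lead_coef_eq0 -size_poly_eq0 sL.
rewrite (tri_unique hK tM Ls sL) apply_opZ => e.
have [|a [a0 ua]] := tri_sol hK hS tM (u := u); last by exists a.
have := congr1 (fun z => kS (lead_coef L)^-1 * z) e.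
by rewrite mulr0 mulrA -rmorphM mulVf // rmorph1 mul1r.
Qed.

Lemma sol_op u a : sol u a -> apply_op kS dS L u = 0.
Proof. by case=> a0 ->; apply: (kill_lincomb hS). Qed.

Lemma sol_uniq u a b i : sol u a -> sol u b -> (i < size s)%N -> a i = b i.
Proof.
move=> [a0 ua] [b0 ub] lt; apply/eqP; rewrite -subr_eq0; apply/eqP.
apply: (tri_free hK hS tM (a := fun i => a i - b i)) => // [j|].
  by rewrite (derB hd) a0 b0 subr0.
rewrite -[RHS](subrr u) {1}ua ub -sumrB; apply: eq_bigr => j _.
by rewrite mulrBl.
Qed.

Lemma sol_add u v a b : sol u a -> sol v b -> sol (u + v) (fun i => a i + b i).
Proof.
move=> [a0 ->] [b0 ->]; split=> [i|]; first by rewrite (derD hd) a0 b0 addr0.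
by rewrite -big_split; apply: eq_bigr => j _; rewrite mulrDl.
Qed.

(** Coordinates obtained by choice; by [sol_uniq] the entries below [size s] are independent of it,
    and this yields additivity and naturality. *)
Definition coefs (u : S) : nat -> S :=
  match pselect (exists a, sol u a) with
  | left h => sval (cid h)
  | right _ => fun=> 0
  end.
Lemma coefsP u a : sol u a -> sol u (coefs u).
Proof.
by move=> ua; rewrite /coefs; case: pselect => [h|[]]; [exact: svalP (cid h) | exists a].
Qed.
End OneAlg.

Lemma sol_hom (S S' : comNzRingType) (kS : {rmorphism K -> S}) (kS' : {rmorphism K -> S'})
    dS dS' (h : {rmorphism S -> S'}) u a : dt_alg_hom kS kS' dS dS' h ->
  sol kS dS u a -> sol kS' dS' (h u) (fun i => h (a i)).
Proof.
move=> [hk hd] [a0 ->]; split=> [i|]; first by rewrite -hd a0 rmorph0.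
by rewrite rmorph_sum; apply: eq_bigr => i _; rewrite rmorphM hk.
Qed.
End Solutions.

(** * Sufficiency for the additive group *)

Section Backward.
Variables (K : closedFieldType) (dK : K -> K) (F : fieldType) (inK : {rmorphism K -> F}).
Variables (x : F) (dF dtF : F -> F) (L : {poly K}).
Hypothesis charK : [pchar K] =i pred0.
Hypothesis hK : is_derivation dK.
Hypothesis hF : is_Kx_dfield inK dK x dF dtF.
Hypothesis L0 : L != 0.

Let dFK := Kx_dFK hF.
Let dtK := Kx_dtK hF.

Lemma PPV_log d (R : comNzRingType) (iF : {rmorphism F -> R}) dR dtR z :
  log_ext inK x dF dtF d iF dR dtR z ->
  PPV_ring dF dtF iF dR dtR
    (block_mx 0 (\row_(i < d) lpole inK x i) 0 0 : 'M[F]_(1 + d)) (ublk d z).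
Proof.
move=> lR; have hd := le_d lR.
split=> //; split; first exact: le_t lR.
split; first exact: le_comm lR.
split; first exact: le_dF lR.
split; first exact: le_tF lR.
split.
  rewrite /ublk !map_block_mx mulmx_block; congr block_mx.
  all: rewrite ?(map_mx0, mul0mx, mulmx0, mulmx1, add0r).
  - by apply/matrixP=> i j; rewrite !mxE; case: eqP; rewrite ?(der1 hd) ?(der0 hd).
  - by apply/matrixP=> i j; rewrite !mxE (le_dz lR).
  - by apply/matrixP=> i j; rewrite !mxE (der0 hd).
  - by apply/matrixP=> i j; rewrite !mxE; case: eqP; rewrite ?(der1 hd) ?(der0 hd).
split.
  exists 1; rewrite det_ublk mulr1; split=> // P P1 PB PM PF PY _.
  apply: (le_gen lR) => // i lt.
  by have := PY 0%N (lshift d ord0) (rshift 1 (Ordinal lt)); rewrite ublkE.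
split; first by move=> r /(le_cst lR)[k ->]; exists (inK k).
split; first exact: oner_neq0.
exact: le_simple lR.
Qed.

Section GaPoints.
Variables (d : nat) (R : comNzRingType) (iF : {rmorphism F -> R}) (dR dtR : R -> R).
Variable z : nat -> R.
Hypothesis lR : log_ext inK x dF dtF d iF dR dtR z.
Variables (S : comNzRingType) (kS : {rmorphism K -> S}) (dS : S -> S).
Hypothesis hS : dt_alg dK kS dS.
Let kR : {rmorphism K -> R} := iF \o inK.
Let PPV := PPV_log lR.

Lemma log_gal_hom (a : nat -> S) : (forall i, (i < d)%N -> dS (a i) = 0) ->
  exists s : {rmorphism R -> tensor kR kS}, gal_hom dR dtR (ublk d z) dS s (ublk d a).
Proof.
move=> a0.
have [s [sF sz]] := le_univ lR (tinl kR kS \o iF) (fun i => tinl kR kS (z i) + tinr kR kS (a i)).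
have hGD := gd_der dFK PPV kS; have hGT := gt_der dtK PPV hS.
have hd := le_d lR; have ht := le_t lR.
exists s; split=> //.
- apply: (le_gen lR).
  + exact: (hom_der1 s hd hGD).
  + by move=> a' b; apply: (hom_derB hd hGD).
  + by move=> a' b; apply: (hom_derM hd hGD).
  + by move=> f; rewrite (le_dF lR) !sF /= (gd_inl dFK PPV) (le_dF lR).
  + move=> i lt; rewrite (le_dz lR) // sF sz // (derD hGD) (gd_inl dFK PPV) (gd_inr dFK PPV).
    by rewrite addr0 (le_dz lR).
- apply: (le_gen lR).
  + exact: (hom_der1 s ht hGT).
  + by move=> a' b; apply: (hom_derB ht hGT).
  + by move=> a' b; apply: (hom_derM ht hGT).
  + by move=> f; rewrite (le_tF lR) !sF /= (gt_inl dtK PPV hS) (le_tF lR).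
  + move=> i lt; rewrite (le_tz lR) // sz // (derD hGT) (gt_inl dtK PPV hS) (gt_inr dtK PPV hS).
    by rewrite a0 // (le_tz lR) // !rmorph0 addr0.
by rewrite !map_ublk ublk_mul; apply: ublk_ext => i lt; rewrite sz.
Qed.

Lemma log_gal_intro (a : nat -> S) : (forall i, (i < d)%N -> dS (a i) = 0) ->
  Gal_pt inK dK iF dR dtR (ublk d z) kS dS (ublk d a).
Proof.
move=> a0; have [hd _] := hS.
have [s hs] := log_gal_hom a0.
have [|s' hs'] := @log_gal_hom (fun i => - a i); first by move=> i lt; rewrite (derN hd) a0 ?oppr0.
exact: (gal_intro dFK dtK PPV hS hs hs' (ublkK d a) (ublkVK d a)).
Qed.

(** The entries of [g] are the differences [sigma(z_i) - z_i]; they are killed by [dt] because each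
    [z_i] is. *)
Lemma log_gal_elim g : Gal_pt inK dK iF dR dtR (ublk d z) kS dS g ->
  exists a, (forall i, dS (a i) = 0) /\ g = ublk d a.
Proof.
move=> [_ [T [jR [jS [dT [dtT [sigma [ten H]]]]]]]]; have [hd _] := hS.
have [hdT [hdtT [dTR [dTS [tTR [tTS H']]]]]] := H.
have [_ [sd [st [sF [_ sY]]]]] := H'.
have jinj := gal_tensor_inj ten.
move: sY; rewrite (map_ublk d jR) (map_ublk d (sigma \o jR)) => /ublk_solve sY.
have [a [gE ja a0]] := ublk_descend jinj sY.
exists a; split=> // i; case: (ltnP i d) => lt; last by rewrite a0 // (der0 hd).
apply: jinj; rewrite -tTS ja //= (derB hdtT) -st !tTR (le_tz lR) // !rmorph0 subrr //.
Qed.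
End GaPoints.

Lemma Ga_backward : fundamental_set dK L ->
  is_PPV_group inK dK dF dtF (Ga_pt L) (fun S => (@GRing.add S)).
Proof.
move=> /(fundamental_setP hK)[s [M [tM sz Ls]]].
have sL : size L = (size s).+1 by rewrite sz prednK // size_poly_gt0.
have [R [iF [dR [dtR [z lR]]]]] := log_ext_exists charK hK hF (size s).
exists (1 + size s)%N, (block_mx 0 (\row_(i < size s) lpole inK x i) 0 0), R, iF, dR, dtR.
exists (ublk (size s) z); split; first exact: PPV_log.
exists (fun S kS dS u => ublk (size s) (coefs s kS dS u)); split.
  move=> S kS dS hS.
  have ex u : Ga_pt L kS dS u -> sol s kS dS u (coefs s kS dS u).
    by move=> /(sol_exists hK tM Ls sL hS)[a /coefsP].
  split; first by move=> u /ex[c0 _]; apply: (log_gal_intro lR hS).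
  split.
    move=> u v /ex[_ uE] /ex[_ vE] e; rewrite uE vE; apply: eq_bigr => i _.
    by rewrite (ublk_inj e).
  split.
    move=> g /(log_gal_elim lR hS)[a [a0 ->]]; exists (lincomb kS s a).
    have sa : sol s kS dS (lincomb kS s a) a by [].
    split; first exact: (sol_op Ls hS sa).
    by apply: ublk_ext => i lt; apply: (sol_uniq hK tM hS (coefsP sa) sa lt).
  move=> u v /ex su /ex sv; rewrite ublk_mul; apply: ublk_ext => i lt.
  have suv := sol_add hS su sv.
  exact: (sol_uniq hK tM hS (coefsP suv) suv lt).
move=> S S' kS kS' dS dS' h hS hS' hh u /(sol_exists hK tM Ls sL hS)[a /coefsP su].
rewrite map_ublk; apply: ublk_ext => i lt.
have sh := sol_hom hh su.
exact: (sol_uniq hK tM hS' (coefsP sh) sh lt).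
Qed.
End Backward.

(** * Sufficiency for the multiplicative group *)

Lemma der_mulrn (R : nzRingType) (D : R -> R) a n : is_derivation D -> D (a *+ n) = D a *+ n.
Proof.
by move=> hD; elim: n => [|n IH]; rewrite ?mulr0n ?(der0 hD) // !mulrS (derD hD) IH.
Qed.

(** [D f = E e] is the integrability condition for the equations [D X = e X] and [E X = f X]. *)
Lemma ld_comm (A : comNzRingType) (D E : A -> A) (e f : A) (x : laur A) :
  is_derivation D -> is_derivation E -> (forall a, D (E a) = E (D a)) -> D f = E e ->
  ld D e (ld E f x) = ld E f (ld D e x).
Proof.
move=> hD hE DE ef; rewrite (lfrac_repr x); move: (repr x) => [p n] /=.
rewrite !ld_frac //; apply: lfrac_eq => //; apply/polyP=> i; rewrite !coef_wder //.
rewrite (derD hD) (derD hE) !(derM hD) !(derM hE) !(derB hD) !(derB hE) DE.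
rewrite !(der_mulrn _ _ hD) !(der_mulrn _ _ hE) ef; ring.
Qed.

Section DiagUnipotent.
Variable d : nat.

Definition mblk (T : comNzRingType) (l : T) (a : nat -> T) : 'M[T]_(1 + (1 + d)) :=
  block_mx l%:M 0 0 (ublk d a).

Lemma mblk_mul (T : comNzRingType) (l m : T) (a b : nat -> T) :
  mblk l a *m mblk m b = mblk (l * m) (fun i => a i + b i).
Proof.
rewrite /mblk mulmx_block !mulmx0 !mul0mx !addr0 !add0r ublk_mul.
by rewrite -scalar_mxM.
Qed.
Lemma det_mblk (T : comNzRingType) (l : T) (a : nat -> T) : \det (mblk l a) = l.
Proof. by rewrite det_ublock det_ublk mulr1 det_scalar1. Qed.
Lemma map_mblk (T U : comNzRingType) (h : {rmorphism T -> U}) l (a : nat -> T) :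
  map_mx h (mblk l a) = mblk (h l) (fun i => h (a i)).
Proof. by rewrite /mblk map_block_mx !map_mx0 map_scalar_mx map_ublk. Qed.
Lemma mblk_ext (T : comNzRingType) (l m : T) (a b : nat -> T) :
  l = m -> (forall i, (i < d)%N -> a i = b i) -> mblk l a = mblk m b.
Proof. by move=> -> h; rewrite /mblk (ublk_ext h). Qed.
Lemma mblkE1 (T : comNzRingType) (l : T) (a : nat -> T) :
  mblk l a (lshift (1 + d) ord0) (lshift (1 + d) ord0) = l.
Proof. by rewrite block_mxEul mxE eqxx. Qed.
Lemma mblk1 (T : comNzRingType) : mblk 1 (fun _ => 0 : T) = 1%:M.
Proof. by rewrite /mblk ublk0 -scalar_mx_block. Qed.
Lemma mblkK (T : comNzRingType) (l m : T) (a : nat -> T) : l * m = 1 ->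
  mblk l a *m mblk m (fun i => - a i) = 1%:M /\ mblk m (fun i => - a i) *m mblk l a = 1%:M.
Proof.
move=> lm; rewrite !mblk_mul [m * l]mulrC lm -(mblk1 T).
by split; apply: mblk_ext => // i _; rewrite ?subrr ?addNr.
Qed.

Lemma mblk_descend (S T : comNzRingType) (j : {rmorphism S -> T}) (g : 'M[S]_(1 + (1 + d)))
    (m : T) (b : nat -> T) : injective j -> map_mx j g = mblk m b ->
  exists l (a : nat -> S), [/\ g = mblk l a, j l = m, forall i, (i < d)%N -> j (a i) = b i &
    forall i, (d <= i)%N -> a i = 0].
Proof.
move=> jinj e; have e' := e; rewrite -[g]submxK map_block_mx in e'.
have mU : map_mx j (drsubmx g) = ublk d b by have [_ _ _] := eq_block_mx e'.
have [a [gE ja a0]] := ublk_descend jinj mU.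
pose l := g (lshift (1 + d) ord0) (lshift (1 + d) ord0).
have jl : j l = m.
  by have /matrixP/(_ (lshift (1 + d) ord0) (lshift (1 + d) ord0)) := e; rewrite mblkE1 mxE.
exists l, a; split=> //; apply/matrixP=> r c; apply: jinj.
have /matrixP/(_ r c) : map_mx j g = map_mx j (mblk l a).
  by rewrite e map_mblk; apply: mblk_ext => // i lt; rewrite ja.
by rewrite !mxE.
Qed.
End DiagUnipotent.
Arguments mblk d {T} l a.

Section GmBackward.
Variables (K : closedFieldType) (dK : K -> K) (F : fieldType) (inK : {rmorphism K -> F}).
Variables (x : F) (dF dtF : F -> F) (L : {poly K}).
Hypothesis charK : [pchar K] =i pred0.
Hypothesis hK : is_derivation dK.
Hypothesis hF : is_Kx_dfield inK dK x dF dtF.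
Hypothesis L0 : L != 0.

Let dFK := Kx_dFK hF.
Let dtK := Kx_dtK hF.
Let hdF := Kx_dF hF.
Let hdt := Kx_dtF hF.

Section ExpExtension.
Variable hs : seq K.
Notation d := (size hs).
Variables (R : comNzRingType) (iF : {rmorphism F -> R}) (dR dtR : R -> R).
Variable z : nat -> R.
Hypothesis lR : log_ext inK x dF dtF d iF dR dtR z.
Let hd := le_d lR. Let ht := le_t lR.

(* [lw] plays the role of exp(x) * prod_i (x - i)^(h_i); the factor exp(x) makes it
   transcendental over the logarithms even when [hs] is empty. *)
Definition exp_b : F := 1 + \sum_(i < d) inK hs`_i * lpole inK x i.
(** The logarithmic [dt]-derivative of the exponential element: differentiating the exponents [h_i]
    produces logarithms, so these have to be adjoined first. *)
Definition exp_v : R := \sum_(i < d) iF (inK (dK hs`_i)) * z i.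

Definition exp_d : laur R -> laur R := ld dR (iF exp_b).
Definition exp_t : laur R -> laur R := ld dtR exp_v.
Definition exp_in : {rmorphism F -> laur R} := @lin R \o (polyC \o iF).

Lemma exp_d_der : is_derivation exp_d. Proof. exact: ld_derivation. Qed.
Lemma exp_t_der : is_derivation exp_t. Proof. exact: ld_derivation. Qed.

Lemma exp_compat : dR exp_v = dtR (iF exp_b).
Proof.
rewrite (le_tF lR) /exp_b (derD hdt) (der1 hdt) add0r (der_sum hdt) rmorph_sum.
rewrite (der_sum hd); apply: eq_bigr => i _.
rewrite (derM hd) (derM hdt) (dt_lpole hK hF) mulr0 addr0 dtK (le_dF lR) dFK rmorph0 mul0r add0r.
by rewrite (le_dz lR) // rmorphM.
Qed.

Lemma exp_comm r : exp_d (exp_t r) = exp_t (exp_d r).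
Proof. by apply: ld_comm => //; [exact: le_comm lR | exact: exp_compat]. Qed.

(** [le_logder] moves the solution down to [F], where [no_exp_solution] applies with the nonzero
    scalar [k - j]. *)
Lemma exp_no_sol j k r : j <> k ->
  dR r + (iF exp_b *+ j - iF exp_b *+ k) * r = 0 -> r = 0.
Proof.
move=> jk /eqP; rewrite addr_eq0 => /eqP e; apply/eqP; apply: contraT => r0.
have [|f f0 df] := le_logder lR (c := inK (k%:R - j%:R) * exp_b) r0.
  rewrite e -mulNr; congr (_ * _).
  by rewrite opprB rmorphB !rmorph_nat mulrBl !mulr_natl rmorphB !rmorphMn.
have ls : exp_b = 1 + logsum inK x [seq (hs`_i, i%:R) | i <- index_iota 0 d].
  by rewrite /exp_b /logsum big_map big_mkord.
case/negP: f0; apply/eqP; rewrite ls in df; apply: (no_exp_solution hF _ df).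
by rewrite subr_eq0; apply/eqP=> /(natK_inj charK)/esym.
Qed.

Definition exp_Y : 'M[laur R]_(1 + (1 + d)) := mblk d (lw R) (fun i => lin (z i)%:P).

Lemma PPV_exp : PPV_ring dF dtF exp_in exp_d exp_t
    (block_mx exp_b%:M 0 0 (block_mx 0 (\row_(i < d) lpole inK x i) 0 0 : 'M[F]_(1 + d)))
    exp_Y.
Proof.
have hed := exp_d_der; have het := exp_t_der.
split=> //; split=> //; split; first exact: exp_comm.
split; first by move=> f; rewrite /exp_d /= ld_inC // (le_dF lR).
split; first by move=> f; rewrite /exp_t /= ld_inC // (le_tF lR).
split.
  rewrite /exp_Y /mblk !map_block_mx mulmx_block; congr block_mx.
  - rewrite map_mx0 mul0mx addr0; apply/matrixP=> i j; rewrite !mxE big_ord1 !mxE !ord1 /=.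
    by rewrite !mulr1n /exp_d ld_w.
  - rewrite !map_mx0 mul0mx mulmx0 addr0; apply/matrixP=> i j; rewrite !mxE; exact: (der0 hed).
  - rewrite !map_mx0 mul0mx mulmx0 addr0; apply/matrixP=> i j; rewrite !mxE; exact: (der0 hed).
  rewrite map_mx0 mul0mx add0r /ublk mulmx_block; congr block_mx.
  all: rewrite ?(map_mx0, mul0mx, mulmx0, mulmx1, add0r).
  - by apply/matrixP=> i j; rewrite !mxE; case: eqP; rewrite ?(der1 hed) ?(der0 hed).
  - by apply/matrixP=> i j; rewrite !mxE /exp_d ld_inC // (le_dz lR).
  - by apply/matrixP=> i j; rewrite !mxE (der0 hed).
  - by apply/matrixP=> i j; rewrite !mxE; case: eqP; rewrite ?(der1 hed) ?(der0 hed).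
split.
  exists (lwi R); rewrite det_mblk lwwi; split=> // P P1 PB PM PF PY Pi.
  have P0 : P 0 by rewrite -(subrr 1); apply: PB.
  have PD p q : P p -> P q -> P (p + q).
    by move=> Pp Pq; rewrite -[q]opprK; apply: (PB) => //; rewrite -sub0r; apply: PB.
  apply: laur_ind => //.
  - apply: (le_gen lR (P := fun c => P (lin c%:P))) => //.
    + by move=> r s Pr Ps; rewrite polyCB rmorphB; apply: PB.
    + by move=> r s Pr Ps; rewrite polyCM rmorphM; apply: PM.
    + move=> i lt.
      have := PY 0%N (rshift 1 (lshift d ord0)) (rshift 1 (rshift 1 (Ordinal lt))).
      by rewrite /= block_mxEdr ublkE.
  - by have := PY 0%N (lshift (1 + d) ord0) (lshift (1 + d) ord0); rewrite /= mblkE1.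
  - exact: (Pi 0%N).
split.
  move=> r /(ld_cst hd exp_no_sol)[c /(le_cst lR)[k ->] ->].
  by exists (inK k).
split; first exact: oner_neq0.
exact: (ld_simple hd exp_no_sol (le_simple lR)).
Qed.

Section GmPoints.
Variables (S : comNzRingType) (kS : {rmorphism K -> S}) (dS : S -> S).
Hypothesis hS : dt_alg dK kS dS.
Let hdS : is_derivation dS. Proof. by case: hS. Qed.
Let kR : {rmorphism K -> laur R} := exp_in \o inK.
Notation s := [seq dK h | h <- hs].

Lemma exp_lincomb (a : nat -> S) :
  lincomb kS s a = \sum_(i < d) a i * kS (dK hs`_i).
Proof.
by rewrite /lincomb size_map; apply: eq_bigr => i _; rewrite (nth_map 0).
Qed.

Lemma exp_gal_hom (l m : S) (a : nat -> S) : l * m = 1 -> sol s kS dS (dS l * m) a ->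
  exists sg : {rmorphism laur R -> tensor kR kS},
    gal_hom exp_d exp_t exp_Y dS sg (mblk d l a).
Proof.
move=> lm [a0 la].
pose jl : {rmorphism laur R -> tensor kR kS} := tinl kR kS.
pose jr : {rmorphism S -> tensor kR kS} := tinr kR kS.
have [g [gF gz]] := le_univ lR (jl \o exp_in) (fun i => jl (lin (z i)%:P) + jr (a i)).
have unit_w : (jl (lw R) * jr l) * (jl (lwi R) * jr m) = 1.
  by rewrite mulrACA -!rmorphM lwwi lm !rmorph1 mulr1.
have [sg [sgC sgw]] := laur_univ g unit_w.
have hGD := gd_der dFK PPV_exp kS; have hGT := gt_der dtK PPV_exp hS.
have hed := exp_d_der; have het := exp_t_der.
have gdl := gd_inl dFK PPV_exp kS; have gdr := gd_inr dFK PPV_exp kS.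
have gtl := gt_inl dtK PPV_exp hS; have gtr := gt_inr dtK PPV_exp hS.
(* Compatibility with [dt] rests on this: shifting each [z_i] by [a_i] changes [exp_v] by the sum of
   the [a_i dt(h_i)], which is the logarithmic derivative of [l]. *)
have gv : g exp_v = jl (lin exp_v%:P) + jr (dS l * m).
  rewrite la exp_lincomb rmorph_sum /exp_v !rmorph_sum -big_split; apply: eq_bigr => i _.
  rewrite rmorphM gF gz // mulrDr; congr (_ + _); first by rewrite !rmorphM.
  by rewrite [RHS]rmorphM mulrC; congr (_ * _); exact: (tin_bal kR kS).
exists sg; split.
- by move=> f; rewrite /= sgC gF.
- apply: laur_ind.
  + by move=> p q; apply: (hom_derD hed hGD).
  + by move=> p q; apply: (hom_derM hed hGD).
  + move=> c; rewrite /exp_d ld_inC // !sgC; move: c; apply: (le_gen lR).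
    * exact: (hom_der1 g hd hGD).
    * by move=> p q; apply: (hom_derB hd hGD).
    * by move=> p q; apply: (hom_derM hd hGD).
    * by move=> f; rewrite (le_dF lR) !gF /= gdl /exp_d ld_inC // (le_dF lR).
    * move=> i lt; rewrite (le_dz lR) // gF gz // (derD hGD) gdl gdr addr0.
      by rewrite /exp_d ld_inC // (le_dz lR).
  + rewrite {1}/exp_d ld_w // rmorphM sgC sgw (derM hGD) gdl gdr mulr0 addr0 gF.
    by rewrite /exp_d ld_w // rmorphM mulrA.
  + apply: (hom_der_inv hed hGD (lwwi R)).
    rewrite {1}/exp_d ld_w // rmorphM sgC sgw (derM hGD) gdl gdr mulr0 addr0 gF.
    by rewrite /exp_d ld_w // rmorphM mulrA.
- have tw : sg (exp_t (lw R)) = gt exp_t dS (sg (lw R)).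
    rewrite {1}/exp_t ld_w // rmorphM sgC sgw (derM hGT) gtl gtr gv.
    rewrite /exp_t ld_w //.
    have -> : tinl kR kS (lin exp_v%:P * lw R) = jl (lin exp_v%:P) * jl (lw R).
      exact: (rmorphM jl).
    have -> : tinr kR kS (dS l) = jr (dS l * m) * jr l.
      by rewrite -rmorphM -mulrA [m * l]mulrC lm mulr1.
    ring.
  apply: laur_ind.
  + by move=> p q; apply: (hom_derD het hGT).
  + by move=> p q; apply: (hom_derM het hGT).
  + move=> c; rewrite /exp_t ld_inC // !sgC; move: c; apply: (le_gen lR).
    * exact: (hom_der1 g ht hGT).
    * by move=> p q; apply: (hom_derB ht hGT).
    * by move=> p q; apply: (hom_derM ht hGT).
    * by move=> f; rewrite (le_tF lR) !gF /= gtl /exp_t ld_inC // (le_tF lR).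
    * move=> i lt; rewrite (le_tz lR) // gz // (derD hGT) gtl gtr a0.
      by rewrite /exp_t ld_inC // (le_tz lR) // !rmorph0 addr0.
  + exact: tw.
  + exact: (hom_der_inv het hGT (lwwi R)).
rewrite /exp_Y !map_mblk mblk_mul; apply: mblk_ext => // i lt.
by rewrite /= sgC gz.
Qed.

Lemma exp_gal_intro (l m : S) (a : nat -> S) : l * m = 1 -> sol s kS dS (dS l * m) a ->
  Gal_pt inK dK exp_in exp_d exp_t exp_Y kS dS (mblk d l a).
Proof.
move=> lm sa; have ml : m * l = 1 by rewrite mulrC.
have [sg hsg] := exp_gal_hom lm sa.
have [sg' hsg'] : exists sg' : {rmorphism laur R -> tensor kR kS},
    gal_hom exp_d exp_t exp_Y dS sg' (mblk d m (fun i => - a i)).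
  apply: exp_gal_hom ml _; case: sa => a0 la; split=> [i|]; first by rewrite (derN hdS) a0 oppr0.
  have -> : dS m * l = - (dS l * m).
    by apply/eqP; rewrite -addr_eq0 addrC [dS m * l]mulrC -(derM hdS) lm (der1 hdS).
  by rewrite la !exp_lincomb -sumrN; apply: eq_bigr => i _; rewrite mulNr.
have [e1 e2] := mblkK d a lm.
exact: (gal_intro dFK dtK PPV_exp hS hsg hsg' e1 e2).
Qed.

Lemma exp_gal_elim g : Gal_pt inK dK exp_in exp_d exp_t exp_Y kS dS g ->
  exists l m a, [/\ l * m = 1, sol s kS dS (dS l * m) a & g = mblk d l a].
Proof.
move=> [[g' gg'] [T [jR [jS [dT [dtT [sigma [ten H]]]]]]]].
have [hdT [hdtT [dTR [dTS [tTR [tTS H']]]]]] := H.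
have [_ [sd [st [sF [_ sY]]]]] := H'.
have jinj := gal_tensor_inj ten.
have jk k : jR (exp_in (inK k)) = jS (kS k) by case: ten.
pose sw := sigma (jR (lw R)); pose jz i := jR (lin (z i)%:P).
have jw : jR (lw R) * jR (lwi R) = 1 by rewrite -rmorphM lwwi rmorph1.
move: sY; rewrite /exp_Y (map_mblk d jR) (map_mblk d (sigma \o jR)) => sY.
have [_ e2] := mblkK d jz jw.
have {}sY : map_mx jS g = mblk d (jR (lwi R) * sw) (fun i => sigma (jz i) - jz i).
  rewrite -[LHS]mul1mx -e2 -mulmxA sY mblk_mul; apply: mblk_ext => // i _.
  by rewrite addrC.
have [l [a [gE jl ja a0]]] := mblk_descend jinj sY.
have da i : dS (a i) = 0.
  case: (ltnP i d) => lt; last by rewrite a0 // (der0 hdS).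
  apply: jinj; rewrite -tTS ja // (derB hdtT) -st !tTR /exp_t ld_inC // (le_tz lR) //.
  by rewrite !rmorph0 subrr.
pose m := g' (lshift (1 + d) ord0) (lshift (1 + d) ord0).
have lm : l * m = 1.
  have /matrixP/(_ (lshift (1 + d) ord0) (lshift (1 + d) ord0)) := gg'.
  rewrite gE -[g']submxK /mblk mulmx_block block_mxEul mul0mx addr0 !mxE big_ord1.
  by rewrite !mxE eqxx !mulr1n /m.
exists l, m, a; split=> //; split=> //.
have swE : sw = jR (lw R) * jS l by rewrite jl mulrA jw mul1r.
have vE : sigma (jR (lin exp_v%:P)) = jR (lin exp_v%:P) + jS (lincomb kS s a).
  rewrite exp_lincomb /exp_v !rmorph_sum -big_split; apply: eq_bigr => i _.
  rewrite !rmorphM -/(jz i) [jS (a i)]ja // [X in _ = _ + X]mulrC -jk.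
  have -> : sigma (jR (lin (iF (inK (dK hs`_i)))%:P)) = jR (lin (iF (inK (dK hs`_i)))%:P).
    exact: sF.
  by rewrite mulrBr addrC subrK.
(* The [dt]-derivative of [sigma(w) = w l] is computed in two ways, and the unit [w] is
   cancelled. *)
have e : jS (dS l) = jS (lincomb kS s a * l).
  have : dtT sw = sigma (jR (lin exp_v%:P)) * sw.
    by rewrite /sw -st tTR /exp_t ld_w // !rmorphM.
  rewrite {1}swE (derM hdtT) tTR /exp_t ld_w // tTS vE swE => h.
  have : jR (lw R) * jS (dS l) = jR (lw R) * jS (lincomb kS s a * l).
    apply: (addrI (jR (lin exp_v%:P * lw R) * jS l)); rewrite h !rmorphM; ring.
  move/(congr1 (fun t => jR (lwi R) * t)).
  by rewrite !mulrA [jR (lwi R) * _]mulrC jw !mul1r.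
by rewrite (jinj _ _ e) -mulrA lm mulr1.
Qed.
End GmPoints.
End ExpExtension.

(** Differentiating the solutions of [L * 'X] loses only one dimension: if [M] annihilates the
    derivatives, [M * 'X] kills the original set, which bounds the order of [M] from below. *)
Lemma Gm_fundamental_tri : fundamental_set dK (L * 'X) ->
  exists hs M, [/\ tri dK [seq dK h | h <- hs] M, size L = (size hs).+1 &
    forall f, f \in [seq dK h | h <- hs] -> apply_op id dK L f = 0].
Proof.
move=> /(fundamental_setP hK)[s0 [M0 [tM0 sz Ls0]]].
rewrite size_mulX //= in sz.
have [s [M [tM sl Ml]]] := tri_greedy hK [seq dK f | f <- s0].
have [mM sM] := tri_size tM.
have Ls f : f \in s -> apply_op id dK L f = 0.
  by move=> /sl/mapP[f' f's ->]; rewrite -(apply_opX idfun) Ls0.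
have le1 : (size s < size L)%N.
  by rewrite ltnNge; apply/negP=> le; have := tri_order hK tM Ls le; apply/eqP.
have le2 : (size L < (size s).+2)%N.
  rewrite ltnNge; apply/negP=> le; have := monic_neq0 mM; apply/negP; rewrite negbK.
  have : M * 'X = 0.
    apply: (tri_order hK tM0) => [f fs|]; first by rewrite (apply_opX idfun) Ml // map_f.
    by rewrite size_mulX ?monic_neq0 // sM sz.
  by move/eqP; rewrite mulf_eq0 polyX_eq0 orbF.
have [hs sE] : exists hs, s = [seq dK a | a <- hs].
  elim: s sl {tM sM Ls le1 le2} => [|a s IH] sl; first by exists [::].
  have [|s' ->] := IH; first by move=> f fs; apply: sl; rewrite inE fs orbT.
  by have /mapP[a' _ ->] := sl a (mem_head _ _); exists (a' :: s').
exists hs, M; rewrite -sE; split=> //.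
have -> : size hs = size s by rewrite sE size_map.
by apply/eqP; rewrite eqn_leq le1 andbT -ltnS.
Qed.

Lemma Gm_backward : fundamental_set dK (L * 'X) ->
  is_PPV_group inK dK dF dtF (Gm_pt L) (fun S => (@GRing.mul S)).
Proof.
move=> /Gm_fundamental_tri[hs [M [tM sL Ls]]].
set s := [seq dK h | h <- hs] in tM Ls.
have ss : size s = size hs by rewrite size_map.
have sL' : size L = (size s).+1 by rewrite ss.
have [R [iF [dR [dtR [z lR]]]]] := log_ext_exists charK hK hF (size hs).
pose d := size hs.
eexists (1 + (1 + d))%N, _, (laur R), (exp_in iF), (exp_d hs iF dR), (exp_t hs iF dtR z).
exists (exp_Y hs z); split; first exact: (PPV_exp lR).
pose good (S : comNzRingType) (kS : {rmorphism K -> S}) (dS : S -> S) u a :=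
  exists v, u * v = 1 /\ sol s kS dS (dS u * v) a.
pose cf (S : comNzRingType) (kS : {rmorphism K -> S}) (dS : S -> S) (u : S) : nat -> S :=
  match pselect (exists a, good S kS dS u a) with
  | left h => sval (cid h)
  | right _ => fun=> 0
  end.
have cfP S kS dS u a : good S kS dS u a -> good S kS dS u (cf S kS dS u).
  by move=> ga; rewrite /cf; case: pselect => [h|[]]; [exact: svalP (cid h) | exists a].
have inv_uniq (S : comNzRingType) (m v v' : S) : m * v = 1 -> m * v' = 1 -> v = v'.
  by move=> e e'; rewrite -[v]mulr1 -e' mulrA [v * m]mulrC e mul1r.
have good_uniq (S : comNzRingType) (kS : {rmorphism K -> S}) dS u a b i :
    dt_alg dK kS dS -> good S kS dS u a -> good S kS dS u b -> (i < d)%N -> a i = b i.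
  move=> hS [v [uv sa]] [v' [uv' sb]] lt; rewrite -(inv_uniq _ _ _ _ uv uv') in sb.
  by apply: (sol_uniq hK tM hS sa sb); rewrite ss.
(* The scalar block is the point itself, which gives injectivity at once; the unipotent block holds
   the coordinates of its logarithmic derivative. *)
exists (fun S kS dS u => mblk d u (cf S kS dS u)); split.
  move=> S kS dS hS; have [hd _] := hS.
  have ex u : Gm_pt L kS dS u -> good S kS dS u (cf S kS dS u).
    move=> [v [uv /(sol_exists hK tM Ls sL' hS)[a sa]]].
    by apply: (cfP _ _ _ _ a); exists v.
  split; first by move=> u /ex[v [uv sa]]; apply: (exp_gal_intro lR hS uv sa).
  split.
    by move=> u v _ _ e; rewrite -(mblkE1 d u (cf S kS dS u)) e mblkE1.
  split.
    move=> g /(exp_gal_elim lR hS)[l [m [a [lm sa ->]]]]; exists l.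
    have gl : good S kS dS l a by exists m.
    split; first by exists m; split=> //; exact: (sol_op Ls hS sa).
    by apply: mblk_ext => // i lt; apply: (good_uniq _ _ _ _ _ _ _ hS (cfP _ _ _ _ _ gl) gl lt).
  move=> u v /ex gu /ex gv; rewrite mblk_mul; apply: mblk_ext => // i lt.
  have guv : good S kS dS (u * v) (fun i => cf S kS dS u i + cf S kS dS v i).
    have [u' [uu' su]] := gu; have [v' [vv' sv]] := gv.
    exists (u' * v'); rewrite mulrACA uu' vv' mulr1; split=> //.
    have -> : dS (u * v) * (u' * v') = (dS u * u') * (v * v') + (u * u') * (dS v * v').
      by rewrite (derM hd); ring.
    by rewrite uu' vv' mulr1 mul1r; apply: (sol_add hS).
  exact: (good_uniq _ _ _ _ _ _ _ hS (cfP _ _ _ _ _ guv) guv lt).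
move=> S S' kS kS' dS dS' h hS hS' hh u [v [uv /(sol_exists hK tM Ls sL' hS)[a sa]]].
rewrite map_mblk; apply: mblk_ext => // i lt.
have gu : good S kS dS u a by exists v.
have [v' [uv' su]] := cfP _ _ _ _ _ gu.
have gh : good S' kS' dS' (h u) (fun i => h (cf S kS dS u i)).
  exists (h v'); rewrite -rmorphM uv' rmorph1; split=> //.
  by have [_ <-] := hh; rewrite -rmorphM; apply: (sol_hom hh).
exact: (good_uniq _ _ _ _ _ _ _ hS' (cfP _ _ _ _ _ gh) gh lt).
Qed.
End GmBackward.

Theorem mainTheorem9 (K : closedFieldType) (dK : K -> K)
  (F : fieldType) (inK : {rmorphism K -> F}) (x : F) (dF dtF : F -> F)
  (L : {poly K}) :
  [pchar K] =i pred0 ->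
  is_derivation dK ->
  is_Kx_dfield inK dK x dF dtF ->
  L != 0 ->
  (is_PPV_group inK dK dF dtF (Gm_pt L) (fun S => (@GRing.mul S))
     <-> fundamental_set dK (L * 'X)) /\
  (is_PPV_group inK dK dF dtF (Ga_pt L) (fun S => (@GRing.add S))
     <-> fundamental_set dK L).
Proof.
move=> charK hK hF L0; split; split.
- exact: (Gm_forward_fundamental charK hK hF L0).
- exact: (Gm_backward charK hK hF L0).
- exact: (Ga_forward_fundamental charK hK hF L0).
- exact: (Ga_backward charK hK hF L0).
Qed.
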